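(* Let $a$ and $q$ be positive coprime integers, and let $f$ be a smooth function on $(0,\infty)$ whose Mellin transform $\widetilde{f}(s)=\int_0^\infty f(x)x^{s}\,\frac{dx}{x}$ extends to a meromorphic function on $\mathbb{C}$ whose only possible pole is at $s=0$, and which has rapid decay as $|s|\to\infty$ in every fixed vertical strip $-B\le \operatorname{Re}(s)\le B$. Then there are constants $c_1,c_2,c_3$ (depending only on $f$) such that for every $\varepsilon>0$, $$S(q,a;f)=a^{-1/2}\big(c_1\log(q/a)+c_2\big)+c_3q^{-1/2}+\sqrt{\tfrac{a}{q}}\,S(a,-q;f)+O\Big(q^{-1/2+\varepsilon}\,\tfrac{a}{q}\Big),$$ and $$S(q,-a;f)=\sqrt{\tfrac{a}{q}}\,S(a,q;f)+c_3q^{-1/2}+O\Big(q^{-1/2+\varepsilon}\,\tfrac{a}{q}\Big),$$ where the implied constants depend only on $f$ and $\varepsilon$.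
   Context: For a positive integer $r$ and an integer $b$ coprime to $r$, define $$S(r,b;f)=\mathop{\sum\sum}_{\substack{m,n\ge 1\\ n\equiv bm \ (\mathrm{mod}\ r)}}\frac{1}{\sqrt{mn}}\,f\Big(\frac{mn}{r}\Big).$$
   Formalization: The possible pole at s=0 is taken to be at most simple (for a higher-order pole the formula fails: a power of log q beyond the first appears), and the Mellin integral is assumed to converge absolutely in some strip to the right of 0 (otherwise S may diverge). *)

(* Defs.v *)
From Stdlib Require Import Reals ZArith Znumtheory.
From Coquelicot Require Import Coquelicot.
Open Scope R_scope.

Definition smooth_pos (f : R -> C) : Prop :=
  forall (n : nat) (x : R), 0 < x ->
    ex_derive_n (fun t => Re (f t)) n x /\ ex_derive_n (fun t => Im (f t)) n x.

(* x ^ s = exp (s ln x) for x > 0 and complex s. *)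
Definition Rcpow (x : R) (s : C) : C :=
  (Rpower x (Re s) * cos (Im s * ln x), Rpower x (Re s) * sin (Im s * ln x)).

Definition mellin_integrand (f : R -> C) (s : C) (x : R) : C :=
  (f x * Rcpow x s / RtoC x)%C.

(* The Mellin integral of f at s converges absolutely and its value is v;
   for f continuous on (0, oo) this is the Lebesgue integral. *)
Definition is_mellin (f : R -> C) (s v : C) : Prop :=
  ex_RInt_gen (fun x => Cmod (mellin_integrand f s x))
    (at_right 0) (Rbar_locally p_infty) /\
  is_RInt_gen (V := C_R_NormedModule) (mellin_integrand f s)
    (at_right 0) (Rbar_locally p_infty) v.

Definition holomorphic_at (F : C -> C) (z : C) : Prop :=
  @ex_derive C_AbsRing C_NormedModule F z.

(* F is meromorphic at z, with a pole of order at most k there. The value of F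
   at z itself is irrelevant. *)
Definition pole_order_le (k : nat) (F : C -> C) (z : C) : Prop :=
  exists G : C -> C,
    locally z (fun s => holomorphic_at G s) /\
    locally z (fun s => s <> z -> F s = (G s / (s - z) ^ k)%C).

Definition rapid_decay_strips (F : C -> C) : Prop :=
  forall (B : R) (N : nat), exists K T : R, forall s : C,
    - B <= Re s <= B -> T <= Cmod s -> Cmod (F s) * Cmod s ^ N <= K.

(* Indices are shifted: position (i, j) carries m = i + 1 and n = j + 1. *)
Definition S_term (r b : Z) (f : R -> C) (i j : nat) : C :=
  let m := Z.of_nat (i + 1) in
  let n := Z.of_nat (j + 1) in
  if Zdivide_dec r (n - b * m)
  then (f (IZR (m * n) / IZR r)%R / RtoC (sqrt (IZR (m * n))))%C
  else RtoC 0.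

Definition double_abs_summable (u : nat -> nat -> C) : Prop :=
  (forall i, ex_series (fun j => Cmod (u i j))) /\
  ex_series (fun i => Series (fun j => Cmod (u i j))).

Definition CSeries (u : nat -> C) : C :=
  (Series (fun n => Re (u n)), Series (fun n => Im (u n))).

(* [Series] is a total function, so this is the double sum of the mathematics
   only when [double_abs_summable (S_term r b f)] holds. *)
Definition S_sum (r b : Z) (f : R -> C) : C :=
  CSeries (fun i => CSeries (fun j => S_term r b f i j)).

(* Main.v *)
Require Import Defs.
From Stdlib Require Import Reals ZArith Znumtheory Lra Lia List ClassicalEpsilon.
From Coquelicot Require Import Coquelicot.
Open Scope R_scope.

(** Write [g x = f x / sqrt x].  Mellin inversion (Fourier inversion with the
    Poisson kernel) followed by contour shifts to a line far to the right and to
    [Re s = -3/2] shows that [f] and its increments decay rapidly at infinity and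
    that [f x = c0 + O(x^(3/2))] at 0, with [f - c0] given by an inverse Mellin
    integral on that line.

    In [S(q, a)] put [n = a m + q l].  The terms with [l = 0] give
    [a^(-1/2) * sum_m f(a m^2 / q) / m]; by a quadrature rule exact on cubics
    this is [a^(-1/2) (c1 log (q / a) + c2)] up to [a^(-1/2) (a / q)^(3/2)].  For
    [l > 0] the terms are [q^(-1/2) g (m l + a m^2 / q)], close to
    [q^(-1/2) g (m l)], whose sum is [c3 q^(-1/2)].  For [l < 0], with [l]
    replaced by [-l], they are [q^(-1/2) g (n l / a + n^2 / (a q))] over
    [n = - q l mod a], close to the terms of [sqrt (a / q) S(a, -q)].  Each
    perturbation costs [O(q^(-1/2) a / q)], because for fixed [l] the integers [n]
    in one class mod [a] are spaced by [a].  For [S(q, -a)] one has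
    [n + a m = q l], and the terms with [a m <= n] and with [a m > n] play the
    roles of [l > 0] and [l < 0]. *)

(** * Integrals of complex-valued functions of a real variable *)

(** All bounds on [f] come from the decay of its Mellin transform: on a line [Re s = sigma] the
    inverse integral converges absolutely, which gives the size [x^(-sigma)] and, by the mean value
    theorem applied to [u^(-s)], a Lipschitz constant. The abscissa [-3/2] is dictated by the error
    term, since [a^(-1/2) (a/q)^(3/2) = q^(-1/2) a/q]. On that line the diagonal terms are
    superpositions of [u^(2 - 2it)]. Their second and third derivatives are not absolutely summable
    over the integers, while the fourth is [O((1 + t^2)^2 u^(-2))]; hence a rule exact on cubics,
    and a decay of [F] strong enough to absorb [t^4]. No residue is computed: at the pole only
    differences such as [x^(-s) - 1] are integrated, and [c0] appears as the limit of [f] at 0. In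
    the same way [c2] is the limit at 0 of an expression with small oscillation, so Euler's constant
    is never isolated. The lattice sums are unordered sums, because the substitutions permute pairs
    of indices. The argument yields [q^(-1/2) a/q], and [1 <= q] supplies the factor [q^eps]. *)

Definition ccont (f : R -> C) (t : R) : Prop :=
  continuous (fun t => Re (f t)) t /\ continuous (fun t => Im (f t)) t.

Definition CI (f : R -> C) (a b : R) : C :=
  (RInt (fun t => Re (f t)) a b, RInt (fun t => Im (f t)) a b).

Lemma continuous_Rplus (f g : R -> R) t :
  continuous f t -> continuous g t -> continuous (fun t => f t + g t) t.
Proof. intros Hf Hg; exact (continuous_plus (V := R_NormedModule) f g t Hf Hg). Qed.

Lemma continuous_Rminus (f g : R -> R) t :
  continuous f t -> continuous g t -> continuous (fun t => f t - g t) t.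
Proof. intros Hf Hg; exact (continuous_minus (V := R_NormedModule) f g t Hf Hg). Qed.

Lemma continuous_Rmult (f g : R -> R) t :
  continuous f t -> continuous g t -> continuous (fun t => f t * g t) t.
Proof. intros Hf Hg; exact (continuous_mult (K := R_AbsRing) f g t Hf Hg). Qed.

Lemma continuous_of_derive (f : R -> R) t : ex_derive f t -> continuous f t.
Proof. exact (ex_derive_continuous (K := R_AbsRing) (V := R_NormedModule) f t). Qed.

Lemma continuous_eps (f : R -> R) t :
  continuous f t <->
  forall e, 0 < e -> exists d, 0 < d /\
    forall s, Rabs (s - t) < d -> Rabs (f s - f t) < e.
Proof.
  split.
  - intros H e He.
    destruct (proj1 (filterlim_locally f (f t)) H (mkposreal e He)) as [d Hd].
    exists d; split; [apply cond_pos|]. intros s Hs; exact (Hd s Hs).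
  - intros H. apply filterlim_locally. intros e.
    destruct (H e (cond_pos e)) as [d [Hd H1]].
    exists (mkposreal d Hd). intros s Hs; exact (H1 s Hs).
Qed.

Lemma ccont_const (c : C) t : ccont (fun _ => c) t.
Proof. split; apply continuous_const. Qed.

Lemma ccont_RtoC (g : R -> R) t : continuous g t -> ccont (fun t => RtoC (g t)) t.
Proof. intros H; split; [exact H|apply continuous_const]. Qed.

Lemma ccont_pair (g h : R -> R) t :
  continuous g t -> continuous h t -> ccont (fun t => (g t, h t)) t.
Proof. intros Hg Hh; split; assumption. Qed.

Lemma ccont_plus f g t : ccont f t -> ccont g t -> ccont (fun t => f t + g t)%C t.
Proof. intros [] []; split; now apply continuous_Rplus. Qed.

Lemma ccont_minus f g t : ccont f t -> ccont g t -> ccont (fun t => f t - g t)%C t.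
Proof. intros [] []; split; now apply continuous_Rminus. Qed.

Lemma ccont_mult f g t : ccont f t -> ccont g t -> ccont (fun t => f t * g t)%C t.
Proof.
  intros [] []; split.
  - apply continuous_Rminus; now apply continuous_Rmult.
  - apply continuous_Rplus; now apply continuous_Rmult.
Qed.

Lemma ccont_comp f (g : R -> R) t :
  continuous g t -> ccont f (g t) -> ccont (fun t => f (g t)) t.
Proof.
  intros Hg [H1 H2]; split.
  - exact (continuous_comp g (fun t => Re (f t)) t Hg H1).
  - exact (continuous_comp g (fun t => Im (f t)) t Hg H2).
Qed.

Lemma continuous_sqrt_comp (g : R -> R) t :
  continuous g t -> continuous (fun t => sqrt (g t)) t.
Proof. intros H; exact (continuous_comp g sqrt t H (continuous_sqrt (g t))). Qed.

Lemma ccont_Cmod f t : ccont f t -> continuous (fun t => Cmod (f t)) t.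
Proof.
  intros [H1 H2]. unfold Cmod. apply continuous_sqrt_comp.
  apply continuous_ext with
    (f := fun t => Re (f t) * Re (f t) + Im (f t) * Im (f t)).
  - intros s; unfold Re, Im; simpl; ring.
  - apply continuous_Rplus; apply continuous_Rmult; assumption.
Qed.

Lemma ex_RInt_cont (g : R -> R) a b : a <= b ->
  (forall t, a <= t <= b -> continuous g t) -> ex_RInt g a b.
Proof.
  intros Hab H. apply (ex_RInt_continuous (V := R_CompleteNormedModule)).
  rewrite Rmin_left, Rmax_right by lra. exact H.
Qed.

Section ComplexIntegral.

Context (a b : R) (Hab : a <= b).

Lemma CI_ext f g : (forall t, a <= t <= b -> f t = g t) -> CI f a b = CI g a b.
Proof.
  intros H. unfold CI. f_equal; apply RInt_ext; intros t Ht;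
    rewrite Rmin_left, Rmax_right in Ht by lra; rewrite H; auto; lra.
Qed.

Lemma CI_plus f g :
  (forall t, a <= t <= b -> ccont f t) -> (forall t, a <= t <= b -> ccont g t) ->
  CI (fun t => f t + g t)%C a b = (CI f a b + CI g a b)%C.
Proof.
  intros Hf Hg. unfold CI, Cplus; simpl; f_equal;
    apply (RInt_plus (V := R_CompleteNormedModule));
    apply ex_RInt_cont; auto; intros t Ht; try apply (Hf t Ht); apply (Hg t Ht).
Qed.

Lemma CI_scal (c : C) f : (forall t, a <= t <= b -> ccont f t) ->
  CI (fun t => c * f t)%C a b = (c * CI f a b)%C.
Proof.
  intros Hf.
  assert (E1 : ex_RInt (fun t => Re (f t)) a b)
    by (apply ex_RInt_cont; auto; intros t Ht; apply (Hf t Ht)).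
  assert (E2 : ex_RInt (fun t => Im (f t)) a b)
    by (apply ex_RInt_cont; auto; intros t Ht; apply (Hf t Ht)).
  unfold CI, Cmult; simpl; f_equal; apply is_RInt_unique.
  - apply (is_RInt_minus (V := R_NormedModule) (fun t => fst c * Re (f t))
             (fun t => snd c * Im (f t)));
      apply (is_RInt_scal (V := R_NormedModule)); now apply (RInt_correct (V := R_CompleteNormedModule)).
  - apply (is_RInt_plus (V := R_NormedModule) (fun t => fst c * Im (f t))
             (fun t => snd c * Re (f t)));
      apply (is_RInt_scal (V := R_NormedModule)); now apply (RInt_correct (V := R_CompleteNormedModule)).
Qed.

Lemma CI_minus f g :
  (forall t, a <= t <= b -> ccont f t) -> (forall t, a <= t <= b -> ccont g t) ->
  CI (fun t => f t - g t)%C a b = (CI f a b - CI g a b)%C.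
Proof.
  intros Hf Hg. unfold CI, Cminus, Cplus, Copp; simpl; f_equal;
    apply (RInt_minus (V := R_CompleteNormedModule));
    apply ex_RInt_cont; auto; intros t Ht; try apply (Hf t Ht); apply (Hg t Ht).
Qed.

(** The triangle inequality is taken in the normed module of C over R, whose norm is [Cmod], so no
    constant is lost by splitting into real and imaginary parts. *)
Lemma CI_le f (g : R -> R) :
  (forall t, a <= t <= b -> ccont f t) -> (forall t, a <= t <= b -> continuous g t) ->
  (forall t, a <= t <= b -> Cmod (f t) <= g t) ->
  Cmod (CI f a b) <= RInt g a b.
Proof.
  intros Hf Hg H. rewrite Cmod_norm.
  apply (norm_RInt_le (V := C_R_NormedModule) f g a b); auto.
  - intros t Ht. rewrite <- Cmod_norm. now apply H.
  - apply (is_RInt_fct_extend_pair (U := R_NormedModule) (V := R_NormedModule));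
      apply (RInt_correct (V := R_CompleteNormedModule)); apply ex_RInt_cont; auto;
      intros t Ht; apply (Hf t Ht).
  - apply (RInt_correct (V := R_CompleteNormedModule)); apply ex_RInt_cont; auto.
Qed.

Lemma CI_le_const f K :
  (forall t, a <= t <= b -> ccont f t) ->
  (forall t, a <= t <= b -> Cmod (f t) <= K) ->
  Cmod (CI f a b) <= K * (b - a).
Proof.
  intros Hf H. replace (K * (b - a)) with (RInt (fun _ => K) a b).
  - apply CI_le; auto. intros; apply continuous_const.
  - rewrite RInt_const. unfold scal; simpl; unfold mult; simpl; ring.
Qed.

Lemma CI_le_scal f (g : R -> R) K :
  (forall t, a <= t <= b -> ccont f t) -> (forall t, a <= t <= b -> continuous g t) ->
  (forall t, a <= t <= b -> Cmod (f t) <= K * g t) ->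
  Cmod (CI f a b) <= K * RInt g a b.
Proof.
  intros Hf Hg H. replace (K * RInt g a b) with (RInt (fun t => K * g t) a b).
  - apply CI_le; auto. intros t Ht. apply continuous_Rmult; auto. apply continuous_const.
  - apply (RInt_scal (V := R_CompleteNormedModule)). now apply ex_RInt_cont.
Qed.

End ComplexIntegral.

Lemma CI_Chasles f a b c : a <= b <= c ->
  (forall t, a <= t <= c -> ccont f t) ->
  (CI f a b + CI f b c)%C = CI f a c.
Proof.
  intros Hab Hf. unfold CI, Cplus; simpl; f_equal;
    apply (RInt_Chasles (V := R_CompleteNormedModule));
    apply ex_RInt_cont; try lra; intros t Ht; apply Hf; lra.
Qed.

Lemma CI_opp_arg f a b : a <= b -> (forall t, a <= t <= b -> ccont f t) ->
  CI (fun t => f (- t)) (- b) (- a) = CI f a b.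
Proof.
  intros Hab Hf.
  assert (G : forall g : R -> R, (forall t, a <= t <= b -> continuous g t) ->
            RInt (fun t => g (- t)) (- b) (- a) = RInt g a b).
  { intros g Hg.
    assert (E0 : is_RInt g b a (opp (RInt g a b))).
    { apply (is_RInt_swap (V := R_NormedModule)),
        (RInt_correct (V := R_CompleteNormedModule)), ex_RInt_cont; auto. }
    replace b with (- - b) in E0 at 1 by ring. replace a with (- - a) in E0 at 1 by ring.
    apply (is_RInt_comp_opp (V := R_NormedModule)) in E0.
    apply (is_RInt_opp (V := R_NormedModule)) in E0.
    apply is_RInt_unique. rewrite opp_opp in E0.
    eapply is_RInt_ext; [|exact E0]. intros t _; simpl. apply opp_opp. }
  unfold CI; f_equal.
  - apply (G (fun t => Re (f t))). intros t Ht; apply (Hf t Ht).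
  - apply (G (fun t => Im (f t))). intros t Ht; apply (Hf t Ht).
Qed.

(** * Exchanging the order of integration *)

Lemma continuity_2d_section1 h u v : continuity_2d_pt h u v ->
  continuous (fun u => h u v) u.
Proof.
  intros H. apply continuous_eps. intros e He.
  destruct (H (mkposreal e He)) as [d Hd]. exists d; split; [apply cond_pos|].
  intros s Hs. apply Hd; auto. rewrite Rminus_eq_0, Rabs_R0. apply cond_pos.
Qed.

Lemma continuity_2d_section2 h u v : continuity_2d_pt h u v ->
  continuous (fun v => h u v) v.
Proof.
  intros H. apply continuous_eps. intros e He.
  destruct (H (mkposreal e He)) as [d Hd]. exists d; split; [apply cond_pos|].
  intros s Hs. apply Hd; auto. rewrite Rminus_eq_0, Rabs_R0. apply cond_pos.
Qed.

(** Uniform continuity near the compact segment over [[c, d]] controls the integrand for all [v] at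
    once. The half-plane [a0 < u] admits integrands that are singular at [u = 0]; these occur later
    with [a0 = 0]. *)
Lemma RInt_param_continuous (h : R -> R -> R) a0 c d u : c <= d -> a0 < u ->
  (forall u v, a0 < u -> c <= v <= d -> continuity_2d_pt h u v) ->
  continuous (fun u => RInt (h u) c d) u.
Proof.
  intros Hcd Hu Hh. apply continuous_eps. intros e He.
  (* The [+ 1] keeps the denominator positive when [c = d]. *)
  assert (He' : 0 < e / (2 * (d - c + 1))) by (apply Rdiv_lt_0_compat; lra).
  destruct (uniform_continuity_2d_1d' h c d u (fun v Hv => Hh u v Hu Hv)
              (mkposreal _ He')) as [del Hdel].
  exists (Rmin del (u - a0)). split.
  { apply Rmin_pos; [apply cond_pos|lra]. }
  intros s Hs.
  assert (Hs1 : Rabs (s - u) < del) by (eapply Rlt_le_trans; [exact Hs|apply Rmin_l]).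
  assert (Hs2 : Rabs (s - u) < u - a0) by (eapply Rlt_le_trans; [exact Hs|apply Rmin_r]).
  apply Rabs_def2 in Hs2. pose proof (Rabs_def2 _ _ Hs1) as Hs3.
  assert (Ex : forall w, a0 < w -> ex_RInt (h w) c d).
  { intros w Hw. apply ex_RInt_cont; auto. intros v Hv. now apply continuity_2d_section2, Hh. }
  rewrite <- (RInt_minus (V := R_CompleteNormedModule)) by (apply Ex; lra).
  eapply Rle_lt_trans.
  { apply abs_RInt_le_const with (M := e / (2 * (d - c + 1))); auto.
    - apply (ex_RInt_minus (V := R_NormedModule)); apply Ex; lra.
    - intros v Hv. left. unfold minus, plus, opp; simpl.
      change (h s v + - h u v) with (h s v - h u v).
      pose proof (cond_pos del). apply Hdel; try lra.
      rewrite Rminus_eq_0, Rabs_R0. lra. }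
  apply Rle_lt_trans with ((d - c + 1) * (e / (2 * (d - c + 1)))).
  - apply Rmult_le_compat_r; lra.
  - field_simplify; lra.
Qed.

(** As functions of the upper limit [b], both sides have derivative [RInt (fun v => h b v) c d], and
    both vanish at [b = a]. Since [a0 < a], the derivative exists on a full neighbourhood of the
    endpoint [a]. *)
Lemma RInt_swap_order (h : R -> R -> R) a0 a b c d :
  a0 < a -> a <= b -> c <= d ->
  (forall u v, a0 < u -> continuity_2d_pt h u v) ->
  RInt (fun v => RInt (fun u => h u v) a b) c d =
  RInt (fun u => RInt (fun v => h u v) c d) a b.
Proof.
  intros Ha Hab Hcd Hh.
  assert (Ex1 : forall v x y, a0 < x -> a0 < y -> ex_RInt (fun u => h u v) x y).
  { intros v x y Hx Hy. apply (ex_RInt_continuous (V := R_CompleteNormedModule)).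
    intros z Hz. apply continuity_2d_section1, Hh.
    assert (a0 < Rmin x y) by (apply Rmin_glb_lt; auto). lra. }
  assert (D : forall x, a0 < x ->
    is_derive (fun x => RInt (fun v => RInt (fun u => h u v) a x) c d) x
      (RInt (fun v => h x v) c d)).
  { intros x Hx.
    assert (L : locally x (fun y => a0 < y)) by (apply open_gt; exact Hx).
    assert (DD : forall y v, a0 < y ->
       is_derive (fun u => RInt (fun u => h u v) a u) y (h y v)).
    { intros y v Hy. apply (is_derive_RInt (V := R_NormedModule) (fun u => h u v) _ a).
      - assert (Ly : locally y (fun y => a0 < y)) by (apply open_gt; exact Hy).
        eapply filter_imp; [|exact Ly]. intros z Hz.
        apply (RInt_correct (V := R_CompleteNormedModule)). now apply Ex1.
      - now apply continuity_2d_section1, Hh. }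
    replace (RInt (fun v => h x v) c d) with
      (RInt (fun v => Derive (fun u => RInt (fun u => h u v) a u) x) c d).
    2:{ apply RInt_ext. intros v _. now apply is_derive_unique, DD. }
    apply (is_derive_RInt_param (fun x v => RInt (fun u => h u v) a x)).
    - eapply filter_imp; [|exact L]. intros y Hy t _. eexists. now apply DD.
    - intros t _. apply continuity_2d_pt_ext_loc with h; [|now apply Hh].
      destruct L as [del Hdel]. exists del. intros u v Hu _.
      symmetry. apply is_derive_unique, DD. apply Hdel. exact Hu.
    - eapply filter_imp; [|exact L]. intros y Hy.
      apply ex_RInt_cont; auto. intros v _.
      assert (E : forall v, continuous (fun v => RInt (fun u => h u v) a y) v).
      { intros w. apply continuous_eps. intros e He.
        (* Only [a0 < y] is known, so [y] may lie to the left of [a]. *)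
        set (m := Rmin a y). set (M := Rmax a y).
        assert (Hm : a0 < m) by (apply Rmin_glb_lt; auto).
        assert (HmM : m <= M) by (unfold m, M; apply Rle_trans with a; [apply Rmin_l|apply Rmax_l]).
        assert (He' : 0 < e / (2 * (M - m + 1))) by (apply Rdiv_lt_0_compat; lra).
        destruct (uniform_continuity_2d_1d h m M w
                    (fun u Hu => Hh u w (Rlt_le_trans _ _ _ Hm (proj1 Hu)))
                    (mkposreal _ He')) as [del Hdel].
        exists del; split; [apply cond_pos|]. intros s Hs.
        rewrite <- (RInt_minus (V := R_CompleteNormedModule)) by (apply Ex1; auto).
        assert (B : Rabs (RInt (fun u => minus (h u s) (h u w)) a y)
                    <= (M - m) * (e / (2 * (M - m + 1)))).
        { assert (B1 : Rabs (RInt (fun u => minus (h u s) (h u w)) m M)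
                    <= (M - m) * (e / (2 * (M - m + 1)))).
          { apply abs_RInt_le_const; auto.
            - apply (ex_RInt_minus (V := R_NormedModule) (fun u => h u s) (fun u => h u w));
                apply Ex1; lra.
            - intros u Hu. left. unfold minus, plus, opp; simpl.
              change (h u s + - h u w) with (h u s - h u w).
              apply Rabs_def2 in Hs. pose proof (cond_pos del).
              apply Hdel; try lra. rewrite Rminus_eq_0, Rabs_R0. lra. }
          unfold m, M, Rmin, Rmax in B1 |- *. destruct (Rle_dec a y); auto.
          rewrite <- opp_RInt_swap.
          - unfold opp; simpl. rewrite Rabs_Ropp. exact B1.
          - apply (ex_RInt_minus (V := R_NormedModule) (fun u => h u s) (fun u => h u w));
                apply Ex1; lra. }
        eapply Rle_lt_trans; [exact B|].
        apply Rle_lt_trans with ((M - m + 1) * (e / (2 * (M - m + 1)))).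
        - apply Rmult_le_compat_r; lra.
        - field_simplify; lra. }
      apply E. }
  assert (I := is_RInt_derive (V := R_CompleteNormedModule)
     (fun x => RInt (fun v => RInt (fun u => h u v) a x) c d)
     (fun x => RInt (fun v => h x v) c d) a b).
  rewrite Rmin_left, Rmax_right in I by lra.
  assert (I' := I (fun x Hx => D x (Rlt_le_trans _ _ _ Ha (proj1 Hx)))
    (fun x Hx => RInt_param_continuous h a0 c d x Hcd (Rlt_le_trans _ _ _ Ha (proj1 Hx))
       (fun u v Hu _ => Hh u v Hu))).
  apply is_RInt_unique in I'. rewrite I'.
  assert (Hz : RInt (fun v => RInt (fun u => h u v) a a) c d = 0).
  { rewrite (RInt_ext _ (fun _ => 0)).
    - rewrite RInt_const. apply Rmult_0_r.
    - intros v _. exact (RInt_point a (fun u => h u v)). }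
  unfold minus, plus, opp; simpl.
  replace (RInt (fun v => RInt (fun u => h u v) a a) c d) with 0
    by (symmetry; exact Hz). symmetry; apply Rminus_0_r.
Qed.

Definition ccont2 (h : R -> R -> C) (u v : R) : Prop :=
  continuity_2d_pt (fun u v => Re (h u v)) u v /\
  continuity_2d_pt (fun u v => Im (h u v)) u v.

Lemma CI_swap (h : R -> R -> C) a0 a b c d :
  a0 < a -> a <= b -> c <= d ->
  (forall u v, a0 < u -> ccont2 h u v) ->
  CI (fun v => CI (fun u => h u v) a b) c d =
  CI (fun u => CI (fun v => h u v) c d) a b.
Proof.
  intros Ha Hab Hcd Hh. unfold CI; simpl. f_equal.
  - apply (RInt_swap_order (fun u v => Re (h u v)) a0); auto. intros; now apply Hh.
  - apply (RInt_swap_order (fun u v => Im (h u v)) a0); auto. intros; now apply Hh.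
Qed.

Lemma ccont_CI_param (h : R -> R -> C) a0 c d u : c <= d -> a0 < u ->
  (forall u v, a0 < u -> c <= v <= d -> ccont2 h u v) -> ccont (fun u => CI (h u) c d) u.
Proof.
  intros Hcd Hu Hh; split; simpl.
  - apply (RInt_param_continuous (fun u v => Re (h u v)) a0); auto. intros; now apply Hh.
  - apply (RInt_param_continuous (fun u v => Im (h u v)) a0); auto. intros; now apply Hh.
Qed.

Lemma ccont2_mult f g u v : ccont2 f u v -> ccont2 g u v ->
  ccont2 (fun u v => f u v * g u v)%C u v.
Proof.
  intros [] []; split; simpl.
  - apply continuity_2d_pt_minus; now apply continuity_2d_pt_mult.
  - apply continuity_2d_pt_plus; now apply continuity_2d_pt_mult.
Qed.

Lemma continuity_2d_fst (g : R -> R) u v : continuous g u ->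
  continuity_2d_pt (fun u _ => g u) u v.
Proof.
  intros H. apply (continuity_1d_2d_pt_comp g (fun u _ => u)).
  - now apply continuity_pt_filterlim.
  - apply continuity_2d_pt_id1.
Qed.

Lemma continuity_2d_snd (g : R -> R) u v : continuous g v ->
  continuity_2d_pt (fun _ v => g v) u v.
Proof.
  intros H. apply (continuity_1d_2d_pt_comp g (fun _ v => v)).
  - now apply continuity_pt_filterlim.
  - apply continuity_2d_pt_id2.
Qed.

Lemma ccont2_fst f u v : ccont f u -> ccont2 (fun u _ => f u) u v.
Proof.
  intros [H1 H2]; split.
  - exact (continuity_2d_fst (fun u => Re (f u)) u v H1).
  - exact (continuity_2d_fst (fun u => Im (f u)) u v H2).
Qed.

Lemma ccont2_snd f u v : ccont f v -> ccont2 (fun _ v => f v) u v.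
Proof.
  intros [H1 H2]; split.
  - exact (continuity_2d_snd (fun u => Re (f u)) u v H1).
  - exact (continuity_2d_snd (fun u => Im (f u)) u v H2).
Qed.

(** * Cauchy's theorem on rectangles *)

(** Complex differentiability with an explicit radius and linear approximation, the form in which
    the bisection argument and the Taylor estimates use it. *)
Definition cdiff (H : C -> C) (z : C) : Prop :=
  exists l : C, forall e, 0 < e -> exists d, 0 < d /\
    forall w, Cmod (w - z) < d -> Cmod (H w - H z - l * (w - z))%C <= e * Cmod (w - z).

Lemma holomorphic_cdiff H z : holomorphic_at H z -> cdiff H z.
Proof.
  intros [l [_ Hl]]. exists l. intros e He.
  destruct (Hl z (fun P HP => HP) (mkposreal e He)) as [d Hd].
  exists d; split; [apply cond_pos|]. intros w Hw.
  specialize (Hd w Hw).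
  change (Cmod ((H w - H z) - (w - z) * l)%C <= e * Cmod (w - z)%C) in Hd.
  replace (H w - H z - l * (w - z))%C with ((H w - H z) - (w - z) * l)%C by ring.
  exact Hd.
Qed.

Lemma cdiff_continuous H z : cdiff H z -> forall e, 0 < e -> exists d, 0 < d /\
  forall w, Cmod (w - z) < d -> Cmod (H w - H z) < e.
Proof.
  intros [l Hl] e He. destruct (Hl 1 Rlt_0_1) as [d [Hd H1]].
  pose proof (Cmod_ge_0 l) as Hl0.
  assert (He' : 0 < e / (2 + Cmod l)) by (apply Rdiv_lt_0_compat; lra).
  exists (Rmin d (e / (2 + Cmod l))). split; [now apply Rmin_pos|]. intros w Hw.
  specialize (H1 w (Rlt_le_trans _ _ _ Hw (Rmin_l _ _))).
  assert (Hw2 := Rlt_le_trans _ _ _ Hw (Rmin_r _ _)).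
  replace (H w - H z)%C with ((H w - H z - l * (w - z)) + l * (w - z))%C by ring.
  eapply Rle_lt_trans; [apply Cmod_triangle|]. rewrite Cmod_mult.
  pose proof (Cmod_ge_0 (w - z)) as Hp.
  apply Rle_lt_trans with ((1 + Cmod l) * Cmod (w - z)); [lra|].
  apply Rle_lt_trans with ((1 + Cmod l) * (e / (2 + Cmod l))).
  - apply Rmult_le_compat_l; lra.
  - apply Rmult_lt_reg_r with (2 + Cmod l); [lra|]. field_simplify; nra.
Qed.

Lemma cdiff_ext_loc H G z d : 0 < d ->
  (forall w, Cmod (w - z) < d -> H w = G w) -> cdiff G z -> cdiff H z.
Proof.
  intros Hd E [l Hl]. exists l. intros e He. destruct (Hl e He) as [d1 [Hd1 H1]].
  exists (Rmin d d1). split; [now apply Rmin_pos|]. intros w Hw.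
  assert (Hw1 := Rlt_le_trans _ _ _ Hw (Rmin_l _ _)).
  assert (Hw2 := Rlt_le_trans _ _ _ Hw (Rmin_r _ _)).
  rewrite (E w Hw1), (E z); [now apply H1|].
  replace (z - z)%C with (RtoC 0) by ring. rewrite Cmod_0. exact Hd.
Qed.

Lemma cdiff_const c z : cdiff (fun _ => c) z.
Proof.
  exists (RtoC 0). intros e He. exists 1. split; [lra|]. intros w _.
  replace (c - c - 0 * (w - z))%C with (RtoC 0) by ring. rewrite Cmod_0.
  pose proof (Cmod_ge_0 (w - z)). nra.
Qed.

Lemma cdiff_minus H G z : cdiff H z -> cdiff G z -> cdiff (fun w => H w - G w)%C z.
Proof.
  intros [l Hl] [k Hk]. exists (l - k)%C. intros e He.
  destruct (Hl (e / 2) ltac:(lra)) as [d1 [Hd1 H1]].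
  destruct (Hk (e / 2) ltac:(lra)) as [d2 [Hd2 H2]].
  exists (Rmin d1 d2). split; [now apply Rmin_pos|]. intros w Hw.
  specialize (H1 w (Rlt_le_trans _ _ _ Hw (Rmin_l _ _))).
  specialize (H2 w (Rlt_le_trans _ _ _ Hw (Rmin_r _ _))).
  replace (H w - G w - (H z - G z) - (l - k) * (w - z))%C with
    ((H w - H z - l * (w - z)) + - (G w - G z - k * (w - z)))%C by ring.
  eapply Rle_trans; [apply Cmod_triangle|]. rewrite Cmod_opp. lra.
Qed.

Lemma cdiff_mult H G z : cdiff H z -> cdiff G z -> cdiff (fun w => H w * G w)%C z.
Proof.
  intros HH HG.
  destruct (cdiff_continuous G z HG 1 Rlt_0_1) as [d0 [Hd0 H0]].
  pose proof HH as [l Hl]. pose proof HG as [k Hk].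
  exists (l * G z + H z * k)%C. intros e He.
  pose proof (Cmod_ge_0 (G z)) as PG. pose proof (Cmod_ge_0 (H z)) as PH.
  pose proof (Cmod_ge_0 l) as Pl.
  set (e' := e / (3 * (1 + Cmod (G z) + Cmod (H z) + Cmod l))).
  assert (He' : 0 < e') by (apply Rdiv_lt_0_compat; lra).
  assert (Ee : e' * (1 + Cmod (G z) + Cmod (H z) + Cmod l) = e / 3) by (unfold e'; field; lra).
  destruct (Hl e' He') as [d1 [Hd1 H1]].
  destruct (Hk e' He') as [d2 [Hd2 H2]].
  destruct (cdiff_continuous G z HG e' He') as [d3 [Hd3 H3]].
  exists (Rmin (Rmin d0 d1) (Rmin d2 d3)). split; [repeat apply Rmin_pos; auto|]. intros w Hw.
  assert (Ha := Rlt_le_trans _ _ _ Hw (Rmin_l _ _)).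
  assert (Hb := Rlt_le_trans _ _ _ Hw (Rmin_r _ _)).
  specialize (H0 w (Rlt_le_trans _ _ _ Ha (Rmin_l _ _))).
  specialize (H1 w (Rlt_le_trans _ _ _ Ha (Rmin_r _ _))).
  specialize (H2 w (Rlt_le_trans _ _ _ Hb (Rmin_l _ _))).
  specialize (H3 w (Rlt_le_trans _ _ _ Hb (Rmin_r _ _))).
  replace (H w * G w - H z * G z - (l * G z + H z * k) * (w - z))%C with
    ((H w - H z - l * (w - z)) * G w + (H z * (G w - G z - k * (w - z))
       + (l * (w - z)) * (G w - G z)))%C by ring.
  eapply Rle_trans; [apply Cmod_triangle|].
  eapply Rle_trans; [apply Rplus_le_compat_l, Cmod_triangle|]. rewrite !Cmod_mult.
  assert (HGw : Cmod (G w) <= 1 + Cmod (G z)).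
  { replace (G w) with ((G w - G z) + G z)%C by ring.
    eapply Rle_trans; [apply Cmod_triangle|]. lra. }
  set (x := Cmod (w - z)) in *. pose proof (Cmod_ge_0 (w - z)) as Px. fold x in Px.
  pose proof (Cmod_ge_0 (G w)) as PGw.
  pose proof (Cmod_ge_0 (G w - G z)) as Pd.
  pose proof (Cmod_ge_0 (H w - H z - l * (w - z))%C) as Pd2.
  pose proof (Cmod_ge_0 (G w - G z - k * (w - z))%C) as Pd3.
  assert (T1 : Cmod (H w - H z - l * (w - z)) * Cmod (G w) <= (e' * x) * (1 + Cmod (G z)))
    by (apply Rmult_le_compat; auto).
  assert (T2 : Cmod (H z) * Cmod (G w - G z - k * (w - z)) <= Cmod (H z) * (e' * x))
    by (apply Rmult_le_compat_l; auto).
  assert (T3 : Cmod l * x * Cmod (G w - G z) <= (Cmod l * x) * e')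
    by (apply Rmult_le_compat_l; [nra|lra]).
  nra.
Qed.

Lemma Cmod_pair_h x x0 c : Cmod ((x, c) - (x0, c)) = Rabs (x - x0).
Proof.
  replace ((x, c) - (x0, c))%C with (RtoC (x - x0)); [apply Cmod_R|].
  unfold Cminus, Cplus, Copp, RtoC; simpl; f_equal; ring.
Qed.

Lemma Cmod_pair_v x y y0 : Cmod ((x, y) - (x, y0)) = Rabs (y - y0).
Proof.
  replace ((x, y) - (x, y0))%C with (Ci * RtoC (y - y0))%C.
  - rewrite Cmod_mult, Cmod_Ci, Cmod_R. ring.
  - unfold Cminus, Cplus, Copp, Cmult, Ci, RtoC; simpl; f_equal; ring.
Qed.

Lemma im_le_Cmod (z : C) : Rabs (Im z) <= Cmod z.
Proof. eapply Rle_trans; [apply Rmax_r|apply Rmax_Cmod]. Qed.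

Lemma ccont_eps (f : R -> C) t :
  (forall e, 0 < e -> exists d, 0 < d /\
     forall s, Rabs (s - t) < d -> Cmod (f s - f t) < e) -> ccont f t.
Proof.
  intros H; split; apply continuous_eps; intros e He;
    destruct (H e He) as [d [Hd H1]]; exists d; split; auto; intros s Hs;
    (eapply Rle_lt_trans; [|apply (H1 s Hs)]).
  - exact (re_le_Cmod (f s - f t)).
  - exact (im_le_Cmod (f s - f t)).
Qed.

Lemma cdiff_ccont_h H x c : cdiff H (x, c) -> ccont (fun x => H (x, c)) x.
Proof.
  intros D. apply ccont_eps. intros e He.
  destruct (cdiff_continuous _ _ D e He) as [d [Hd H1]].
  exists d; split; auto. intros s Hs. apply H1. now rewrite Cmod_pair_h.
Qed.

Lemma cdiff_ccont_v H x y : cdiff H (x, y) -> ccont (fun y => H (x, y)) y.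
Proof.
  intros D. apply ccont_eps. intros e He.
  destruct (cdiff_continuous _ _ D e He) as [d [Hd H1]].
  exists d; split; auto. intros s Hs. apply H1. now rewrite Cmod_pair_v.
Qed.

(** * Boundary integrals of rectangles and Goursat's bisection *)

Definition rectI (H : C -> C) (a b c d : R) : C :=
  (CI (fun x => H (x, c)) a b + Ci * CI (fun y => H (b, y)) c d
   - CI (fun x => H (x, d)) a b - Ci * CI (fun y => H (a, y)) c d)%C.

Definition cont_on_rect (H : C -> C) a b c d : Prop :=
  forall x y, a <= x <= b -> c <= y <= d ->
    ccont (fun x => H (x, y)) x /\ ccont (fun y => H (x, y)) y.

Lemma rectI_split_h H a m b c d : a <= m <= b -> c <= d -> cont_on_rect H a b c d ->
  rectI H a b c d = (rectI H a m c d + rectI H m b c d)%C.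
Proof.
  intros Hm Hcd Hc. unfold rectI.
  rewrite <- (CI_Chasles (fun x => H (x, c)) a m b) by (auto; intros; apply Hc; lra).
  rewrite <- (CI_Chasles (fun x => H (x, d)) a m b) by (auto; intros; apply Hc; lra).
  ring.
Qed.

Lemma rectI_split_v H a b c m d : a <= b -> c <= m <= d -> cont_on_rect H a b c d ->
  rectI H a b c d = (rectI H a b c m + rectI H a b m d)%C.
Proof.
  intros Hm Hcd Hc. unfold rectI.
  rewrite <- (CI_Chasles (fun y => H (b, y)) c m d) by (auto; intros; apply Hc; lra).
  rewrite <- (CI_Chasles (fun y => H (a, y)) c m d) by (auto; intros; apply Hc; lra).
  ring.
Qed.

Lemma CI_affine (p l : C) a b : a <= b ->
  CI (fun t => p + RtoC t * l)%C a b
  = (RtoC (b - a) * p + RtoC ((b ^ 2 - a ^ 2) / 2) * l)%C.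
Proof.
  intros Hab.
  assert (G : forall u v, RInt (fun t => u + (t * v)) a b
              = (b - a) * u + (b ^ 2 - a ^ 2) / 2 * v).
  { intros u v. apply is_RInt_unique.
    replace ((b - a) * u + (b ^ 2 - a ^ 2) / 2 * v) with
      (minus (b * u + b ^ 2 / 2 * v) (a * u + a ^ 2 / 2 * v))
      by (unfold minus, plus, opp; simpl; field).
    apply (is_RInt_derive (V := R_CompleteNormedModule) (fun t => t * u + t ^ 2 / 2 * v)).
    - intros t _. auto_derive; auto. simpl. field.
    - intros t _. apply continuous_Rplus; [apply continuous_const|].
      apply continuous_Rmult; [apply continuous_id|apply continuous_const]. }
  destruct p as [p1 p2], l as [l1 l2].
  unfold CI. apply injective_projections; simpl.
  - rewrite (RInt_ext _ (fun t => p1 + t * l1)) by (intros; simpl; ring). rewrite G. simpl. field.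
  - rewrite (RInt_ext _ (fun t => p2 + t * l2)) by (intros; simpl; ring). rewrite G. simpl. field.
Qed.

(** The four side integrals of an affine function are explicit and cancel. This replaces the use of
    a primitive in Goursat's argument. *)
Lemma rectI_affine (p l z : C) a b c d : a <= b -> c <= d ->
  rectI (fun w => p + l * (w - z))%C a b c d = RtoC 0.
Proof.
  intros Hab Hcd. unfold rectI.
  assert (Hx : forall y, CI (fun x => p + l * ((x, y) - z))%C a b
     = (RtoC (b - a) * (p + l * ((0, y) - z)) + RtoC ((b ^ 2 - a ^ 2) / 2) * l)%C).
  { intros y. rewrite <- (CI_affine _ l a b Hab). apply CI_ext; auto. intros t _.
    destruct p, l, z; unfold Cplus, Cmult, Cminus, Copp, RtoC; simpl; f_equal; ring. }
  assert (Hy : forall x, CI (fun y => p + l * ((x, y) - z))%C c d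
     = (RtoC (d - c) * (p + l * ((x, 0) - z)) + RtoC ((d ^ 2 - c ^ 2) / 2) * (l * Ci))%C).
  { intros x. rewrite <- (CI_affine _ (l * Ci) c d Hcd). apply CI_ext; auto. intros t _.
    destruct p, l, z; unfold Cplus, Cmult, Cminus, Copp, Ci, RtoC; simpl; f_equal; ring. }
  rewrite !Hx, !Hy.
  destruct p, l, z; apply injective_projections; simpl; field.
Qed.

Lemma rectI_minus H G a b c d : a <= b -> c <= d ->
  cont_on_rect H a b c d -> cont_on_rect G a b c d ->
  rectI (fun w => H w - G w)%C a b c d = (rectI H a b c d - rectI G a b c d)%C.
Proof.
  intros Hab Hcd HH HG. unfold rectI.
  rewrite (CI_minus a b Hab (fun x => H (x, c)) (fun x => G (x, c))),
    (CI_minus a b Hab (fun x => H (x, d)) (fun x => G (x, d))),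
    (CI_minus c d Hcd (fun y => H (b, y)) (fun y => G (b, y))),
    (CI_minus c d Hcd (fun y => H (a, y)) (fun y => G (a, y)));
    try (intros; apply HH; lra); try (intros; apply HG; lra).
  ring.
Qed.

Lemma rectI_le H a b c d K : a <= b -> c <= d -> cont_on_rect H a b c d ->
  (forall x y, a <= x <= b -> c <= y <= d -> Cmod (H (x, y)) <= K) ->
  Cmod (rectI H a b c d) <= 2 * K * ((b - a) + (d - c)).
Proof.
  intros Hab Hcd Hc HK. unfold rectI.
  assert (B1 := CI_le_const a b Hab (fun x => H (x, c)) K
     (fun t Ht => proj1 (Hc t c Ht ltac:(lra))) (fun t Ht => HK t c Ht ltac:(lra))).
  assert (B2 := CI_le_const a b Hab (fun x => H (x, d)) K
     (fun t Ht => proj1 (Hc t d Ht ltac:(lra))) (fun t Ht => HK t d Ht ltac:(lra))).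
  assert (B3 := CI_le_const c d Hcd (fun y => H (b, y)) K
     (fun t Ht => proj2 (Hc b t ltac:(lra) Ht)) (fun t Ht => HK b t ltac:(lra) Ht)).
  assert (B4 := CI_le_const c d Hcd (fun y => H (a, y)) K
     (fun t Ht => proj2 (Hc a t ltac:(lra) Ht)) (fun t Ht => HK a t ltac:(lra) Ht)).
  unfold Cminus. repeat (eapply Rle_trans; [apply Cmod_triangle|]; rewrite ?Cmod_opp).
  assert (T := Cmod_triangle (CI (fun x => H (x, c)) a b + Ci * CI (fun y => H (b, y)) c d)
     (- CI (fun x => H (x, d)) a b)).
  assert (T' := Cmod_triangle (CI (fun x => H (x, c)) a b) (Ci * CI (fun y => H (b, y)) c d)).
  rewrite Cmod_opp in T. rewrite Cmod_mult, Cmod_Ci in T' |- *. lra.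
Qed.

Lemma Cmod_le_sum x y : Cmod (x, y) <= Rabs x + Rabs y.
Proof.
  replace ((x, y) : C) with (RtoC x + Ci * RtoC y)%C.
  - eapply Rle_trans; [apply Cmod_triangle|]. rewrite Cmod_mult, Cmod_Ci, !Cmod_R. lra.
  - unfold Cplus, Cmult, Ci, RtoC; simpl; f_equal; ring.
Qed.

(** Subtracting the affine part does not change the boundary integral. What remains is at most [e]
    times the semi-perimeter, on a path of twice that length. The square of the semi-perimeter is
    exactly what a bisection divides by four. *)
Lemma rectI_near_diff H l z e a b c d : a <= Re z <= b -> c <= Im z <= d -> 0 <= e ->
  cont_on_rect H a b c d ->
  (forall x y, a <= x <= b -> c <= y <= d ->
     Cmod (H (x, y) - H z - l * ((x, y) - z)) <= e * Cmod ((x, y) - z)) ->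
  Cmod (rectI H a b c d) <= 2 * e * ((b - a) + (d - c)) ^ 2.
Proof.
  intros Ha Hc He Hcont Hd.
  set (A := fun w => (H z + l * (w - z))%C).
  assert (HA : cont_on_rect A a b c d).
  { intros x y _ _. unfold A. split; apply ccont_plus; try apply ccont_const;
      (apply ccont_mult; [apply ccont_const|apply ccont_minus; [|apply ccont_const]]);
      apply ccont_pair; try apply continuous_id; apply continuous_const. }
  assert (E : rectI H a b c d = rectI (fun w => H w - A w)%C a b c d).
  { rewrite rectI_minus by (auto; lra). unfold A at 1.
    rewrite rectI_affine by lra. ring. }
  rewrite E.
  replace (2 * e * (b - a + (d - c)) ^ 2)
    with (2 * (e * ((b - a) + (d - c))) * ((b - a) + (d - c))) by ring.
  apply rectI_le; try lra.
  - intros x y Hx Hy. destruct (Hcont x y Hx Hy), (HA x y Hx Hy).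
    split; now apply ccont_minus.
  - intros x y Hx Hy. unfold A.
    replace (H (x, y) - (H z + l * ((x, y) - z)))%C
      with (H (x, y) - H z - l * ((x, y) - z))%C by ring.
    eapply Rle_trans; [apply Hd; auto|]. apply Rmult_le_compat_l; auto.
    destruct z as [z1 z2]. unfold Re, Im in *; simpl in Ha, Hc.
    eapply Rle_trans; [apply (Cmod_le_sum (x + - z1) (y + - z2))|].
    apply Rplus_le_compat; apply Rabs_le; lra.
Qed.

Definition half (i : bool) (p : R * R) : R * R :=
  let m := (fst p + snd p) / 2 in if i then (fst p, m) else (m, snd p).

(** The common point is the supremum of the left ends: both sequences of ends are monotone, so every
    left end lies below every right end. *)
Lemma nested_halves (P : nat -> R * R) : fst (P O) <= snd (P O) ->
  (forall n, exists i, P (S n) = half i (P n)) ->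
  exists x, forall n, fst (P n) <= x <= snd (P n) /\ fst (P O) <= fst (P n) /\
    snd (P n) <= snd (P O) /\ snd (P n) - fst (P n) = (snd (P O) - fst (P O)) / 2 ^ n.
Proof.
  intros H0 HP.
  assert (W : forall n, fst (P n) <= snd (P n) /\
     snd (P n) - fst (P n) = (snd (P O) - fst (P O)) / 2 ^ n).
  { induction n as [|n [IH1 IH2]]; [simpl; lra|]. destruct (HP n) as [i ->].
    unfold half. destruct i; simpl; split; try lra.
    - replace ((fst (P n) + snd (P n)) / 2 - fst (P n)) with ((snd (P n) - fst (P n)) / 2) by lra.
      rewrite IH2. field. apply pow_nonzero; lra.
    - replace (snd (P n) - (fst (P n) + snd (P n)) / 2) with ((snd (P n) - fst (P n)) / 2) by lra.
      rewrite IH2. field. apply pow_nonzero; lra. }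
  assert (S1 : forall n, fst (P n) <= fst (P (S n)) /\ snd (P (S n)) <= snd (P n)).
  { intros n. destruct (W n) as [Hn _]. destruct (HP n) as [i ->].
    unfold half; destruct i; simpl; lra. }
  assert (Mon : forall n k, fst (P n) <= fst (P (n + k)%nat) /\ snd (P (n + k)%nat) <= snd (P n)).
  { intros n; induction k as [|k IH]; [rewrite Nat.add_0_r; lra|].
    rewrite Nat.add_succ_r. specialize (S1 (n + k)%nat). lra. }
  assert (Cr : forall n m, fst (P n) <= snd (P m)).
  { intros n m. destruct (Nat.le_ge_cases n m) as [Hle|Hle].
    - destruct (Mon n (m - n)%nat) as [A _]. replace (n + (m - n))%nat with m in A by lia.
      destruct (W m); lra.
    - destruct (Mon m (n - m)%nat) as [_ A]. replace (m + (n - m))%nat with n in A by lia.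
      destruct (W n); lra. }
  destruct (completeness (fun y => exists n, y = fst (P n))) as [x [Hx1 Hx2]].
  - exists (snd (P O)). intros y [n ->]. apply Cr.
  - exists (fst (P O)). now exists O.
  - exists x. intros n. destruct (Mon O n) as [M1 M2]. simpl in M1, M2.
    repeat split; auto.
    + apply Hx1. now exists n.
    + apply Hx2. intros y [k ->]. apply Cr.
    + apply W.
Qed.

(** If the integral exceeded [e] times the squared semi-perimeter, one of the four quarters would
    inherit this. The nested bad rectangles shrink to a point where [H] is nearly affine, which
    contradicts [rectI_near_diff]. Since [e] is arbitrary, the integral vanishes. *)
Theorem goursat H a b c d : a <= b -> c <= d ->
  (forall x y, a <= x <= b -> c <= y <= d -> cdiff H (x, y)) ->
  rectI H a b c d = RtoC 0.
Proof.
  intros Hab Hcd HD.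
  assert (Hcont : forall a' b' c' d', a <= a' -> b' <= b -> c <= c' -> d' <= d ->
     cont_on_rect H a' b' c' d').
  { intros a' b' c' d' H1 H2 H3 H4 x y Hx Hy. split.
    - apply cdiff_ccont_h, HD; lra.
    - apply cdiff_ccont_v, HD; lra. }
  set (I := fun r : (R * R) * (R * R) =>
    Cmod (rectI H (fst (fst r)) (snd (fst r)) (fst (snd r)) (snd (snd r)))).
  set (L := fun r : (R * R) * (R * R) =>
    (snd (fst r) - fst (fst r)) + (snd (snd r) - fst (snd r))).
  enough (B : forall e, 0 < e -> I ((a, b), (c, d)) <= e * L ((a, b), (c, d)) ^ 2).
  { apply Cmod_eq_0. apply Rle_antisym; [|apply Cmod_ge_0].
    change (Cmod (rectI H a b c d)) with (I ((a, b), (c, d))).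
    apply le_epsilon. intros e He. rewrite Rplus_0_l.
    set (l := L ((a, b), (c, d))) in *.
    eapply Rle_trans; [apply (B (e / (1 + l ^ 2)))|].
    - apply Rdiv_lt_0_compat; nra.
    - apply Rmult_le_reg_r with (1 + l ^ 2); [nra|]. field_simplify; nra. }
  intros e He. apply Rnot_lt_le. intros Hbad.
  set (bad := fun r => e * L r ^ 2 < I r).
  set (t := fun i j (r : (R * R) * (R * R)) => (half i (fst r), half j (snd r))).
  (* Three quarters are tested and the fourth is the untested default. [Bad] shows that the default
     is bad whenever the three tests fail. *)
  set (next := fun r =>
    if Rlt_dec (e * L (t true true r) ^ 2) (I (t true true r)) then t true true r else
    if Rlt_dec (e * L (t true false r) ^ 2) (I (t true false r)) then t true false r else
    if Rlt_dec (e * L (t false true r) ^ 2) (I (t false true r)) then t false true r else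
    t false false r).
  assert (Nform : forall r, exists i j, next r = t i j r).
  { intros r. unfold next. repeat destruct Rlt_dec; eauto. }
  set (seqr := fix s n := match n with O => ((a, b), (c, d)) | S n => next (s n) end).
  assert (PX := nested_halves (fun n => fst (seqr n)) Hab
    (fun n => let (i, Hi) := Nform (seqr n) in let (j, Hj) := Hi in
       ex_intro _ i (f_equal fst Hj))).
  assert (PY := nested_halves (fun n => snd (seqr n)) Hcd
    (fun n => let (i, Hi) := Nform (seqr n) in let (j, Hj) := Hi in
       ex_intro _ j (f_equal snd Hj))).
  destruct PX as [x HX], PY as [y HY]. cbn [fst snd seqr] in HX, HY.
  assert (Bad : forall n, bad (seqr n)).
  { induction n as [|n IH]; [exact Hbad|]. cbn [seqr].
    destruct (HX n) as [X1 [X2 [X3 _]]], (HY n) as [Y1 [Y2 [Y3 _]]].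
    destruct (seqr n) as [[a' b'] [c' d']]. cbn [fst snd] in *.
    unfold bad, next. repeat (destruct Rlt_dec; [assumption|]).
    apply Rnot_le_lt. intros N4.
    repeat match goal with N : ~ (_ < _) |- _ => apply Rnot_lt_le in N end.
    unfold bad, I, L, t, half in *. cbn [fst snd] in *.
    set (mx := (a' + b') / 2) in *. set (my := (c' + d') / 2) in *.
    assert (Q : rectI H a' b' c' d' = ((rectI H a' mx c' my + rectI H a' mx my d')
        + (rectI H mx b' c' my + rectI H mx b' my d'))%C).
    { rewrite (rectI_split_h H a' mx b' c' d'), (rectI_split_v H a' mx c' my d'),
        (rectI_split_v H mx b' c' my d'); unfold mx, my; try lra; auto; apply Hcont; lra. }
    rewrite Q in IH.
    assert (T := Cmod_triangle (rectI H a' mx c' my + rectI H a' mx my d')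
      (rectI H mx b' c' my + rectI H mx b' my d')).
    assert (T1 := Cmod_triangle (rectI H a' mx c' my) (rectI H a' mx my d')).
    assert (T2 := Cmod_triangle (rectI H mx b' c' my) (rectI H mx b' my d')).
    assert (E1 : mx - a' = (b' - a') / 2) by (unfold mx; lra).
    assert (E2 : b' - mx = (b' - a') / 2) by (unfold mx; lra).
    assert (E3 : my - c' = (d' - c') / 2) by (unfold my; lra).
    assert (E4 : d' - my = (d' - c') / 2) by (unfold my; lra).
    rewrite E1, E2, E3, E4 in *. nra. }
  assert (Hxy : cdiff H (x, y)).
  { destruct (HX O) as [X1 _], (HY O) as [Y1 _]. cbn [fst snd seqr] in *. apply HD; lra. }
  (* With [e / 4] the near-affine bound is [(e / 2) L^2], which is incompatible with [e L^2 < I]. *)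
  destruct Hxy as [l Hl]. destruct (Hl (e / 4) ltac:(lra)) as [del [Hdel Hd]].
  assert (Hw : exists n, ((b - a) + (d - c)) / 2 ^ n < del).
  { destruct (pow_lt_1_zero (/ 2) ltac:(rewrite Rabs_right; lra)
      (del / ((b - a) + (d - c) + 1)) ltac:(apply Rdiv_lt_0_compat; lra)) as [N HN].
    exists N. specialize (HN N (Nat.le_refl N)).
    rewrite Rabs_right in HN by (left; apply pow_lt; lra).
    rewrite pow_inv in HN. unfold Rdiv.
    assert (P : 0 < / 2 ^ N) by (apply Rinv_0_lt_compat, pow_lt; lra).
    apply Rle_lt_trans with (((b - a) + (d - c) + 1) * / 2 ^ N); [nra|].
    replace del with ((b - a + (d - c) + 1) * (del / (b - a + (d - c) + 1))) by (field; lra).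
    apply Rmult_lt_compat_l; lra. }
  destruct Hw as [n Hn]. specialize (Bad n).
  destruct (HX n) as [X1 [X2 [X3 X4]]], (HY n) as [Y1 [Y2 [Y3 Y4]]].
  unfold bad, I, L in Bad. destruct (seqr n) as [[a' b'] [c' d']]. cbn [fst snd] in *.
  assert (HL : (b' - a') + (d' - c') < del) by (unfold Rdiv in *; lra).
  assert (F := rectI_near_diff H l (x, y) (e / 4) a' b' c' d' X1 Y1 ltac:(lra)
    (Hcont a' b' c' d' X2 X3 Y2 Y3)).
  assert (F' : Cmod (rectI H a' b' c' d') <= 2 * (e / 4) * (b' - a' + (d' - c')) ^ 2).
  { apply F. intros u v Hu Hv. apply Hd.
    eapply Rle_lt_trans; [apply (Cmod_le_sum (u + - x) (v + - y))|].
    apply Rle_lt_trans with ((b' - a') + (d' - c')); [|exact HL].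
    apply Rplus_le_compat; apply Rabs_le; lra. }
  assert (0 <= (b' - a' + (d' - c')) ^ 2) by apply pow2_ge_0. nra.
Qed.

(** By Goursat the difference of the two vertical integrals equals that of the two horizontal ones,
    each at most [K (b - a)]. *)
Lemma vertical_shift H a b M K : a <= b -> 0 <= M ->
  (forall x y, a <= x <= b -> - M <= y <= M -> cdiff H (x, y)) ->
  (forall x, a <= x <= b -> Cmod (H (x, M)) <= K /\ Cmod (H (x, - M)) <= K) ->
  Cmod (CI (fun y => H (b, y)) (- M) M - CI (fun y => H (a, y)) (- M) M)
  <= 2 * K * (b - a).
Proof.
  intros Hab HM HD HK.
  assert (G := goursat H a b (- M) M Hab ltac:(lra) HD). unfold rectI in G.
  assert (C1 : forall x, a <= x <= b -> ccont (fun x => H (x, - M)) x)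
    by (intros x Hx; apply cdiff_ccont_h, HD; lra).
  assert (C2 : forall x, a <= x <= b -> ccont (fun x => H (x, M)) x)
    by (intros x Hx; apply cdiff_ccont_h, HD; lra).
  assert (B1 := CI_le_const a b Hab _ K C1 (fun t Ht => proj2 (HK t Ht))).
  assert (B2 := CI_le_const a b Hab _ K C2 (fun t Ht => proj1 (HK t Ht))).
  set (A1 := CI (fun x => H (x, - M)) a b) in *.
  set (A2 := CI (fun x => H (x, M)) a b) in *.
  set (V1 := CI (fun y => H (b, y)) (- M) M) in *.
  set (V2 := CI (fun y => H (a, y)) (- M) M) in *.
  replace (Cmod (V1 - V2)) with (Cmod (Ci * (V1 - V2))) by (rewrite Cmod_mult, Cmod_Ci; ring).
  replace (Ci * (V1 - V2))%C with ((A1 + Ci * V1 - A2 - Ci * V2) + (A2 + - A1))%C by ring.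
  rewrite G. replace (0 + (A2 + - A1))%C with (A2 + - A1)%C by ring.
  eapply Rle_trans; [apply Cmod_triangle|]. rewrite Cmod_opp. lra.
Qed.

(** * Complex exponentials and Taylor expansion *)

Definition cis (y : R) : C := (cos y, sin y).

Definition cexp (z : C) : C := (exp (Re z) * cos (Im z), exp (Re z) * sin (Im z)).

Lemma cexp_add z w : cexp (z + w)%C = (cexp z * cexp w)%C.
Proof.
  unfold cexp, Cmult; simpl. rewrite exp_plus, cos_plus, sin_plus.
  unfold Re, Im. f_equal; ring.
Qed.

Lemma cexp_0 : cexp (RtoC 0) = RtoC 1.
Proof. unfold cexp, RtoC; simpl. rewrite exp_0, cos_0, sin_0. f_equal; ring. Qed.

Lemma Cmod_cis y : Cmod (cis y) = 1.
Proof.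
  unfold Cmod, cis; simpl. transitivity (sqrt 1); [f_equal|apply sqrt_1].
  pose proof (sin2_cos2 y) as H. unfold Rsqr in H. lra.
Qed.

Lemma cexp_cis z : cexp z = (RtoC (exp (Re z)) * cis (Im z))%C.
Proof. unfold cexp, cis, Cmult, RtoC; simpl. f_equal; ring. Qed.

Lemma Cmod_cexp z : Cmod (cexp z) = exp (Re z).
Proof.
  rewrite cexp_cis, Cmod_mult, Cmod_cis, Cmod_R, Rmult_1_r. apply Rabs_right.
  left; apply exp_pos.
Qed.

Lemma cis_add x y : cis (x + y) = (cis x * cis y)%C.
Proof. unfold cis, Cmult; simpl. rewrite cos_plus, sin_plus. f_equal; ring. Qed.

Lemma ccont_cis (g : R -> R) t : continuous g t -> ccont (fun t => cis (g t)) t.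
Proof.
  intros H. apply ccont_pair.
  - exact (continuous_comp g cos t H (continuous_cos (g t))).
  - exact (continuous_comp g sin t H (continuous_sin (g t))).
Qed.

Lemma continuous_exp_comp (g : R -> R) t : continuous g t -> continuous (fun t => exp (g t)) t.
Proof. intros H. exact (continuous_comp g exp t H (continuous_exp (g t))). Qed.

Lemma ccont_cexp g t : ccont g t -> ccont (fun t => cexp (g t)) t.
Proof.
  intros [H1 H2]. pose proof (continuous_exp_comp _ _ H1) as H3.
  apply ccont_pair; apply continuous_Rmult; try exact H3.
  - exact (continuous_comp (fun t => Im (g t)) cos t H2 (continuous_cos _)).
  - exact (continuous_comp (fun t => Im (g t)) sin t H2 (continuous_sin _)).
Qed.

Lemma Rcpow_cexp x s : Rcpow x s = cexp (s * RtoC (ln x)).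
Proof.
  unfold Rcpow, cexp, Rpower. simpl.
  replace (fst s * ln x - snd s * 0) with (Re s * ln x) by (unfold Re; ring).
  replace (fst s * 0 + snd s * ln x) with (Im s * ln x) by (unfold Im; ring).
  reflexivity.
Qed.

Lemma Rcpow_add x s s' : Rcpow x (s + s')%C = (Rcpow x s * Rcpow x s')%C.
Proof. rewrite !Rcpow_cexp, <- cexp_add. f_equal. ring. Qed.

Lemma Cmod_Rcpow x s : Cmod (Rcpow x s) = Rpower x (Re s).
Proof.
  rewrite Rcpow_cexp, Cmod_cexp. unfold Rpower. f_equal. simpl. unfold Re; ring.
Qed.

Lemma Rcpow_mult x y s : 0 < x -> 0 < y -> Rcpow (x * y) s = (Rcpow x s * Rcpow y s)%C.
Proof.
  intros Hx Hy. rewrite !Rcpow_cexp, ln_mult, <- cexp_add, RtoC_plus by auto.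
  f_equal. ring.
Qed.

Lemma Rcpow_R x r : Rcpow x (RtoC r) = RtoC (Rpower x r).
Proof.
  unfold Rcpow, RtoC; simpl. rewrite Rmult_0_l, cos_0, sin_0. f_equal; ring.
Qed.

Lemma ccont_ext (f g : R -> C) t : (forall s, f s = g s) -> ccont f t -> ccont g t.
Proof.
  intros E [H1 H2]; split.
  - eapply continuous_ext; [intros s; now rewrite <- E|exact H1].
  - eapply continuous_ext; [intros s; now rewrite <- E|exact H2].
Qed.

Lemma ccont_Rcpow_exponent x (g : R -> C) t : ccont g t -> ccont (fun t => Rcpow x (g t)) t.
Proof.
  intros H. apply ccont_ext with (fun t => cexp (g t * RtoC (ln x))%C).
  - intros s; now rewrite Rcpow_cexp.
  - exact (ccont_cexp (fun t => g t * RtoC (ln x))%C t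
             (ccont_mult _ _ _ H (ccont_const _ _))).
Qed.

Definition cderiv (f : R -> C) (t : R) (l : C) : Prop :=
  is_derive (fun t => Re (f t)) t (Re l) /\ is_derive (fun t => Im (f t)) t (Im l).

Lemma cderiv_ccont f t l : cderiv f t l -> ccont f t.
Proof.
  intros [H1 H2]; split;
    apply continuous_of_derive; eexists; eassumption.
Qed.

Lemma cderiv_Rcpow u z : 0 < u -> cderiv (fun u => Rcpow u z) u (z * Rcpow u (z - 1))%C.
Proof.
  intros Hu.
  assert (E : Rcpow u (z - 1)%C = (RtoC (/ u) * Rcpow u z)%C).
  { unfold Cminus. rewrite Rcpow_add.
    replace (- (1))%C with (RtoC (- (1))) by (unfold RtoC, Copp; simpl; f_equal; ring).
    rewrite Rcpow_R, Rpower_Ropp, Rpower_1 by auto. ring. }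
  rewrite E. destruct z as [z1 z2]. unfold Rcpow, Rpower, cderiv. simpl. split.
  - auto_derive; auto. field. lra.
  - auto_derive; auto. field. lra.
Qed.

Lemma cderiv_cexp_line z t : cderiv (fun t => cexp (RtoC t * z)%C) t (z * cexp (RtoC t * z))%C.
Proof.
  destruct z as [z1 z2]. unfold cexp, cderiv, Re, Im, Cmult, RtoC; cbn [fst snd].
  split; auto_derive; auto; unfold Rminus; ring.
Qed.

Lemma cderiv_scal (c : C) f t l : cderiv f t l -> cderiv (fun t => c * f t)%C t (c * l)%C.
Proof.
  intros [H1 H2]; split; simpl.
  - apply (is_derive_minus (V := R_NormedModule) (fun t => fst c * Re (f t))
      (fun t => snd c * Im (f t))); apply is_derive_scal; assumption.
  - apply (is_derive_plus (V := R_NormedModule) (fun t => fst c * Im (f t))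
      (fun t => snd c * Re (f t))); apply is_derive_scal; assumption.
Qed.

(** One application of the mean value theorem. The factor [1 / (n + 1)] of an integration is given
    up, so the same [K] serves at every order. *)
Lemma remainder_step (r r' : R -> R) H K n : 0 <= K ->
  (forall h, 0 <= h <= H -> is_derive r h (r' h)) -> r 0 = 0 ->
  (forall h, 0 <= h <= H -> Rabs (r' h) <= K * h ^ n) ->
  forall h, 0 <= h <= H -> Rabs (r h) <= K * h ^ S n.
Proof.
  intros HK Hr H0 Hr' h Hh.
  destruct (MVT_gen r 0 h r') as [c [Hc Ec]].
  - rewrite Rmin_left, Rmax_right by lra. intros x Hx. apply Hr; lra.
  - rewrite Rmin_left, Rmax_right by lra. intros x Hx.
    apply continuity_pt_filterlim.
    apply continuous_of_derive.
    eexists; apply Hr; lra.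
  - rewrite Rmin_left, Rmax_right in Hc by lra.
    rewrite H0, !Rminus_0_r in Ec. rewrite Ec, Rabs_mult, (Rabs_right h) by lra.
    simpl. replace (K * (h * h ^ n)) with (K * h ^ n * h) by ring.
    apply Rmult_le_compat_r; [lra|]. eapply Rle_trans; [apply Hr'; lra|].
    apply Rmult_le_compat_l; auto. apply pow_incr; lra.
Qed.

Lemma taylor4_real (w0 w1 w2 w3 w4 : R -> R) a H K : 0 <= K ->
  (forall t, a <= t <= a + H -> is_derive w0 t (w1 t) /\ is_derive w1 t (w2 t) /\
     is_derive w2 t (w3 t) /\ is_derive w3 t (w4 t) /\ Rabs (w4 t) <= K) ->
  forall h, 0 <= h <= H ->
  Rabs (w0 (a + h) - (w0 a + h * w1 a + h ^ 2 / 2 * w2 a + h ^ 3 / 6 * w3 a)) <= K * h ^ 4.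
Proof.
  intros HK HD.
  assert (R3 : forall h, 0 <= h <= H -> Rabs (w3 (a + h) - w3 a) <= K * h ^ 1).
  { apply (remainder_step _ (fun h => w4 (a + h))); auto.
    - intros h Hh. destruct (HD (a + h)) as [_ [_ [_ [D _]]]]; [lra|].
      auto_derive; [eexists; exact D|].
      replace (Derive (fun x => w3 x) (a + h)) with (w4 (a + h))
        by (symmetry; now apply is_derive_unique). field.
    - rewrite Rplus_0_r; ring.
    - intros h Hh. simpl. rewrite Rmult_1_r. apply HD; lra. }
  assert (R2 : forall h, 0 <= h <= H -> Rabs (w2 (a + h) - (w2 a + h * w3 a)) <= K * h ^ 2).
  { apply (remainder_step _ (fun h => w3 (a + h) - w3 a)); auto.
    - intros h Hh. destruct (HD (a + h)) as [_ [_ [D _]]]; [lra|].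
      auto_derive; [eexists; exact D|].
      replace (Derive (fun x => w2 x) (a + h)) with (w3 (a + h))
        by (symmetry; now apply is_derive_unique). field.
    - rewrite Rplus_0_r; ring. }
  assert (R1 : forall h, 0 <= h <= H ->
     Rabs (w1 (a + h) - (w1 a + h * w2 a + h ^ 2 / 2 * w3 a)) <= K * h ^ 3).
  { apply (remainder_step _ (fun h => w2 (a + h) - (w2 a + h * w3 a))); auto.
    - intros h Hh. destruct (HD (a + h)) as [_ [D _]]; [lra|].
      auto_derive; [eexists; exact D|].
      replace (Derive (fun x => w1 x) (a + h)) with (w2 (a + h))
        by (symmetry; now apply is_derive_unique). field.
    - rewrite Rplus_0_r; field. }
  apply (remainder_step _ (fun h => w1 (a + h) - (w1 a + h * w2 a + h ^ 2 / 2 * w3 a))); auto.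
  - intros h Hh. destruct (HD (a + h)) as [D _]; [lra|].
    auto_derive; [eexists; exact D|].
      replace (Derive (fun x => w0 x) (a + h)) with (w1 (a + h))
        by (symmetry; now apply is_derive_unique). field.
  - rewrite Rplus_0_r; field.
Qed.

(** The real estimate is applied to both components, hence the factor 2. *)
Lemma taylor4 (w0 w1 w2 w3 w4 : R -> C) a H K :
  (forall t, a <= t <= a + H -> cderiv w0 t (w1 t) /\ cderiv w1 t (w2 t) /\
     cderiv w2 t (w3 t) /\ cderiv w3 t (w4 t) /\ Cmod (w4 t) <= K) ->
  forall h, 0 <= h <= H ->
  Cmod (w0 (a + h)%R - (w0 a + RtoC h * w1 a + RtoC (h ^ 2 / 2)%R * w2 a
          + RtoC (h ^ 3 / 6)%R * w3 a))%C <= 2 * K * h ^ 4.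
Proof.
  intros HD h Hh.
  assert (HK : 0 <= K).
  { eapply Rle_trans; [apply (Cmod_ge_0 (w4 a))|]. apply HD; lra. }
  match goal with |- Cmod ?z <= _ => set (Z := z) end.
  apply Rle_trans with (Rabs (fst Z) + Rabs (snd Z)).
  { pose proof (Cmod_le_sum (fst Z) (snd Z)) as E.
    rewrite <- (surjective_pairing Z) in E. exact E. }
  replace (2 * K * h ^ 4) with (K * h ^ 4 + K * h ^ 4) by ring.
  apply Rplus_le_compat.
  - assert (T := taylor4_real (fun t => Re (w0 t)) (fun t => Re (w1 t)) (fun t => Re (w2 t))
      (fun t => Re (w3 t)) (fun t => Re (w4 t)) a H K HK).
    unfold Re in T. replace (fst Z) with
      (fst (w0 (a + h)) - (fst (w0 a) + h * fst (w1 a) + h ^ 2 / 2 * fst (w2 a)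
         + h ^ 3 / 6 * fst (w3 a))) by (unfold Z; simpl; ring).
    apply T; auto. intros t Ht. destruct (HD t Ht) as [[] [[] [[] [[] B]]]].
    split; [|split; [|split; [|split]]]; try assumption. eapply Rle_trans; [apply re_le_Cmod|exact B].
  - assert (T := taylor4_real (fun t => Im (w0 t)) (fun t => Im (w1 t)) (fun t => Im (w2 t))
      (fun t => Im (w3 t)) (fun t => Im (w4 t)) a H K HK).
    unfold Im in T. replace (snd Z) with
      (snd (w0 (a + h)) - (snd (w0 a) + h * snd (w1 a) + h ^ 2 / 2 * snd (w2 a)
         + h ^ 3 / 6 * snd (w3 a))) by (unfold Z; simpl; ring).
    apply T; auto. intros t Ht. destruct (HD t Ht) as [[] [[] [[] [[] B]]]].
    split; [|split; [|split; [|split]]]; try assumption. eapply Rle_trans; [apply im_le_Cmod|exact B].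
Qed.

Lemma exp_le_mono x y : x <= y -> exp x <= exp y.
Proof. intros [H| ->]; [left; now apply exp_increasing|right; reflexivity]. Qed.

(** Fourth-order expansion of [t -> cexp (t z)] on [[0, 1]], with [exp 1 <= 3]. Its remainder is at
    most [6 |z|^4 <= 6 |z|^3], and the cubic term adds [|z|^3 / 6]. *)
Lemma cexp_taylor3 z : Cmod z <= 1 ->
  Cmod (cexp z - 1 - z - z * z / RtoC 2)%C <= 7 * Cmod z ^ 3.
Proof.
  intros Hz. pose proof (Cmod_ge_0 z) as P.
  assert (T := taylor4 (fun t => cexp (RtoC t * z)) (fun t => z * cexp (RtoC t * z))%C
    (fun t => z * (z * cexp (RtoC t * z)))%C (fun t => z * (z * (z * cexp (RtoC t * z))))%C
    (fun t => z * (z * (z * (z * cexp (RtoC t * z)))))%C 0 1 (3 * Cmod z ^ 4)).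
  assert (T' := fun HD => T HD 1 ltac:(lra)). clear T.
  rewrite Rplus_0_l in T'.
  replace (RtoC 1 * z)%C with z in T' by ring.
  replace (RtoC 0 * z)%C with (RtoC 0) in T' by ring. rewrite cexp_0 in T'.
  set (r := (cexp z - 1 - z - z * z / RtoC 2)%C).
  replace r with ((cexp z - (1 + 1 * (z * 1) + RtoC (1 ^ 2 / 2)%R * (z * (z * 1))
     + RtoC (1 ^ 3 / 6)%R * (z * (z * (z * 1))))) + RtoC (/ 6)%R * (z * z * z))%C.
  2:{ unfold r. destruct z as [x y]. apply injective_projections; simpl; field. }
  eapply Rle_trans; [apply Cmod_triangle|]. rewrite !Cmod_mult, Cmod_R, Rabs_right by lra.
  assert (B : 2 * (3 * Cmod z ^ 4) * 1 ^ 4 <= 6 * Cmod z ^ 3).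
  { assert (0 <= Cmod z ^ 3) by (apply pow_le; auto). simpl in *. nra. }
  apply Rle_trans with (6 * Cmod z ^ 3 + / 6 * (Cmod z * Cmod z * Cmod z)).
  - apply Rplus_le_compat_r. eapply Rle_trans; [|exact B]. apply T'.
    intros t Ht. pose proof (cderiv_cexp_line z t) as D0.
    pose proof (cderiv_scal z _ _ _ D0) as D1. pose proof (cderiv_scal z _ _ _ D1) as D2.
    pose proof (cderiv_scal z _ _ _ D2) as D3.
    split; [exact D0|split; [exact D1|split; [exact D2|split; [exact D3|]]]].
    rewrite !Cmod_mult, Cmod_cexp.
    assert (E : exp (Re (RtoC t * z)%C) <= 3).
    { apply Rle_trans with (exp 1); [|apply exp_le_3]. apply exp_le_mono.
      eapply Rle_trans; [apply Rle_abs|]. eapply Rle_trans; [apply re_le_Cmod|].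
      rewrite Cmod_mult, Cmod_R, Rabs_right by lra. nra. }
    pose proof (exp_pos (Re (RtoC t * z)%C)).
    assert (0 <= Cmod z ^ 4) by (apply pow_le; auto). simpl in *. nra.
  - assert (0 <= Cmod z ^ 3) by (apply pow_le; auto). simpl in *. nra.
Qed.

Lemma cexp_taylor2 z : Cmod z <= 1 -> Cmod (cexp z - 1 - z)%C <= 8 * Cmod z ^ 2.
Proof.
  intros Hz. pose proof (Cmod_ge_0 z) as P.
  replace (cexp z - 1 - z)%C with
    ((cexp z - 1 - z - z * z / RtoC 2) + RtoC (/ 2)%R * (z * z))%C.
  2:{ destruct z as [x y]. apply injective_projections; simpl; field. }
  eapply Rle_trans; [apply Cmod_triangle|].
  assert (T := cexp_taylor3 z Hz). rewrite !Cmod_mult, Cmod_R, Rabs_right by lra.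
  simpl in *. nra.
Qed.

Lemma cdiff_Rcpow_opp x s : cdiff (fun s => Rcpow x (- s)%C) s.
Proof.
  set (L := ln x). set (E := cexp (- s * RtoC L)%C).
  exists (- RtoC L * E)%C. intros e He.
  assert (PE : 0 <= Cmod E) by apply Cmod_ge_0.
  pose proof (Rabs_pos L) as PL.
  set (Q := 8 * Cmod E * Rabs L ^ 2 + 1).
  assert (HQ : 0 < Q) by (unfold Q; assert (0 <= Rabs L ^ 2) by (apply pow_le; auto); nra).
  (* The first radius keeps the exponent in the unit disc, where the Taylor bound holds; the second
     makes the quadratic remainder at most [e] times the distance. *)
  exists (Rmin (/ (Rabs L + 1)) (e / Q)). split.
  { apply Rmin_pos; [apply Rinv_0_lt_compat; lra|now apply Rdiv_lt_0_compat]. }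
  intros w Hw.
  assert (H1 := Rlt_le_trans _ _ _ Hw (Rmin_l _ _)).
  assert (H2 := Rlt_le_trans _ _ _ Hw (Rmin_r _ _)).
  rewrite !Rcpow_cexp. fold L. fold E.
  set (v := (- (w - s) * RtoC L)%C).
  replace (- w * RtoC L)%C with (- s * RtoC L + v)%C by (unfold v; ring).
  rewrite cexp_add. fold E.
  replace (E * cexp v - E - - RtoC L * E * (w - s))%C with (E * (cexp v - 1 - v))%C
    by (unfold v; ring).
  assert (Hv : Cmod v = Cmod (w - s) * Rabs L) by (unfold v; rewrite Cmod_mult, Cmod_opp, Cmod_R; ring).
  pose proof (Cmod_ge_0 (w - s)) as Pw.
  assert (H1' : Cmod (w - s) * (Rabs L + 1) < 1).
  { replace 1 with (/ (Rabs L + 1) * (Rabs L + 1)) at 2 by (field; lra).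
    apply Rmult_lt_compat_r; lra. }
  assert (H2' : Cmod (w - s) * Q < e).
  { replace e with (e / Q * Q) by (field; lra). apply Rmult_lt_compat_r; lra. }
  rewrite Cmod_mult. eapply Rle_trans.
  { apply Rmult_le_compat_l; auto. apply cexp_taylor2. rewrite Hv. nra. }
  rewrite Hv.
  replace (Cmod E * (8 * (Cmod (w - s) * Rabs L) ^ 2)) with
    ((Cmod (w - s) * (Q - 1)) * Cmod (w - s)) by (unfold Q; ring).
  apply Rmult_le_compat_r; auto. nra.
Qed.

(* [(x^(-s) - 1) / s] has a removable singularity at 0. *)
Lemma cdiff_Rcpow_quotient x :
  cdiff (fun s => if Ceq_dec s (RtoC 0) then RtoC (- ln x)
                  else ((Rcpow x (- s) - 1) / s)%C) (RtoC 0).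
Proof.
  set (L := ln x). exists (RtoC (L ^ 2 / 2)). intros e He.
  pose proof (Rabs_pos L) as PL.
  set (Q := 7 * Rabs L ^ 3 + 1).
  assert (HQ : 0 < Q) by (unfold Q; assert (0 <= Rabs L ^ 3) by (apply pow_le; auto); nra).
  exists (Rmin (/ (Rabs L + 1)) (e / Q)). split.
  { apply Rmin_pos; [apply Rinv_0_lt_compat; lra|now apply Rdiv_lt_0_compat]. }
  intros w Hw.
  assert (H1 := Rlt_le_trans _ _ _ Hw (Rmin_l _ _)).
  assert (H2 := Rlt_le_trans _ _ _ Hw (Rmin_r _ _)).
  destruct (Ceq_dec (RtoC 0) (RtoC 0)) as [_|N]; [|now elim N].
  destruct (Ceq_dec w (RtoC 0)) as [->|Nw].
  { replace (RtoC (- L) - RtoC (- L) - RtoC (L ^ 2 / 2) * (0 - 0))%C with (RtoC 0) by ring.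
    rewrite Cmod_0. pose proof (Cmod_ge_0 (0 - 0)). nra. }
  replace (w - 0)%C with w in * by ring.
  set (v := (- w * RtoC L)%C).
  assert (Hv : Cmod v = Cmod w * Rabs L) by (unfold v; rewrite Cmod_mult, Cmod_opp, Cmod_R; ring).
  pose proof (Cmod_ge_0 w) as Pw.
  assert (Pw' : 0 < Cmod w) by now apply Cmod_gt_0.
  assert (H1' : Cmod w * (Rabs L + 1) < 1).
  { replace 1 with (/ (Rabs L + 1) * (Rabs L + 1)) at 2 by (field; lra).
    apply Rmult_lt_compat_r; lra. }
  assert (H2' : Cmod w * Q < e).
  { replace e with (e / Q * Q) by (field; lra). apply Rmult_lt_compat_r; lra. }
  rewrite Rcpow_cexp. fold L. fold v.
  assert (E2 : RtoC (L ^ 2 / 2) = (RtoC L * RtoC L / RtoC 2)%C).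
  { apply injective_projections; simpl; field. }
  assert (N2 : RtoC 2 <> RtoC 0) by (intros Q0; apply RtoC_inj in Q0; lra).
  replace ((cexp v - 1) / w - RtoC (- L) - RtoC (L ^ 2 / 2) * w)%C with
    ((cexp v - 1 - v - v * v / RtoC 2) / w)%C
    by (rewrite E2, RtoC_opp; unfold v; field; auto).
  rewrite Cmod_div by auto. apply Rmult_le_reg_r with (Cmod w); auto.
  unfold Rdiv. rewrite Rmult_assoc, Rinv_l, Rmult_1_r by lra.
  eapply Rle_trans; [apply cexp_taylor3; rewrite Hv; nra|]. rewrite Hv.
  replace (7 * (Cmod w * Rabs L) ^ 3) with ((Cmod w * (Q - 1)) * Cmod w * Cmod w)
    by (unfold Q; ring).
  repeat apply Rmult_le_compat_r; auto. nra.
Qed.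

(** * Fourier inversion *)

Lemma sq_sum_pos d w : 0 < d -> 0 < d ^ 2 + w ^ 2.
Proof. intros Hd. pose proof (pow2_ge_0 w). nra. Qed.

Lemma RInt_exp_cos d w M : 0 < d ->
  RInt (fun t => exp (- (d * t)) * cos (t * w)) 0 M
  = (d + exp (- (d * M)) * (w * sin (M * w) - d * cos (M * w))) / (d ^ 2 + w ^ 2).
Proof.
  intros Hd. assert (Hdw : d ^ 2 + w ^ 2 <> 0) by nra.
  set (A := fun t => exp (- (d * t)) * (w * sin (t * w) - d * cos (t * w)) / (d ^ 2 + w ^ 2)).
  apply is_RInt_unique.
  replace ((d + exp (- (d * M)) * (w * sin (M * w) - d * cos (M * w))) / (d ^ 2 + w ^ 2))
    with (minus (A M) (A 0)).
  - apply (is_RInt_derive (V := R_CompleteNormedModule) A).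
    + intros t _. unfold A. auto_derive; auto. field; nra.
    + intros t _. apply continuous_of_derive.
      auto_derive; auto.
  - unfold minus, plus, opp, A; simpl.
    rewrite Rmult_0_r, Ropp_0, exp_0, Rmult_0_l, sin_0, cos_0. field; nra.
Qed.

Lemma continuous_damping d t : continuous (fun t => exp (- (d * Rabs t))) t.
Proof.
  apply continuous_exp_comp.
  apply (continuous_opp (V := R_NormedModule) (fun t => d * Rabs t)).
  apply continuous_Rmult; [apply continuous_const|].
  apply (continuous_Rabs t).
Qed.

(** The damping makes the truncated Fourier kernel explicit: it is the Poisson kernel
    [2 d / (d^2 + w^2)] plus a term of order [exp (- d M)]. *)
Lemma CI_damped_cis d w M : 0 < d -> 0 <= M ->
  CI (fun t => RtoC (exp (- (d * Rabs t))) * cis (t * w))%C (- M) M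
  = RtoC (2 * (d + exp (- (d * M)) * (w * sin (M * w) - d * cos (M * w))) / (d ^ 2 + w ^ 2)).
Proof.
  intros Hd HM.
  set (g := fun t => (RtoC (exp (- (d * Rabs t))) * cis (t * w))%C).
  assert (Cg : forall t, ccont g t).
  { intros t. apply ccont_mult.
    - apply ccont_RtoC, continuous_damping.
    - apply ccont_cis. apply continuous_Rmult; [apply continuous_id|apply continuous_const]. }
  assert (Cgo : forall t, ccont (fun t => g (- t)) t).
  { intros t. apply ccont_comp; auto.
    apply (continuous_opp (V := R_NormedModule) (fun x => x)), continuous_id. }
  rewrite <- (CI_Chasles g (- M) 0 M) by (auto; lra).
  rewrite <- (CI_opp_arg g (- M) 0), Ropp_0, Ropp_involutive by (auto; lra).
  rewrite <- CI_plus by auto.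
  rewrite (CI_ext 0 M HM _ (fun t => RtoC 2 * RtoC (exp (- (d * t)) * cos (t * w)))%C).
  2:{ intros t Ht. unfold g, cis. rewrite Rabs_Ropp, Rabs_right by lra.
      replace (- t * w) with (- (t * w)) by ring. rewrite cos_neg, sin_neg.
      apply injective_projections; simpl; ring. }
  rewrite CI_scal; auto.
  2:{ intros t _. apply ccont_RtoC.
      apply continuous_of_derive. auto_derive; auto. }
  unfold CI. simpl. rewrite RInt_exp_cos by auto.
  rewrite RInt_const.
  assert (Hdw : d ^ 2 + w ^ 2 <> 0) by nra.
  unfold scal; simpl; unfold mult; simpl.
  apply injective_projections; simpl; [|ring].
  field; nra.
Qed.

Lemma atan_le_id y : 0 <= y -> atan y <= y.
Proof.
  intros Hy. destruct (MVT_gen atan 0 y (fun x => / (1 + x ^ 2))) as [c [Hc E]].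
  - intros x _. auto_derive; auto. field. nra.
  - intros x _. apply continuity_pt_filterlim.
    apply continuous_of_derive. auto_derive; auto.
  - rewrite atan_0, !Rminus_0_r in E. rewrite E.
    assert (/ (1 + c ^ 2) <= 1) by (rewrite <- Rinv_1; apply Rinv_le_contravar; nra).
    nra.
Qed.

Lemma RInt_poisson d u r : 0 < d -> 0 < r ->
  RInt (fun v => 2 * d / (d ^ 2 + (v - u) ^ 2)) (u - r) (u + r) = 4 * atan (r / d).
Proof.
  intros Hd Hr. apply is_RInt_unique.
  replace (4 * atan (r / d)) with
    (minus (2 * atan ((u + r - u) / d)) (2 * atan ((u - r - u) / d))).
  - apply (is_RInt_derive (V := R_CompleteNormedModule) (fun v => 2 * atan ((v - u) / d))).
    + intros v _. auto_derive; auto. field.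
      pose proof (sq_sum_pos d (v - u) Hd). split; lra.
    + intros v _. apply continuous_of_derive.
      auto_derive. pose proof (sq_sum_pos d (v - u) Hd). simpl in *; lra.
  - unfold minus, plus, opp; simpl.
    replace ((u + r - u) / d) with (r / d) by (field; lra).
    replace ((u - r - u) / d) with (- (r / d)) by (field; lra).
    rewrite atan_opp. ring.
Qed.

Lemma continuous_poisson d u v : 0 < d ->
  continuous (fun v => 2 * d / (d ^ 2 + (v - u) ^ 2)) v.
Proof.
  intros Hd. apply continuous_of_derive.
  auto_derive. pose proof (sq_sum_pos d (v - u) Hd). simpl in *; lra.
Qed.

(** The kernel has total mass [2 PI]. At distance at least [r] from [u] it is at most [2 d / r^2],
    which is integrated against the [L^1] bound [A]; nearer to [u], continuity of [phi] applies. The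
    window [[a, b]] stays free because the caller chooses it after [d]. *)
Lemma poisson_approx (phi : R -> C) A u e :
  (forall v, ccont phi v) ->
  (forall a b, a <= b -> RInt (fun v => Cmod (phi v)) a b <= A) -> 0 < e ->
  exists r d0, 0 < r /\ 0 < d0 /\ forall d a b, 0 < d < d0 -> a <= u - r -> u + r <= b ->
    Cmod (CI (fun v => RtoC (2 * d / (d ^ 2 + (v - u) ^ 2)) * phi v)%C a b
          - RtoC (2 * PI) * phi u) <= e.
Proof.
  intros Hc HA He. pose proof PI_RGT_0 as PP.
  assert (A0 : 0 <= A).
  { specialize (HA 0 0 (Rle_refl 0)). rewrite RInt_point in HA. exact HA. }
  set (e1 := e / (4 * PI)). assert (He1 : 0 < e1) by (apply Rdiv_lt_0_compat; lra).
  destruct (Hc u) as [C1 C2].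
  destruct (proj1 (continuous_eps _ _) C1 (e1 / 2) ltac:(lra)) as [d1 [Hd1 H1]].
  destruct (proj1 (continuous_eps _ _) C2 (e1 / 2) ltac:(lra)) as [d2 [Hd2 H2]].
  set (r := Rmin d1 d2 / 2).
  assert (Hr : 0 < r) by (unfold r; pose proof (Rmin_pos _ _ Hd1 Hd2); lra).
  assert (Near : forall v, u - r <= v <= u + r -> Cmod (phi v - phi u) <= e1).
  { intros v Hv.
    assert (Rabs (v - u) < Rmin d1 d2).
    { apply Rle_lt_trans with r; [apply Rabs_le; lra|unfold r in *; lra]. }
    eapply Rle_trans; [apply (Cmod_le_sum (Re (phi v) + - Re (phi u)) (Im (phi v) + - Im (phi u)))|].
    specialize (H1 v (Rlt_le_trans _ _ _ H (Rmin_l _ _))).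
    specialize (H2 v (Rlt_le_trans _ _ _ H (Rmin_r _ _))). unfold Rminus in H1, H2. lra. }
  set (B := Cmod (phi u)). assert (PB : 0 <= B) by apply Cmod_ge_0.
  (* [Q] collects all contributions linear in [d]: the two far ranges, the defect of the central
     mass from [2 PI], and a margin of 1 that makes [Q] positive. *)
  set (Q := 4 * A / r ^ 2 + 4 * B / r + 1).
  assert (HQ : 0 < Q).
  { assert (0 <= 4 * A / r ^ 2) by (apply Rmult_le_pos; [lra|left; apply Rinv_0_lt_compat; nra]).
    assert (0 <= 4 * B / r) by (apply Rmult_le_pos; [lra|left; apply Rinv_0_lt_compat; nra]).
    unfold Q; lra. }
  exists r, (e / 2 / Q). split; [exact Hr|]. split; [apply Rdiv_lt_0_compat; lra|].
  intros d a b [Hd Hd0] Ha Hb.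
  set (p := fun v => 2 * d / (d ^ 2 + (v - u) ^ 2)).
  assert (Pp : forall v, 0 < p v) by (intros v; apply Rdiv_lt_0_compat; [lra|now apply sq_sum_pos]).
  assert (Cp : forall v, continuous p v) by (intros v; now apply continuous_poisson).
  assert (CF : forall v, ccont (fun v => RtoC (p v) * phi v)%C v).
  { intros v. apply ccont_mult; auto. apply ccont_RtoC; auto. }
  change (Cmod (CI (fun v => RtoC (p v) * phi v)%C a b - RtoC (2 * PI) * phi u) <= e).
  rewrite <- (CI_Chasles _ a (u - r) b) by (auto; lra).
  rewrite <- (CI_Chasles _ (u - r) (u + r) b) by (auto; lra).
  assert (Far : forall x y, x <= y -> (forall v, x <= v <= y -> r <= Rabs (v - u)) ->
     Cmod (CI (fun v => RtoC (p v) * phi v)%C x y) <= 2 * d / r ^ 2 * A).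
  { intros x y Hxy Hf. apply Rle_trans with
      (2 * d / r ^ 2 * RInt (fun v => Cmod (phi v)) x y).
    - apply CI_le_scal; auto. { intros; now apply ccont_Cmod. }
      intros v Hv. rewrite Cmod_mult, Cmod_R, Rabs_right by (apply Rle_ge; left; auto).
      apply Rmult_le_compat_r; [apply Cmod_ge_0|].
      unfold p. apply Rmult_le_compat_l; [lra|]. apply Rinv_le_contravar; [nra|].
      specialize (Hf v Hv). rewrite <- (pow2_abs (v - u)). nra.
    - apply Rmult_le_compat_l; auto. left. apply Rdiv_lt_0_compat; nra. }
  assert (F1 := Far a (u - r) Ha). assert (F2 := Far (u + r) b Hb).
  assert (N1 : forall v, a <= v <= u - r -> r <= Rabs (v - u))
    by (intros v Hv; rewrite Rabs_left1; lra).
  assert (N2 : forall v, u + r <= v <= b -> r <= Rabs (v - u))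
    by (intros v Hv; rewrite Rabs_right; lra).
  assert (F1' := F1 N1). assert (F2' := F2 N2).
  clear F1 F2 Far.
  assert (Hm : u - r <= u + r) by lra.
  assert (Mid : CI (fun v => RtoC (p v) * phi v)%C (u - r) (u + r)
     = (CI (fun v => RtoC (p v) * (phi v - phi u))%C (u - r) (u + r)
        + RtoC (4 * atan (r / d)) * phi u)%C).
  { rewrite <- (RInt_poisson d u r) by auto. fold p.
    replace (RtoC (RInt p (u - r) (u + r)) * phi u)%C
      with (CI (fun v => phi u * RtoC (p v))%C (u - r) (u + r)).
    - rewrite <- CI_plus; auto.
      + apply CI_ext; auto. intros t _. ring.
      + intros t _. apply ccont_mult; [apply ccont_RtoC; auto|].
        apply ccont_minus; auto. apply ccont_const.
      + intros t _. apply ccont_mult; [apply ccont_const|apply ccont_RtoC; auto].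
    - rewrite CI_scal; auto. 2:{ intros; apply ccont_RtoC; auto. }
      rewrite Cmult_comm. f_equal. unfold CI, RtoC; simpl. f_equal.
      rewrite RInt_const. apply Rmult_0_r. }
  assert (M1 : Cmod (CI (fun v => RtoC (p v) * (phi v - phi u))%C (u - r) (u + r))
     <= e1 * (4 * atan (r / d))).
  { rewrite <- (RInt_poisson d u r) by auto. fold p. apply CI_le_scal; auto.
    - intros t _. apply ccont_mult; [apply ccont_RtoC; auto|].
      apply ccont_minus; auto. apply ccont_const.
    - intros t Ht. rewrite Cmod_mult, Cmod_R, Rabs_right by (apply Rle_ge; left; auto).
      rewrite Rmult_comm. apply Rmult_le_compat_r; [left; auto|]. now apply Near. }
  assert (Hrd : 0 < r / d) by (apply Rdiv_lt_0_compat; lra).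
  pose proof (atan_bound (r / d)) as [_ At].
  assert (At2 : PI / 2 - d / r <= atan (r / d)).
  { assert (E := atan_inv (r / d) Hrd).
    assert (L := atan_le_id (/ (r / d)) ltac:(left; now apply Rinv_0_lt_compat)).
    replace (/ (r / d)) with (d / r) in * by (field; lra). lra. }
  rewrite Mid.
  set (I1 := CI _ a (u - r)) in *. set (I2 := CI _ (u + r) b) in *.
  set (I3 := CI (fun v => RtoC (p v) * (phi v - phi u))%C _ _) in *.
  replace (I1 + (I3 + RtoC (4 * atan (r / d)) * phi u + I2) - RtoC (2 * PI) * phi u)%C
    with ((I1 + I2) + (I3 + RtoC (4 * atan (r / d) - 2 * PI) * phi u))%C
    by (rewrite RtoC_minus; ring).
  eapply Rle_trans; [apply Cmod_triangle|].
  pose proof (Cmod_triangle I1 I2) as T1.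
  pose proof (Cmod_triangle I3 (RtoC (4 * atan (r / d) - 2 * PI) * phi u)) as T2.
  rewrite Cmod_mult, Cmod_R, Rabs_left1 in T2 by lra. fold B in T2.
  assert (S1 : e1 * (4 * atan (r / d)) <= e / 2).
  { replace (e / 2) with (e1 * (2 * PI)) by (unfold e1; field; lra).
    apply Rmult_le_compat_l; lra. }
  assert (S2 : - (4 * atan (r / d) - 2 * PI) * B <= 4 * d / r * B)
    by (apply Rmult_le_compat_r; auto; unfold Rdiv in *; lra).
  assert (S3 : d * Q < e / 2).
  { replace (e / 2) with (e / 2 / Q * Q) by (field; lra). apply Rmult_lt_compat_r; lra. }
  assert (S4 : d * Q = 4 * d / r * B + 2 * (2 * d / r ^ 2 * A) + d)
    by (unfold Q; field; lra).
  lra.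
Qed.

Lemma continuous_inv_1_sq t : continuous (fun t => / (1 + t ^ 2)) t.
Proof.
  apply continuous_of_derive. auto_derive. nra.
Qed.

Lemma RInt_inv_1_sq_le a b : a <= b -> RInt (fun t => / (1 + t ^ 2)) a b <= PI.
Proof.
  intros Hab. rewrite (is_RInt_unique _ _ _ (minus (atan b) (atan a))).
  - unfold minus, plus, opp; simpl. pose proof (atan_bound a). pose proof (atan_bound b). lra.
  - apply (is_RInt_derive (V := R_CompleteNormedModule) atan).
    + intros t _. auto_derive; auto. field. nra.
    + intros t _. apply continuous_inv_1_sq.
Qed.

(** Four replacements cost [e / 4] each: insert the damping [exp (- d |t|)], replace [Phi] by the
    transform over a finite window, exchange the integrals and replace the resulting kernel by the
    Poisson kernel, then use [poisson_approx]. The order of choice is [d], then [M], then the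
    window; this requires the window to be uniform in [t]. *)
Theorem fourier_inversion (phi Phi : R -> C) A K u e :
  (forall v, ccont phi v) ->
  (forall a b, a <= b -> RInt (fun v => Cmod (phi v)) a b <= A) ->
  (forall t, ccont Phi t) ->
  (forall t, Cmod (Phi t) * (1 + t ^ 2) ^ 2 <= K) ->
  (forall e, 0 < e -> exists a0 b0, forall t a b, a <= a0 -> b0 <= b ->
     Cmod (Phi t - CI (fun v => phi v * cis (t * v))%C a b) <= e) ->
  0 < e ->
  exists M0, forall M, M0 <= M ->
    Cmod (CI (fun t => Phi t * cis (- (t * u)))%C (- M) M - RtoC (2 * PI) * phi u) <= e.
Proof.
  intros Hc HA HP HK Hlim He. pose proof PI_RGT_0 as PP.
  assert (A0 : 0 <= A).
  { specialize (HA 0 0 (Rle_refl 0)). rewrite RInt_point in HA. exact HA. }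
  assert (K0 : 0 <= K).
  { eapply Rle_trans; [|apply (HK 0)]. apply Rmult_le_pos; [apply Cmod_ge_0|nra]. }
  destruct (poisson_approx phi A u (e / 4) Hc HA ltac:(lra)) as [r [d0 [Hr [Hd0 Hap]]]].
  (* Damping changes the integrand by at most [d |t| |Phi t| <= K d / (1 + t^2)], so it costs at
     most [K d PI]. *)
  set (d := Rmin (d0 / 2) (e / (4 * (K * PI + 1)))).
  assert (HKP : 0 <= K * PI) by nra.
  assert (Hd : 0 < d) by (apply Rmin_pos; [lra|apply Rdiv_lt_0_compat; lra]).
  assert (Hdd0 : d < d0) by (apply Rle_lt_trans with (d0 / 2); [apply Rmin_l|lra]).
  assert (HdK : K * d * PI <= e / 4).
  { assert (d <= e / (4 * (K * PI + 1))) by apply Rmin_r.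
    apply Rle_trans with ((K * PI + 1) * d); [nra|].
    apply Rle_trans with ((K * PI + 1) * (e / (4 * (K * PI + 1)))).
    - apply Rmult_le_compat_l; lra.
    - right; field; lra. }
  (* The kernel differs from the Poisson kernel by at most [3 exp (- d M) / d], and
     [exp (- d M) <= 1 / (d M)]. The condition is therefore [3 A / (d^2 M) <= e / 4]. *)
  exists (Rmax 1 (12 * A / (d ^ 2 * e))). intros M HM.
  assert (HM1 : 1 <= M) by (eapply Rle_trans; [apply Rmax_l|exact HM]).
  assert (HM2 : 12 * A / (d ^ 2 * e) <= M) by (eapply Rle_trans; [apply Rmax_r|exact HM]).
  clear HM. assert (HMM : - M <= M) by lra.
  (* An error [e'] on an interval of length [2 M] costs [e / 4]. *)
  set (e' := e / (8 * M)). assert (He' : 0 < e') by (apply Rdiv_lt_0_compat; lra).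
  destruct (Hlim e' He') as [a0 [b0 Hab0]].
  set (a := Rmin a0 (u - r)). set (b := Rmax b0 (u + r)).
  assert (Ha : a <= a0 /\ a <= u - r) by (split; [apply Rmin_l|apply Rmin_r]).
  assert (Hb : b0 <= b /\ u + r <= b) by (split; [apply Rmax_l|apply Rmax_r]).
  assert (Hab : a <= b) by lra.
  set (E := fun t => RtoC (exp (- (d * Rabs t)))).
  set (kk := fun t => cis (- (t * u))).
  assert (Ckk : forall t, ccont kk t).
  { intros t. apply ccont_cis. apply (continuous_opp (V := R_NormedModule) (fun t => t * u)).
    apply continuous_Rmult; [apply continuous_id|apply continuous_const]. }
  assert (CE : forall t, ccont E t) by (intros t; apply ccont_RtoC, continuous_damping).
  assert (E1 : forall t, Cmod (E t) <= 1).
  { intros t. unfold E. rewrite Cmod_R, Rabs_right by (left; apply exp_pos).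
    rewrite <- exp_0. apply exp_le_mono. pose proof (Rabs_pos t). nra. }
  set (inner := fun t => CI (fun v => phi v * cis (t * v))%C a b).
  assert (C2 : forall t v, ccont2 (fun t v => phi v * cis (t * v))%C t v).
  { intros t v. apply ccont2_mult.
    - apply (ccont2_snd phi); auto.
    - split; simpl.
      + apply (continuity_1d_2d_pt_comp cos (fun t v => t * v)); [apply continuity_cos|].
        apply continuity_2d_pt_mult; [apply continuity_2d_pt_id1|apply continuity_2d_pt_id2].
      + apply (continuity_1d_2d_pt_comp sin (fun t v => t * v)); [apply continuity_sin|].
        apply continuity_2d_pt_mult; [apply continuity_2d_pt_id1|apply continuity_2d_pt_id2]. }
  assert (Cin : forall t, ccont inner t).
  { intros t. apply (ccont_CI_param (fun t v => phi v * cis (t * v))%C (t - 1)); auto. lra. }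
  set (J := CI (fun t => Phi t * kk t)%C (- M) M).
  set (J1 := CI (fun t => E t * (Phi t * kk t))%C (- M) M).
  set (J2 := CI (fun t => (E t * kk t) * inner t)%C (- M) M).
  set (p := fun v => 2 * d / (d ^ 2 + (v - u) ^ 2)).
  set (J3 := CI (fun v => RtoC (p v) * phi v)%C a b).
  assert (B1 : Cmod (J - J1) <= e / 4).
  { unfold J, J1. rewrite <- CI_minus; auto.
    2:{ intros t _. now apply ccont_mult. }
    2:{ intros t _. apply ccont_mult; auto. now apply ccont_mult. }
    eapply Rle_trans; [|exact HdK].
    apply Rle_trans with (K * d * RInt (fun t => / (1 + t ^ 2)) (- M) M).
    - apply CI_le_scal; auto.
      + intros t _. apply ccont_minus; [now apply ccont_mult|].
        apply ccont_mult; auto. now apply ccont_mult.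
      + intros; apply continuous_inv_1_sq.
      + intros t _.
        replace (Phi t * kk t - E t * (Phi t * kk t))%C with ((1 - E t) * Phi t * kk t)%C by ring.
        unfold kk. rewrite !Cmod_mult, Cmod_cis, Rmult_1_r. unfold E.
        rewrite <- RtoC_minus, Cmod_R.
        pose proof (Rabs_pos t) as Pt.
        assert (X1 : 1 - d * Rabs t <= exp (- (d * Rabs t))).
        { pose proof (exp_ineq1_le (- (d * Rabs t))). lra. }
        assert (X2 : exp (- (d * Rabs t)) <= 1).
        { rewrite <- exp_0. apply exp_le_mono. nra. }
        rewrite Rabs_right by lra.
        pose proof (HK t) as HKt. pose proof (Cmod_ge_0 (Phi t)) as PPt.
        assert (Ht : Rabs t <= 1 + t ^ 2) by (rewrite <- (pow2_abs t); nra).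
        assert (P1 : 0 < 1 + t ^ 2) by nra.
        apply Rmult_le_reg_r with ((1 + t ^ 2) ^ 2); [nra|].
        replace (K * d * / (1 + t ^ 2) * (1 + t ^ 2) ^ 2) with (d * (1 + t ^ 2) * K)
          by (field; nra).
        rewrite Rmult_assoc. apply Rmult_le_compat; auto; try lra.
        * apply Rmult_le_pos; auto. nra.
        * nra.
    - apply Rmult_le_compat_l; [nra|]. apply RInt_inv_1_sq_le; lra. }
  assert (B2 : Cmod (J1 - J2) <= e / 4).
  { unfold J1, J2. rewrite <- CI_minus; auto.
    2:{ intros t _. apply ccont_mult; auto. now apply ccont_mult. }
    2:{ intros t _. apply ccont_mult; auto. now apply ccont_mult. }
    replace (e / 4) with (e' * (M - - M)) by (unfold e'; field; lra).
    apply CI_le_const; auto.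
    - intros t _. apply ccont_minus; apply ccont_mult; auto; now apply ccont_mult.
    - intros t _.
      replace (E t * (Phi t * kk t) - E t * kk t * inner t)%C
        with (E t * kk t * (Phi t - inner t))%C by ring.
      unfold kk. rewrite !Cmod_mult, Cmod_cis, Rmult_1_r.
      specialize (Hab0 t a b (proj1 Ha) (proj1 Hb)). fold (inner t) in Hab0.
      specialize (E1 t). pose proof (Cmod_ge_0 (E t)). pose proof (Cmod_ge_0 (Phi t - inner t)).
      nra. }
  set (k := fun w => 2 * (d + exp (- (d * M)) * (w * sin (M * w) - d * cos (M * w)))
                     / (d ^ 2 + w ^ 2)).
  assert (Sw : J2 = CI (fun v => RtoC (k (v - u)%R) * phi v)%C a b).
  { assert (C2' : forall t v, ccont2 (fun t v => E t * kk t * (phi v * cis (t * v)))%C t v).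
    { intros t v. apply ccont2_mult; [|apply C2].
      apply (ccont2_fst (fun t => E t * kk t)%C). now apply ccont_mult. }
    assert (Cph : forall t v, ccont (fun v => phi v * cis (t * v))%C v).
    { intros t v. apply ccont_mult; auto. apply ccont_cis.
      apply continuous_Rmult; [apply continuous_const|apply continuous_id]. }
    assert (S := CI_swap (fun t v => E t * kk t * (phi v * cis (t * v)))%C (- M - 1) (- M) M a b
      ltac:(lra) HMM Hab (fun t v _ => C2' t v)).
    unfold J2. transitivity (CI (fun u0 => CI (fun v => E u0 * kk u0 * (phi v * cis (u0 * v)))%C a b)
       (- M) M).
    - apply CI_ext; auto. intros t _. rewrite CI_scal; auto.
    - rewrite <- S. apply CI_ext; auto. intros v _.
      rewrite (CI_ext _ _ HMM _ (fun t => phi v * (E t * cis (t * (v - u)%R)))%C).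
      + rewrite CI_scal; auto.
        * unfold E. rewrite CI_damped_cis by lra. fold (k (v - u)). apply Cmult_comm.
        * intros t _. apply ccont_mult; auto. apply ccont_cis.
          apply continuous_Rmult; [apply continuous_id|apply continuous_const].
      + intros t _. replace (t * (v - u)) with (- (t * u) + t * v) by ring.
        rewrite cis_add. unfold kk. ring. }
  assert (Ck : forall v, continuous (fun v => k (v - u)) v).
  { intros v. apply continuous_of_derive.
    unfold k. auto_derive. pose proof (sq_sum_pos d (v - u) Hd). simpl in *; lra. }
  assert (Cp : forall v, continuous p v) by (intros v; now apply continuous_poisson).
  assert (B3 : Cmod (J2 - J3) <= e / 4).
  { rewrite Sw. unfold J3.
    assert (C1 : forall v, ccont (fun v => RtoC (k (v - u)%R) * phi v)%C v).
    { intros v. apply ccont_mult; auto. apply (ccont_RtoC (fun v => k (v - u))); auto. }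
    assert (C1' : forall v, ccont (fun v => RtoC (p v) * phi v)%C v).
    { intros v. apply ccont_mult; auto. apply ccont_RtoC; auto. }
    rewrite <- CI_minus; auto.
    (* From [2 |w| d <= d^2 + w^2] follows [(2 |w| + 2 d) / (d^2 + w^2) <= 3 / d]. *)
    set (Q := 3 * exp (- (d * M)) / d).
    assert (HQ : 0 < Q).
    { apply Rdiv_lt_0_compat; auto. pose proof (exp_pos (- (d * M))); lra. }
    apply Rle_trans with (Q * RInt (fun v => Cmod (phi v)) a b).
    - apply CI_le_scal; auto.
      + intros v _. now apply ccont_minus.
      + intros v _. now apply ccont_Cmod.
      + intros v _.
        replace (RtoC (k (v - u)%R) * phi v - RtoC (p v) * phi v)%C
          with (RtoC (k (v - u)%R - p v) * phi v)%C by (rewrite RtoC_minus; ring).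
        rewrite Cmod_mult, Cmod_R. apply Rmult_le_compat_r; [apply Cmod_ge_0|].
        unfold k, p. set (w := v - u).
        assert (Pw : 0 < d ^ 2 + w ^ 2) by now apply sq_sum_pos.
        replace (2 * (d + exp (- (d * M)) * (w * sin (M * w) - d * cos (M * w))) / (d ^ 2 + w ^ 2)
           - 2 * d / (d ^ 2 + w ^ 2)) with
          (exp (- (d * M)) * ((2 * w * sin (M * w) - 2 * d * cos (M * w)) / (d ^ 2 + w ^ 2)))
          by (field; nra).
        rewrite Rabs_mult, (Rabs_right (exp _)) by (left; apply exp_pos).
        replace Q with (exp (- (d * M)) * (3 * / d)) by (unfold Q; field; lra). unfold Rdiv.
        apply Rmult_le_compat_l; [left; apply exp_pos|].
        rewrite Rabs_mult, (Rabs_right (/ _)) by (left; now apply Rinv_0_lt_compat).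
        apply Rmult_le_reg_r with (d ^ 2 + w ^ 2); auto.
        rewrite Rmult_assoc, Rinv_l, Rmult_1_r by lra.
        apply Rmult_le_reg_r with d; auto.
        replace (3 * / d * (d ^ 2 + w ^ 2) * d) with (3 * (d ^ 2 + w ^ 2)) by (field; lra).
        assert (T : Rabs (2 * w * sin (M * w) - 2 * d * cos (M * w)) <= 2 * Rabs w + 2 * d).
        { unfold Rminus. eapply Rle_trans; [apply Rabs_triang|]. rewrite Rabs_Ropp, !Rabs_mult.
          rewrite (Rabs_right 2), (Rabs_right d) by lra.
          assert (Rabs (sin (M * w)) <= 1) by (apply Rabs_le; apply SIN_bound).
          assert (Rabs (cos (M * w)) <= 1) by (apply Rabs_le; apply COS_bound).
          pose proof (Rabs_pos w). nra. }
        rewrite <- (pow2_abs w). set (aw := Rabs w) in *.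
        apply Rle_trans with ((2 * aw + 2 * d) * d); [apply Rmult_le_compat_r; lra|].
        pose proof (pow2_ge_0 (aw - d)). pose proof (pow2_ge_0 aw). nra.
    - apply Rle_trans with (Q * A); [apply Rmult_le_compat_l; [lra|auto]|].
      assert (X : exp (- (d * M)) * (d * M) <= 1).
      { rewrite exp_Ropp. apply Rmult_le_reg_l with (exp (d * M)); [apply exp_pos|].
        rewrite <- Rmult_assoc, Rinv_r, Rmult_1_l, Rmult_1_r
          by (apply Rgt_not_eq, exp_pos).
        pose proof (exp_ineq1_le (d * M)). lra. }
      assert (Y : 12 * A <= M * (d ^ 2 * e)).
      { assert (Pde : 0 < d ^ 2 * e) by (apply Rmult_lt_0_compat; nra).
        apply Rmult_le_reg_r with (/ (d ^ 2 * e)); [now apply Rinv_0_lt_compat|].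
        rewrite (Rmult_assoc M), Rinv_r, Rmult_1_r by lra. exact HM2. }
      unfold Q. apply Rmult_le_reg_r with d; auto.
      replace (3 * exp (- (d * M)) / d * A * d) with (3 * A * exp (- (d * M))) by (field; lra).
      pose proof (exp_pos (- (d * M))) as PE. set (E0 := exp (- (d * M))) in *.
      assert (Z1 : 12 * A * E0 <= M * (d ^ 2 * e) * E0) by (apply Rmult_le_compat_r; lra).
      assert (Z2 : E0 * (d * M) * (d * e) <= 1 * (d * e)) by (apply Rmult_le_compat_r; nra).
      nra. }
  assert (B4 := Hap d a b (conj Hd Hdd0) (proj2 Ha) (proj2 Hb)). fold p in B4. fold J3 in B4.
  change (Cmod (J - RtoC (2 * PI) * phi u) <= e).
  replace (J - RtoC (2 * PI) * phi u)%C with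
    ((J - J1) + ((J1 - J2) + ((J2 - J3) + (J3 - RtoC (2 * PI) * phi u))))%C by ring.
  eapply Rle_trans; [apply Cmod_triangle|].
  eapply Rle_trans; [apply Rplus_le_compat_l, Cmod_triangle|].
  eapply Rle_trans; [apply Rplus_le_compat_l, Rplus_le_compat_l, Cmod_triangle|].
  change (fun v => RtoC (2 * d / (d ^ 2 + (v - u) ^ 2)) * phi v)%C
    with (fun v => RtoC (p v) * phi v)%C in B4. fold J3 in B4. lra.
Qed.

(** * Mellin inversion *)

(** Valid at 0 too, where both inverses are 0. Integrands can therefore be rewritten for every real
    argument, as [ccont_ext] requires. *)
Lemma RtoC_inv_total x : (/ RtoC x)%C = RtoC (/ x).
Proof.
  destruct (Req_dec x 0) as [->|H].
  - unfold Cinv, RtoC; simpl. rewrite Rinv_0. unfold Rdiv. f_equal; ring.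
  - symmetry. now apply RtoC_inv.
Qed.

Lemma ccont_mellin_integrand f s x : 0 < x -> ccont f x ->
  ccont (mellin_integrand f s) x.
Proof.
  intros Hx Hf. apply ccont_ext with (fun x => f x * Rcpow x s * RtoC (/ x))%C.
  - intros y. unfold mellin_integrand, Cdiv. now rewrite RtoC_inv_total.
  - apply ccont_mult.
    + apply ccont_mult; auto. eapply cderiv_ccont. now apply cderiv_Rcpow.
    + apply ccont_RtoC. apply continuous_of_derive.
      auto_derive. lra.
Qed.

(** Under [x = exp v] the Mellin transform on [Re s = sigma] becomes the Fourier transform of this
    function, with frequency [t = Im s]. *)
Definition log_profile (f : R -> C) (sigma v : R) : C := (f (exp v) * RtoC (exp (sigma * v)))%C.

Lemma mellin_integrand_exp f sigma t v :
  (RtoC (exp v) * mellin_integrand f (sigma, t) (exp v))%C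
  = (log_profile f sigma v * cis (t * v))%C.
Proof.
  unfold mellin_integrand, log_profile, Cdiv. rewrite RtoC_inv_total.
  unfold Rcpow, Rpower. rewrite ln_exp. unfold Re, Im, cis; cbn [fst snd].
  pose proof (exp_pos v). destruct (f (exp v)) as [a b].
  apply injective_projections; simpl; field; lra.
Qed.

Lemma Cmod_log_profile f sigma t v :
  exp v * Cmod (mellin_integrand f (sigma, t) (exp v)) = Cmod (log_profile f sigma v).
Proof.
  transitivity (Cmod (RtoC (exp v) * mellin_integrand f (sigma, t) (exp v))).
  - rewrite Cmod_mult, Cmod_R, (Rabs_right (exp v)); [reflexivity|].
    left; apply exp_pos.
  - rewrite mellin_integrand_exp, Cmod_mult, Cmod_cis. ring.
Qed.

Lemma RInt_exp_subst (h : R -> R) a b : (forall x, 0 < x -> continuous h x) ->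
  RInt (fun v => exp v * h (exp v)) a b = RInt h (exp a) (exp b).
Proof.
  intros Hh. apply (RInt_comp (V := R_CompleteNormedModule) h exp exp).
  - intros x _. apply Hh, exp_pos.
  - intros x _. split; [auto_derive; auto; ring|apply continuous_exp].
Qed.

Section Mellin.

Context (f : R -> C) (sigma : R) (f_cont : forall x, 0 < x -> ccont f x).

Lemma ccont_log_profile v : ccont (log_profile f sigma) v.
Proof.
  unfold log_profile. apply ccont_mult.
  - apply ccont_comp; [apply continuous_exp|apply f_cont, exp_pos].
  - apply ccont_RtoC. apply continuous_of_derive.
    auto_derive; auto.
Qed.

Lemma CI_log_profile t a b :
  CI (fun v => log_profile f sigma v * cis (t * v))%C a b
  = CI (mellin_integrand f (sigma, t)) (exp a) (exp b).
Proof.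
  unfold CI. f_equal.
  - rewrite <- (RInt_exp_subst (fun x => Re (mellin_integrand f (sigma, t) x))).
    + apply RInt_ext. intros v _. rewrite <- mellin_integrand_exp. simpl. unfold Re; ring.
    + intros x Hx. exact (proj1 (ccont_mellin_integrand f _ x Hx (f_cont x Hx))).
  - rewrite <- (RInt_exp_subst (fun x => Im (mellin_integrand f (sigma, t) x))).
    + apply RInt_ext. intros v _. rewrite <- mellin_integrand_exp. simpl. unfold Im; ring.
    + intros x Hx. exact (proj2 (ccont_mellin_integrand f _ x Hx (f_cont x Hx))).
Qed.

Lemma RInt_Cmod_log_profile t a b :
  RInt (fun v => Cmod (log_profile f sigma v)) a b
  = RInt (fun x => Cmod (mellin_integrand f (sigma, t) x)) (exp a) (exp b).
Proof.
  rewrite <- RInt_exp_subst.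
  - apply RInt_ext. intros v _. now rewrite (Cmod_log_profile f sigma t).
  - intros x Hx. apply ccont_Cmod, ccont_mellin_integrand; auto.
Qed.

Lemma log_window (P : R * R -> Prop) :
  filter_prod (at_right 0) (Rbar_locally p_infty) P ->
  exists a0 b0, forall a b, a <= a0 -> b0 <= b -> P (exp a, exp b).
Proof.
  intros [Q S [d Hd] [M HM] H].
  exists (ln (d / 2)), (ln (Rmax M 1 + 1)). intros a b Ha Hb. apply H.
  - pose proof (cond_pos d). apply Hd; [|apply exp_pos].
    assert (exp a <= d / 2) by (rewrite <- (exp_ln (d / 2)) by lra; now apply exp_le_mono).
    pose proof (exp_pos a). unfold ball; simpl; unfold AbsRing_ball, abs, minus, plus, opp; simpl.
    rewrite Ropp_0, Rplus_0_r, Rabs_right by lra. lra.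
  - apply HM. pose proof (Rmax_l M 1). pose proof (Rmax_r M 1).
    assert (Rmax M 1 + 1 <= exp b)
      by (rewrite <- (exp_ln (Rmax M 1 + 1)) by lra; now apply exp_le_mono). lra.
Qed.

Lemma mellin_window t v e : is_mellin f (sigma, t) v -> 0 < e ->
  exists a0 b0, forall a b, a <= a0 -> b0 <= b ->
    Cmod (v - CI (fun v => log_profile f sigma v * cis (t * v))%C a b) <= e.
Proof.
  intros [_ H] He.
  assert (H1 := proj1 (filterlimi_locally _ v) H (mkposreal (e / 2) ltac:(lra))).
  destruct (log_window _ H1) as [a0 [b0 H2]]. exists a0, b0. intros a b Ha Hb.
  destruct (H2 a b Ha Hb) as [z [Hz [B1 B2]]]. simpl in Hz.
  assert (Ez : CI (mellin_integrand f (sigma, t)) (exp a) (exp b) = z).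
  { unfold CI. rewrite (surjective_pairing z). f_equal.
    - apply is_RInt_unique.
      exact (is_RInt_fct_extend_fst (U := R_NormedModule) (V := R_NormedModule) _ _ _ _ Hz).
    - apply is_RInt_unique.
      exact (is_RInt_fct_extend_snd (U := R_NormedModule) (V := R_NormedModule) _ _ _ _ Hz). }
  rewrite CI_log_profile, Ez.
  unfold ball in B1, B2; simpl in B1, B2;
    unfold AbsRing_ball, abs, minus, plus, opp in B1, B2; simpl in B1, B2.
  replace (v - z)%C with (- (z - v))%C by ring. rewrite Cmod_opp.
  eapply Rle_trans; [apply (Cmod_le_sum (fst z + - fst v) (snd z + - snd v))|]. lra.
Qed.

Lemma mellin_abs_window t v : is_mellin f (sigma, t) v ->
  exists l, forall e, 0 < e -> exists a0 b0, forall a b, a <= a0 -> b0 <= b ->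
    Rabs (RInt (fun v => Cmod (log_profile f sigma v)) a b - l) < e.
Proof.
  intros [[l H] _]. exists l. intros e He.
  assert (H1 := proj1 (filterlimi_locally _ l) H (mkposreal e He)).
  destruct (log_window _ H1) as [a0 [b0 H2]]. exists a0, b0. intros a b Ha Hb.
  destruct (H2 a b Ha Hb) as [z [Hz B]]. simpl in Hz.
  rewrite (RInt_Cmod_log_profile t). rewrite (is_RInt_unique _ _ _ _ Hz). exact B.
Qed.

Lemma ex_RInt_Cmod_log_profile a b : ex_RInt (fun v => Cmod (log_profile f sigma v)) a b.
Proof.
  apply (ex_RInt_continuous (V := R_CompleteNormedModule)). intros z _.
  apply ccont_Cmod, ccont_log_profile.
Qed.

Lemma RInt_Cmod_log_profile_pos a b : a <= b ->
  0 <= RInt (fun v => Cmod (log_profile f sigma v)) a b.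
Proof.
  intros Hab. apply RInt_ge_0; auto; [apply ex_RInt_Cmod_log_profile|].
  intros; apply Cmod_ge_0.
Qed.

Lemma RInt_Cmod_log_profile_split a b c d :
  RInt (fun v => Cmod (log_profile f sigma v)) a d =
  RInt (fun v => Cmod (log_profile f sigma v)) a b
  + RInt (fun v => Cmod (log_profile f sigma v)) b c
  + RInt (fun v => Cmod (log_profile f sigma v)) c d.
Proof.
  set (g := fun v => Cmod (log_profile f sigma v)).
  rewrite <- (RInt_Chasles (V := R_CompleteNormedModule) g a c d),
    <- (RInt_Chasles (V := R_CompleteNormedModule) g a b c)
    by apply ex_RInt_Cmod_log_profile.
  reflexivity.
Qed.

Context (F : C -> C) (F_mellin : forall t, is_mellin f (sigma, t) (F (sigma, t))).

Lemma log_profile_integrable : exists A, forall a b, a <= b ->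
  RInt (fun v => Cmod (log_profile f sigma v)) a b <= A.
Proof.
  destruct (mellin_abs_window 0 _ (F_mellin 0)) as [l Hl].
  destruct (Hl 1 Rlt_0_1) as [a0 [b0 H0]]. exists (l + 1). intros a b Hab.
  specialize (H0 (Rmin a a0) (Rmax b b0) (Rmin_r _ _) (Rmax_r _ _)).
  rewrite (RInt_Cmod_log_profile_split _ a b _) in H0.
  pose proof (RInt_Cmod_log_profile_pos (Rmin a a0) a (Rmin_l _ _)).
  pose proof (RInt_Cmod_log_profile_pos b (Rmax b b0) (Rmax_l _ _)).
  apply Rabs_def2 in H0. lra.
Qed.

(** Uniformity in [t] comes from absolute convergence: the tails are dominated by the integral of
    the modulus, which does not depend on [t]. The larger window [[a', b']], on which the value of
    [F] is approximated, may depend on [t]. *)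
Lemma mellin_uniform_window e : 0 < e ->
  exists a0 b0, forall t a b, a <= a0 -> b0 <= b ->
    Cmod (F (sigma, t) - CI (fun v => log_profile f sigma v * cis (t * v))%C a b) <= e.
Proof.
  intros He. destruct (mellin_abs_window 0 _ (F_mellin 0)) as [l Hl].
  destruct (Hl (e / 4) ltac:(lra)) as [a0 [b0 H0]].
  exists (Rmin a0 b0), b0. intros t a b Ha Hb.
  assert (Ha' : a <= a0) by (eapply Rle_trans; [exact Ha|apply Rmin_l]).
  assert (Hab : a <= b) by (pose proof (Rmin_r a0 b0); lra).
  destruct (mellin_window t _ (e / 2) (F_mellin t) ltac:(lra)) as [a1 [b1 H1]].
  set (a' := Rmin a a1). set (b' := Rmax b b1).
  assert (Aa : a' <= a /\ a' <= a1) by (split; [apply Rmin_l|apply Rmin_r]).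
  assert (Bb : b <= b' /\ b1 <= b') by (split; [apply Rmax_l|apply Rmax_r]).
  specialize (H1 a' b' (proj2 Aa) (proj2 Bb)).
  assert (X1 := H0 a b Ha' Hb). assert (X2 := H0 a' b' ltac:(lra) ltac:(lra)).
  rewrite (RInt_Cmod_log_profile_split a' a b b') in X2.
  set (h := fun v => (log_profile f sigma v * cis (t * v))%C) in *.
  assert (Ch : forall v, ccont h v).
  { intros v. apply ccont_mult; [apply ccont_log_profile|]. apply ccont_cis.
    apply continuous_Rmult; [apply continuous_const|apply continuous_id]. }
  assert (Nh : forall v, Cmod (h v) <= Cmod (log_profile f sigma v)).
  { intros v. unfold h. rewrite Cmod_mult, Cmod_cis. lra. }
  assert (Y1 : Cmod (CI h a' a) <= RInt (fun v => Cmod (log_profile f sigma v)) a' a).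
  { apply CI_le; try lra; auto. intros; apply ccont_Cmod, ccont_log_profile. }
  assert (Y2 : Cmod (CI h b b') <= RInt (fun v => Cmod (log_profile f sigma v)) b b').
  { apply CI_le; try lra; auto. intros; apply ccont_Cmod, ccont_log_profile. }
  rewrite <- (CI_Chasles h a' a b'), <- (CI_Chasles h a b b') in H1 by (auto; lra).
  replace (F (sigma, t) - CI h a b)%C with
    ((F (sigma, t) - (CI h a' a + (CI h a b + CI h b b'))) + (CI h a' a + CI h b b'))%C by ring.
  eapply Rle_trans; [apply Cmod_triangle|].
  pose proof (Cmod_triangle (CI h a' a) (CI h b b')).
  apply Rabs_def2 in X1. apply Rabs_def2 in X2. lra.
Qed.

Theorem mellin_inversion K x e :
  (forall t, ccont (fun t => F (sigma, t)) t) ->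
  (forall t, Cmod (F (sigma, t)) * (1 + t ^ 2) ^ 2 <= K) -> 0 < x -> 0 < e ->
  exists M0, forall M, M0 <= M ->
    Cmod (CI (fun t => F (sigma, t) * Rcpow x (- (sigma, t)))%C (- M) M
          - RtoC (2 * PI) * f x) <= e.
Proof.
  intros HF HK Hx He. destruct log_profile_integrable as [A HA].
  set (c := exp (- (sigma * ln x))). assert (Pc : 0 < c) by apply exp_pos.
  destruct (fourier_inversion (log_profile f sigma) (fun t => F (sigma, t)) A K (ln x) (e / c)
    ccont_log_profile HA HF HK mellin_uniform_window ltac:(now apply Rdiv_lt_0_compat))
    as [M0 HM0].
  exists (Rmax 0 M0). intros M HM.
  assert (HM1 : 0 <= M) by (eapply Rle_trans; [apply Rmax_l|exact HM]).
  specialize (HM0 M ltac:(eapply Rle_trans; [apply Rmax_r|exact HM])).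
  assert (E1 : forall t, (F (sigma, t) * Rcpow x (- (sigma, t)))%C
     = (RtoC c * (F (sigma, t) * cis (- (t * ln x))))%C).
  { intros t. replace (Rcpow x (- (sigma, t))%C) with (RtoC c * cis (- (t * ln x)))%C; [ring|].
    unfold Rcpow, Rpower, cis, c. unfold Re, Im; simpl.
    replace (- sigma * ln x) with (- (sigma * ln x)) by ring.
    replace (- t * ln x) with (- (t * ln x)) by ring.
    apply injective_projections; simpl; ring. }
  rewrite (CI_ext (- M) M ltac:(lra) _ _ (fun t _ => E1 t)), CI_scal; [|lra|].
  2:{ intros t _. apply ccont_mult; auto. apply ccont_cis.
      apply (continuous_opp (V := R_NormedModule) (fun t => t * ln x)).
      apply continuous_Rmult; [apply continuous_id|apply continuous_const]. }
  replace (f x) with (RtoC c * log_profile f sigma (ln x))%C.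
  2:{ unfold log_profile, c. rewrite exp_ln, exp_Ropp by auto.
      rewrite RtoC_inv by (apply Rgt_not_eq, exp_pos). field.
      intros Q. apply RtoC_inj in Q. pose proof (exp_pos (sigma * ln x)); lra. }
  replace (RtoC c * CI (fun t => F (sigma, t) * cis (- (t * ln x)))%C (- M) M
     - RtoC (2 * PI) * (RtoC c * log_profile f sigma (ln x)))%C with
    (RtoC c * (CI (fun t => F (sigma, t) * cis (- (t * ln x)))%C (- M) M
       - RtoC (2 * PI) * log_profile f sigma (ln x)))%C by ring.
  rewrite Cmod_mult, Cmod_R, Rabs_right by lra.
  replace e with (c * (e / c)) by (field; lra). apply Rmult_le_compat_l; lra.
Qed.

End Mellin.

(** * Inverse Mellin integrals on vertical lines *)

Lemma ccont_vertical sigma t : ccont (fun t => (sigma, t) : C) t.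
Proof. apply ccont_pair; [apply continuous_const|apply continuous_id]. Qed.

Lemma ccont_opp g t : ccont g t -> ccont (fun t => - g t)%C t.
Proof.
  intros H. apply ccont_ext with (fun t => RtoC 0 - g t)%C; [intros; ring|].
  apply ccont_minus; auto. apply ccont_const.
Qed.

Lemma Im_le_Cmod_pair x t : Rabs t <= Cmod (x, t).
Proof. exact (im_le_Cmod (x, t)). Qed.

Lemma Rpower_abs_le x r B : Rabs r <= B -> Rpower x r <= exp (B * Rabs (ln x)).
Proof.
  intros H. unfold Rpower. apply exp_le_mono. eapply Rle_trans; [apply Rle_abs|].
  rewrite Rabs_mult. apply Rmult_le_compat_r; auto. apply Rabs_pos.
Qed.

(** The values along [1 / (n + 1)] form a Cauchy sequence. Letting the second argument run through
    it in the hypothesis gives the rate with the same constant [A]. *)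
Lemma limit_at_0 (h : R -> C) A :
  (forall x y, 0 < x -> 0 < y -> Cmod (h x - h y) <= A * (Rpower x (3 / 2) + Rpower y (3 / 2))) ->
  exists l, forall x, 0 < x -> Cmod (h x - l) <= A * Rpower x (3 / 2).
Proof.
  intros H. set (y := fun n : nat => / (INR n + 1)).
  assert (Py : forall n, 0 < y n)
    by (intros n; apply Rinv_0_lt_compat; pose proof (pos_INR n); lra).
  assert (A0 : 0 <= A).
  { specialize (H 1 1 Rlt_0_1 Rlt_0_1).
    replace (h 1 - h 1)%C with (RtoC 0) in H by ring. rewrite Cmod_0 in H.
    assert (P : 0 < Rpower 1 (3 / 2)) by apply exp_pos. nra. }
  assert (Sm : forall e, 0 < e -> exists N, forall n, (n >= N)%nat ->
     A * Rpower (y n) (3 / 2) <= e).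
  { intros e He.
    destruct (archimed_cor1 (e / (A + 1)) ltac:(apply Rdiv_lt_0_compat; lra)) as [N [HN HN0]].
    exists N. intros n Hn.
    assert (Y : Rpower (y n) (3 / 2) <= y n).
    { pose proof (pos_INR n). rewrite <- (Rpower_1 (y n)) at 2 by auto.
      unfold Rpower. apply exp_le_mono.
      assert (ln (y n) <= 0).
      { rewrite <- ln_1. apply ln_le; auto. unfold y. rewrite <- Rinv_1.
        apply Rinv_le_contravar; lra. } lra. }
    assert (Z : y n <= e / (A + 1)).
    { left. eapply Rle_lt_trans; [|exact HN]. unfold y. apply Rinv_le_contravar.
      - now apply lt_0_INR.
      - apply le_INR in Hn. lra. }
    apply Rle_trans with (A * (e / (A + 1))).
    - apply Rmult_le_compat_l; lra.
    - apply Rmult_le_reg_r with (A + 1); [lra|]. field_simplify; lra. }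
  assert (CC : forall g : C -> R, (forall z w, Rabs (g z - g w) <= Cmod (z - w)) ->
     Cauchy_crit (fun n => g (h (y n)))).
  { intros g Hg e He. destruct (Sm (e / 3) ltac:(lra)) as [N HN]. exists N. intros n m Hn Hm.
    unfold Rdist. eapply Rle_lt_trans; [apply Hg|].
    eapply Rle_lt_trans; [apply H; auto|].
    pose proof (HN n Hn). pose proof (HN m Hm). lra. }
  destruct (Rcomplete.R_complete _ (CC Re (fun z w => re_le_Cmod (z - w)))) as [l1 H1].
  destruct (Rcomplete.R_complete _ (CC Im (fun z w => im_le_Cmod (z - w)))) as [l2 H2].
  exists (l1, l2). intros x Hx. apply le_epsilon. intros e He.
  destruct (Sm (e / 3) ltac:(lra)) as [N0 HN0].
  destruct (H1 (e / 3) ltac:(lra)) as [N1 HN1].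
  destruct (H2 (e / 3) ltac:(lra)) as [N2 HN2].
  set (n := (N0 + N1 + N2)%nat).
  specialize (HN0 n ltac:(unfold n; lia)). specialize (HN1 n ltac:(unfold n; lia)).
  specialize (HN2 n ltac:(unfold n; lia)).
  specialize (H x (y n) Hx (Py n)).
  replace (h x - (l1, l2))%C with ((h x - h (y n)) + (h (y n) - (l1, l2)))%C by ring.
  eapply Rle_trans; [apply Cmod_triangle|].
  assert (Cmod (h (y n) - (l1, l2)) <= e / 3 + e / 3).
  { eapply Rle_trans;
      [apply (Cmod_le_sum (Re (h (y n)) + - l1) (Im (h (y n)) + - l2))|].
    unfold Rdist, Rminus in HN1, HN2. lra. }
  lra.
Qed.

Section Lines.

Context (F : C -> C)
  (F_diff : forall s, s <> RtoC 0 -> cdiff F s)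
  (F_decay : rapid_decay_strips F).

Lemma F_vertical_cont sigma t : sigma <> 0 -> ccont (fun t => F (sigma, t)) t.
Proof.
  intros H. apply cdiff_ccont_v, F_diff. intros E. apply H. now injection E.
Qed.

(** Continuity handles bounded [t]; for large [t] the decay with exponent 6 suffices, because
    [1 + t^2 <= 2 |s|^2]. Of the three powers, two pay for multipliers growing like [t^4] and one
    makes the integral converge. *)
Lemma F_vertical_bound sigma : sigma <> 0 ->
  exists K, 0 <= K /\ forall t, Cmod (F (sigma, t)) * (1 + t ^ 2) ^ 3 <= K.
Proof.
  intros Hs. destruct (F_decay (Rabs sigma) 6%nat) as [K [T HKT]].
  set (T' := Rmax T 1).
  set (g := fun t => Cmod (F (sigma, t)) * (1 + t ^ 2) ^ 3).
  assert (Cg : forall t, continuous g t).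
  { intros t. apply continuous_Rmult.
    - now apply ccont_Cmod, F_vertical_cont.
    - apply continuous_of_derive. auto_derive; auto. }
  destruct (bounded_continuity (K := R_AbsRing) (V := R_NormedModule) g (- T') T'
    (fun t _ => Cg t)) as [M HM].
  assert (Pg : forall t, 0 <= g t).
  { intros t. apply Rmult_le_pos; [apply Cmod_ge_0|]. apply pow_le. nra. }
  exists (Rmax 0 (Rmax M (8 * K))). split; [apply Rmax_l|]. intros t. fold (g t).
  eapply Rle_trans; [|apply Rmax_r].
  destruct (Rle_dec (Rabs t) T') as [Ht|Ht].
  - eapply Rle_trans; [|apply Rmax_l]. left.
    apply Rabs_le_between in Ht. specialize (HM t Ht).
    unfold norm in HM; simpl in HM; unfold abs in HM; simpl in HM.
    now rewrite Rabs_right in HM by (apply Rle_ge; auto).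
  - apply Rnot_le_lt in Ht.
    assert (T1 : 1 < Rabs t) by (pose proof (Rmax_r T 1); unfold T' in Ht; lra).
    assert (T2 : T < Rabs t) by (pose proof (Rmax_l T 1); unfold T' in Ht; lra).
    eapply Rle_trans; [|apply Rmax_r].
    pose proof (Im_le_Cmod_pair sigma t) as Hst.
    assert (B : Cmod (F (sigma, t)) * Cmod (sigma, t) ^ 6 <= K).
    { apply HKT; [|lra]. simpl. split.
      - pose proof (Rle_abs (- sigma)). rewrite Rabs_Ropp in H. lra.
      - apply Rle_abs. }
    unfold g. rewrite <- (pow2_abs t).
    apply Rle_trans with (8 * (Cmod (F (sigma, t)) * Cmod (sigma, t) ^ 6)); [|lra].
    rewrite (Rmult_comm 8), Rmult_assoc. apply Rmult_le_compat_l; [apply Cmod_ge_0|].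
    replace (Cmod (sigma, t) ^ 6 * 8) with ((2 * Cmod (sigma, t) ^ 2) ^ 3) by ring.
    apply pow_incr. split; nra.
Qed.

Definition line_integral (sigma x M : R) : C :=
  CI (fun t => F (sigma, t) * Rcpow x (- (sigma, t)))%C (- M) M.

Lemma ccont_line_integrand sigma x t : sigma <> 0 ->
  ccont (fun t => F (sigma, t) * Rcpow x (- (sigma, t)))%C t.
Proof.
  intros H. apply ccont_mult; [now apply F_vertical_cont|].
  apply ccont_Rcpow_exponent, ccont_opp, ccont_vertical.
Qed.

(** After the multiplier has used two of the three powers of [1 + t^2], there remains
    [1 / (1 + t^2)], of integral at most [PI]. *)
Lemma CI_F_mult_le sigma K (mu : R -> C) B a b : a <= b -> sigma <> 0 -> 0 <= B ->
  (forall t, Cmod (F (sigma, t)) * (1 + t ^ 2) ^ 3 <= K) ->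
  (forall t, ccont mu t) ->
  (forall t, a <= t <= b -> Cmod (mu t) <= B * (1 + t ^ 2) ^ 2) ->
  Cmod (CI (fun t => F (sigma, t) * mu t)%C a b) <= K * B * PI.
Proof.
  intros Hab Hs HB HK Hmu Hb.
  assert (K0 : 0 <= K).
  { eapply Rle_trans; [|apply (HK 0)]. apply Rmult_le_pos; [apply Cmod_ge_0|nra]. }
  apply Rle_trans with (K * B * RInt (fun t => / (1 + t ^ 2)) a b).
  - apply CI_le_scal; auto.
    + intros t _. apply ccont_mult; auto. now apply F_vertical_cont.
    + intros; apply continuous_inv_1_sq.
    + intros t Ht. rewrite Cmod_mult. assert (P : 0 < 1 + t ^ 2) by nra.
      apply Rle_trans with (Cmod (F (sigma, t)) * (B * (1 + t ^ 2) ^ 2)).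
      { apply Rmult_le_compat_l; [apply Cmod_ge_0|auto]. }
      apply Rmult_le_reg_r with (1 + t ^ 2); auto.
      rewrite (Rmult_assoc (K * B)), Rinv_l, Rmult_1_r by lra.
      specialize (HK t).
      replace (Cmod (F (sigma, t)) * (B * (1 + t ^ 2) ^ 2) * (1 + t ^ 2)) with
        (Cmod (F (sigma, t)) * (1 + t ^ 2) ^ 3 * B) by ring.
      now apply Rmult_le_compat_r.
  - apply Rmult_le_compat_l; [nra|]. now apply RInt_inv_1_sq_le.
Qed.

(** Mellin inversion as a limit of symmetric truncations. With [ds = i dt] the usual factor
    [1 / (2 PI i)] becomes the [2 PI] on the side of [h]. *)
Definition inverts (sigma : R) (h : R -> C) : Prop :=
  forall x, 0 < x -> forall e, 0 < e -> exists M0, forall M, M0 <= M ->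
    Cmod (line_integral sigma x M - RtoC (2 * PI) * h x) <= e.

Lemma Re_vertical_opp sigma t : Re (- (sigma, t))%C = - sigma.
Proof. reflexivity. Qed.

Lemma line_integral_tail sigma K x M M' : sigma <> 0 -> 0 <= M <= M' ->
  (forall t, Cmod (F (sigma, t)) * (1 + t ^ 2) ^ 3 <= K) ->
  Cmod (line_integral sigma x M' - line_integral sigma x M)
  <= 2 * K * PI * Rpower x (- sigma) / (1 + M ^ 2).
Proof.
  intros Hs HM HK. unfold line_integral.
  set (g := fun t => (F (sigma, t) * Rcpow x (- (sigma, t)))%C).
  assert (Cg : forall t, ccont g t) by (intros; now apply ccont_line_integrand).
  rewrite <- (CI_Chasles g (- M') (- M) M'), <- (CI_Chasles g (- M) M M') by (auto; lra).
  replace (CI g (- M') (- M) + (CI g (- M) M + CI g M M') - CI g (- M) M)%C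
    with (CI g (- M') (- M) + CI g M M')%C by ring.
  eapply Rle_trans; [apply Cmod_triangle|].
  assert (P : 0 < Rpower x (- sigma)) by apply exp_pos.
  assert (PM : 0 < 1 + M ^ 2) by nra.
  assert (B : forall a b, a <= b -> (forall t, a <= t <= b -> M ^ 2 <= t ^ 2) ->
    Cmod (CI g a b) <= K * (Rpower x (- sigma) / (1 + M ^ 2)) * PI).
  { intros a b Hab Ht. apply CI_F_mult_le; auto.
    - left. now apply Rdiv_lt_0_compat.
    - intros t. apply ccont_Rcpow_exponent, ccont_opp, ccont_vertical.
    - intros t Htt. rewrite Cmod_Rcpow, Re_vertical_opp. specialize (Ht t Htt).
      apply Rmult_le_reg_r with (1 + M ^ 2); auto.
      replace (Rpower x (- sigma) / (1 + M ^ 2) * (1 + t ^ 2) ^ 2 * (1 + M ^ 2))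
        with (Rpower x (- sigma) * (1 + t ^ 2) ^ 2) by (field; lra).
      apply Rmult_le_compat_l; [lra|]. nra. }
  assert (B1 := B (- M') (- M) ltac:(lra)). assert (B2 := B M M' ltac:(lra)).
  assert (B1' := B1 ltac:(intros t Ht; nra)). assert (B2' := B2 ltac:(intros t Ht; nra)).
  unfold Rdiv in *. lra.
Qed.

(** The tail beyond [M] is absolutely small with an explicit dependence on [x], so pointwise
    convergence acquires a rate. The quadrature rule needs this rate on a whole interval of
    arguments at once. *)
Lemma inverts_uniform sigma h : sigma <> 0 -> inverts sigma h ->
  exists K, 0 <= K /\ forall x M, 0 < x -> 0 <= M ->
    Cmod (line_integral sigma x M - RtoC (2 * PI) * h x)
    <= K * Rpower x (- sigma) / (1 + M ^ 2).
Proof.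
  intros Hs Hi. destruct (F_vertical_bound sigma Hs) as [K [K0 HK]].
  pose proof PI_RGT_0. exists (2 * K * PI). split; [nra|]. intros x M Hx HM.
  apply le_epsilon. intros e He. destruct (Hi x Hx e He) as [M0 HM0].
  set (M' := Rmax M M0).
  specialize (HM0 M' (Rmax_r _ _)).
  assert (T := line_integral_tail sigma K x M M' Hs (conj HM (Rmax_l _ _)) HK).
  replace (line_integral sigma x M - RtoC (2 * PI) * h x)%C with
    (- (line_integral sigma x M' - line_integral sigma x M)
      + (line_integral sigma x M' - RtoC (2 * PI) * h x))%C by ring.
  eapply Rle_trans; [apply Cmod_triangle|]. rewrite Cmod_opp. lra.
Qed.

(** The horizontal sides of a shifted contour have fixed length, so a single power of decay makes
    them vanish in the limit. *)
Lemma horizontal_decay B : exists K T, 0 <= K /\ 1 <= T /\ forall x M,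
  - B <= x <= B -> T <= M -> Cmod (F (x, M)) <= K / M /\ Cmod (F (x, - M)) <= K / M.
Proof.
  destruct (F_decay B 1%nat) as [K [T HKT]]. exists (Rmax 0 K), (Rmax 1 T).
  split; [apply Rmax_l|]. split; [apply Rmax_l|]. intros x M Hx HM.
  assert (M1 : 1 <= M) by (eapply Rle_trans; [apply Rmax_l|exact HM]).
  assert (MT : T <= M) by (eapply Rle_trans; [apply Rmax_r|exact HM]).
  assert (G : forall y, Rabs y = M -> Cmod (F (x, y)) <= Rmax 0 K / M).
  { intros y Hy. pose proof (Im_le_Cmod_pair x y) as Hi. rewrite Hy in Hi.
    specialize (HKT (x, y) Hx ltac:(lra)). rewrite pow_1 in HKT.
    pose proof (Cmod_ge_0 (F (x, y))). pose proof (Rmax_r 0 K).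
    apply Rmult_le_reg_r with M; [lra|].
    replace (Rmax 0 K / M * M) with (Rmax 0 K) by (field; lra). nra. }
  split; apply G; [rewrite Rabs_right; lra|rewrite Rabs_left; lra].
Qed.

Lemma limit_of_K_over_M K e : 0 <= K -> 0 < e -> exists M0, 1 <= M0 /\
  forall M, M0 <= M -> K / M <= e.
Proof.
  intros HK He. exists (Rmax 1 (K / e)). split; [apply Rmax_l|]. intros M HM.
  assert (M1 : 1 <= M) by (eapply Rle_trans; [apply Rmax_l|exact HM]).
  assert (M2 : K / e <= M) by (eapply Rle_trans; [apply Rmax_r|exact HM]).
  apply Rmult_le_reg_r with M; [lra|].
  replace (K / M * M) with (K / e * e) by (field; split; lra). nra.
Qed.

(** There is no pole between the two lines, and for fixed [x] the horizontal sides are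
    [O(1 / M)]. *)
Lemma shift_to_the_right sigma1 sigma2 h : 0 < sigma1 <= sigma2 ->
  inverts sigma1 h -> inverts sigma2 h.
Proof.
  intros Hs Hi x Hx e He.
  destruct (Hi x Hx (e / 2) ltac:(lra)) as [M0 HM0].
  destruct (horizontal_decay sigma2) as [K [T [K0 [T1 HKT]]]].
  set (E := exp (sigma2 * Rabs (ln x))). assert (PE : 0 < E) by apply exp_pos.
  set (Q := 2 * (K * E) * (sigma2 - sigma1)).
  assert (HQ : 0 <= Q) by (unfold Q; apply Rmult_le_pos; [nra|lra]).
  destruct (limit_of_K_over_M Q (e / 2) HQ ltac:(lra)) as [M1 [M11 HM1]].
  exists (Rmax (Rmax M0 M1) T). intros M HM.
  assert (HT : T <= M) by (eapply Rle_trans; [apply Rmax_r|exact HM]).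
  assert (H01 : Rmax M0 M1 <= M) by (eapply Rle_trans; [apply Rmax_l|exact HM]).
  specialize (HM0 M ltac:(eapply Rle_trans; [apply Rmax_l|exact H01])).
  specialize (HM1 M ltac:(eapply Rle_trans; [apply Rmax_r|exact H01])).
  assert (V := vertical_shift (fun s => F s * Rcpow x (- s))%C sigma1 sigma2 M (K / M * E)
    ltac:(lra) ltac:(lra)).
  assert (V' : Cmod (line_integral sigma2 x M - line_integral sigma1 x M)
     <= 2 * (K / M * E) * (sigma2 - sigma1)).
  { apply V.
    - intros u v Hu _. apply cdiff_mult; [apply F_diff|apply cdiff_Rcpow_opp].
      intros Q0. injection Q0. lra.
    - intros u Hu. destruct (HKT u M ltac:(lra) HT) as [G1 G2].
      assert (RP : Rpower x (- u) <= E).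
      { apply Rpower_abs_le. rewrite Rabs_Ropp, Rabs_right; lra. }
      assert (0 < Rpower x (- u)) by apply exp_pos.
      rewrite !Cmod_mult, !Cmod_Rcpow, !Re_vertical_opp.
      split; (apply Rmult_le_compat; [apply Cmod_ge_0|lra|assumption|assumption]). }
  replace (2 * (K / M * E) * (sigma2 - sigma1)) with (Q / M) in V' by (unfold Q; field; lra).
  replace (line_integral sigma2 x M - RtoC (2 * PI) * h x)%C with
    ((line_integral sigma2 x M - line_integral sigma1 x M)
      + (line_integral sigma1 x M - RtoC (2 * PI) * h x))%C by ring.
  eapply Rle_trans; [apply Cmod_triangle|]. lra.
Qed.

Context (F_pole : pole_order_le 1 F (RtoC 0)).

(** The zero of [x^(-s) - 1] at the origin cancels the pole of [F], which has order at most one; at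
    0 the extension takes the value [- G(0) ln x]. *)
Lemma removable_at_0 x : exists H : C -> C, (forall s, cdiff H s) /\
  forall s, s <> RtoC 0 -> H s = (F s * (Rcpow x (- s) - 1))%C.
Proof.
  destruct F_pole as [G [[d1 H1] [d2 H2]]].
  set (D := fun s => if Ceq_dec s (RtoC 0) then RtoC (- ln x)
                  else ((Rcpow x (- s) - 1) / s)%C).
  exists (fun s => if Ceq_dec s (RtoC 0) then (G s * D s)%C
                   else (F s * (Rcpow x (- s) - 1))%C).
  split.
  2:{ intros s Hs. destruct (Ceq_dec s (RtoC 0)); [contradiction|reflexivity]. }
  assert (Sub : forall s : C, cdiff (fun s => Rcpow x (- s) - 1)%C s)
    by (intros s; apply cdiff_minus; [apply cdiff_Rcpow_opp|apply cdiff_const]).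
  intros s. destruct (Ceq_dec s (RtoC 0)) as [->|Hs].
  - apply cdiff_ext_loc with (fun s => G s * D s)%C d2; [apply cond_pos| |].
    + intros w Hw. destruct (Ceq_dec w (RtoC 0)) as [->|Nw]; [reflexivity|].
      unfold D. destruct (Ceq_dec w (RtoC 0)); [contradiction|].
      rewrite H2; auto.
      * simpl. field. replace (w - 0)%C with w by ring. auto.
      * apply C_NormedModule_mixin_compat1. exact Hw.
    + apply cdiff_mult; [|apply cdiff_Rcpow_quotient].
      apply holomorphic_cdiff, H1. apply ball_center.
  - apply cdiff_ext_loc with (fun s => F s * (Rcpow x (- s) - 1))%C (Cmod s).
    + now apply Cmod_gt_0.
    + intros w Hw. destruct (Ceq_dec w (RtoC 0)) as [->|Nw]; [|reflexivity].
      replace (0 - s)%C with (- s)%C in Hw by ring. rewrite Cmod_opp in Hw. lra.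
    + apply cdiff_mult; auto.
Qed.

Lemma line_integral_1 sigma t : Rcpow 1 (- (sigma, t))%C = RtoC 1.
Proof. rewrite Rcpow_cexp, ln_1, Cmult_0_r. apply cexp_0. Qed.

(** The residue at 0 is the same for the arguments [x] and 1, so it disappears from the difference
    and Cauchy's theorem applies to an entire integrand. *)
Lemma shift_across_0 sigma1 sigma2 h x e : sigma1 < 0 < sigma2 -> inverts sigma2 h ->
  0 < x -> 0 < e -> exists M0, forall M, M0 <= M ->
    Cmod (line_integral sigma1 x M - line_integral sigma1 1 M
          - RtoC (2 * PI) * (h x - h 1)) <= e.
Proof.
  intros Hs Hi Hx He.
  destruct (Hi x Hx (e / 4) ltac:(lra)) as [M0 HM0].
  destruct (Hi 1 Rlt_0_1 (e / 4) ltac:(lra)) as [M2 HM2].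
  set (B := Rmax (- sigma1) sigma2).
  assert (HB : - sigma1 <= B /\ sigma2 <= B) by (split; [apply Rmax_l|apply Rmax_r]).
  destruct (horizontal_decay B) as [K [T [K0 [T1 HKT]]]].
  (* The [+ 1] accounts for the subtracted 1 in [x^(-s) - 1]. *)
  set (E := exp (B * Rabs (ln x)) + 1).
  assert (PE : 0 < E) by (unfold E; pose proof (exp_pos (B * Rabs (ln x))); lra).
  set (Q := 2 * (K * E) * (sigma2 - sigma1)).
  assert (HQ : 0 <= Q) by (unfold Q; apply Rmult_le_pos; [nra|lra]).
  destruct (limit_of_K_over_M Q (e / 4) HQ ltac:(lra)) as [M1 [M11 HM1]].
  exists (Rmax (Rmax M0 M1) (Rmax M2 T)). intros M HM.
  assert (H2T : Rmax M2 T <= M) by (eapply Rle_trans; [apply Rmax_r|exact HM]).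
  assert (H01 : Rmax M0 M1 <= M) by (eapply Rle_trans; [apply Rmax_l|exact HM]).
  assert (HT : T <= M) by (eapply Rle_trans; [apply Rmax_r|exact H2T]).
  specialize (HM0 M ltac:(eapply Rle_trans; [apply Rmax_l|exact H01])).
  specialize (HM1 M ltac:(eapply Rle_trans; [apply Rmax_r|exact H01])).
  specialize (HM2 M ltac:(eapply Rle_trans; [apply Rmax_l|exact H2T])).
  destruct (removable_at_0 x) as [H [HD HE]].
  assert (V := vertical_shift H sigma1 sigma2 M (K / M * E) ltac:(lra) ltac:(lra)
    (fun u v _ _ => HD (u, v))).
  assert (NZ : forall u v : R, u <> 0 \/ v <> 0 -> (u, v) <> RtoC 0).
  { intros u v Huv Q0. injection Q0. intros -> ->. destruct Huv; lra. }
  assert (LI : forall sigma, sigma <> 0 ->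
    CI (fun y => H (sigma, y)) (- M) M = (line_integral sigma x M - line_integral sigma 1 M)%C).
  { intros sigma Hsg. unfold line_integral. rewrite <- CI_minus; try lra.
    - apply CI_ext; [lra|]. intros t _. rewrite HE by (apply NZ; auto).
      rewrite line_integral_1. ring.
    - intros; now apply ccont_line_integrand.
    - intros; now apply ccont_line_integrand. }
  rewrite !LI in V by lra.
  assert (V' := V ltac:(intros u Hu;
      destruct (HKT u M ltac:(lra) HT) as [G1 G2];
      rewrite !HE by (apply NZ; lra); rewrite !Cmod_mult;
      assert (RP : Rpower x (- u) <= E - 1) by
        (unfold E; replace (exp (B * Rabs (ln x)) + 1 - 1) with (exp (B * Rabs (ln x))) by ring;
         apply Rpower_abs_le; rewrite Rabs_Ropp; apply Rabs_le; lra);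
      assert (RP2 : forall v, Cmod (Rcpow x (- (u, v)) - 1) <= E) by
        (intros v; unfold Cminus at 1; eapply Rle_trans; [apply Cmod_triangle|];
         rewrite Cmod_opp, Cmod_1, Cmod_Rcpow, Re_vertical_opp; lra);
      split; (apply Rmult_le_compat; [apply Cmod_ge_0|apply Cmod_ge_0|assumption|apply RP2]))).
  replace (2 * (K / M * E) * (sigma2 - sigma1)) with (Q / M) in V' by (unfold Q; field; lra).
  set (a1 := line_integral sigma1 x M) in *. set (a2 := line_integral sigma1 1 M) in *.
  set (b1 := line_integral sigma2 x M) in *. set (b2 := line_integral sigma2 1 M) in *.
  replace (a1 - a2 - RtoC (2 * PI) * (h x - h 1))%C with
    (- ((b1 - b2) - (a1 - a2)) + ((b1 - RtoC (2 * PI) * h x) + - (b2 - RtoC (2 * PI) * h 1)))%C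
    by ring.
  eapply Rle_trans; [apply Cmod_triangle|].
  eapply Rle_trans; [apply Rplus_le_compat_l, Cmod_triangle|]. rewrite !Cmod_opp. lra.
Qed.

Lemma line_integral_le sigma : sigma <> 0 -> exists K, 0 <= K /\ forall x M, 0 <= M ->
  Cmod (line_integral sigma x M) <= K * Rpower x (- sigma).
Proof.
  intros Hs. destruct (F_vertical_bound sigma Hs) as [K [K0 HK]].
  pose proof PI_RGT_0. exists (K * PI). split; [nra|]. intros x M HM.
  replace (K * PI * Rpower x (- sigma)) with (K * Rpower x (- sigma) * PI) by ring.
  assert (P : 0 < Rpower x (- sigma)) by apply exp_pos.
  apply CI_F_mult_le; auto; try lra.
  - intros t. apply ccont_Rcpow_exponent, ccont_opp, ccont_vertical.
  - intros t _. rewrite Cmod_Rcpow, Re_vertical_opp.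
    assert (1 <= (1 + t ^ 2) ^ 2) by (apply pow_R1_Rle; nra). nra.
Qed.

(** Differences of [h] are differences of integrals on the left line, each [O(x^(3/2))]. Thus [h]
    has a limit [c0] at 0, and comparison with a small argument [y] identifies [h - c0] itself with
    the left integral. *)
Lemma inverts_left sigma2 h : 0 < sigma2 -> inverts sigma2 h ->
  exists c0, inverts (- (3 / 2)) (fun x => h x - c0)%C.
Proof.
  intros Hs Hi. set (s1 := - (3 / 2)).
  destruct (line_integral_le s1 ltac:(unfold s1; lra)) as [K [K0 HK]].
  replace (- s1) with (3 / 2) in HK by (unfold s1; lra).
  pose proof PI_RGT_0 as PP.
  assert (Diff : forall x y e, 0 < x -> 0 < y -> 0 < e -> exists M0, forall M, M0 <= M ->
    Cmod ((line_integral s1 x M - line_integral s1 y M)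
          - RtoC (2 * PI) * (h x - h y)) <= e).
  { intros x y e Hx Hy He.
    destruct (shift_across_0 s1 sigma2 h x (e / 2) ltac:(unfold s1; lra) Hi Hx ltac:(lra))
      as [M1 H1].
    destruct (shift_across_0 s1 sigma2 h y (e / 2) ltac:(unfold s1; lra) Hi Hy ltac:(lra))
      as [M2 H2].
    exists (Rmax M1 M2). intros M HM.
    specialize (H1 M ltac:(eapply Rle_trans; [apply Rmax_l|exact HM])).
    specialize (H2 M ltac:(eapply Rle_trans; [apply Rmax_r|exact HM])).
    set (a := line_integral s1 x M) in *. set (b := line_integral s1 y M) in *.
    set (o := line_integral s1 1 M) in *.
    replace (a - b - RtoC (2 * PI) * (h x - h y))%C with
      ((a - o - RtoC (2 * PI) * (h x - h 1)) + - (b - o - RtoC (2 * PI) * (h y - h 1)))%C by ring.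
    eapply Rle_trans; [apply Cmod_triangle|]. rewrite Cmod_opp. lra. }
  assert (Osc : forall x y, 0 < x -> 0 < y ->
    Cmod (h x - h y) <= K * (Rpower x (3 / 2) + Rpower y (3 / 2))).
  { intros x y Hx Hy. apply le_epsilon. intros e He.
    destruct (Diff x y e Hx Hy He) as [M0 HM0]. set (M := Rmax 0 M0).
    specialize (HM0 M (Rmax_r _ _)).
    pose proof (HK x M (Rmax_l _ _)) as B1. pose proof (HK y M (Rmax_l _ _)) as B2.
    set (a := line_integral s1 x M) in *. set (b := line_integral s1 y M) in *.
    assert (T : 2 * PI * Cmod (h x - h y) <= e + (Cmod a + Cmod b)).
    { replace (2 * PI * Cmod (h x - h y)) with (Cmod (RtoC (2 * PI) * (h x - h y)))
        by (rewrite Cmod_mult, Cmod_R, Rabs_right by lra; ring).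
      replace (RtoC (2 * PI) * (h x - h y))%C with
        (- (a - b - RtoC (2 * PI) * (h x - h y)) + (a + - b))%C by ring.
      eapply Rle_trans; [apply Cmod_triangle|]. rewrite Cmod_opp.
      pose proof (Cmod_triangle a (- b)) as T. rewrite Cmod_opp in T. lra. }
    pose proof PI2_1. pose proof (Cmod_ge_0 (h x - h y)). nra. }
  destruct (limit_at_0 h K Osc) as [c0 Hc0]. exists c0.
  intros x Hx e He.
  (* Both the left integral at [y] and [2 PI (h y - c0)] are bounded by multiples of [y^(3/2) <= y];
     this [y] makes their total at most [e / 2]. *)
  set (y := Rmin 1 (e / (2 * (K + 2 * PI * K + 1)))).
  assert (KP : 0 <= 2 * PI * K) by nra.
  assert (Hy : 0 < y) by (apply Rmin_pos; [lra|apply Rdiv_lt_0_compat; lra]).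
  assert (Ey : (K + 2 * PI * K) * Rpower y (3 / 2) <= e / 2).
  { assert (Y1 : Rpower y (3 / 2) <= y).
    { rewrite <- (Rpower_1 y) at 2 by auto. unfold Rpower. apply exp_le_mono.
      assert (ln y <= 0) by (rewrite <- ln_1; apply ln_le; auto; apply Rmin_l). lra. }
    assert (Y2 : y <= e / (2 * (K + 2 * PI * K + 1))) by apply Rmin_r.
    apply Rle_trans with ((K + 2 * PI * K + 1) * (e / (2 * (K + 2 * PI * K + 1)))).
    - apply Rmult_le_compat; try lra. left; apply exp_pos.
    - right. field. lra. }
  destruct (Diff x y (e / 2) Hx Hy ltac:(lra)) as [M0 HM0].
  exists (Rmax 0 M0). intros M HM.
  assert (HM1 : 0 <= M) by (eapply Rle_trans; [apply Rmax_l|exact HM]).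
  specialize (HM0 M ltac:(eapply Rle_trans; [apply Rmax_r|exact HM])).
  specialize (HK y M HM1). specialize (Hc0 y Hy).
  set (a := line_integral s1 x M) in *. set (b := line_integral s1 y M) in *.
  replace (a - RtoC (2 * PI) * (h x - c0))%C with
    ((a - b - RtoC (2 * PI) * (h x - h y)) + (b + - (RtoC (2 * PI) * (h y - c0))))%C by ring.
  eapply Rle_trans; [apply Cmod_triangle|].
  eapply Rle_trans; [apply Rplus_le_compat_l, Cmod_triangle|].
  rewrite Cmod_opp, Cmod_mult, Cmod_R, Rabs_right by lra. nra.
Qed.

End Lines.

(** * Size and increments of functions given by inverse Mellin integrals *)

Lemma mean_value_real (h h' : R -> R) a b K : a <= b ->
  (forall t, a <= t <= b -> is_derive h t (h' t) /\ Rabs (h' t) <= K) ->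
  Rabs (h b - h a) <= K * (b - a).
Proof.
  intros Hab H.
  destruct (MVT_gen h a b h') as [c [Hc Ec]].
  - rewrite Rmin_left, Rmax_right by lra. intros x Hx. apply H; lra.
  - rewrite Rmin_left, Rmax_right by lra. intros x Hx.
    apply continuity_pt_filterlim.
    apply continuous_of_derive.
    eexists; apply H; lra.
  - rewrite Rmin_left, Rmax_right in Hc by lra.
    rewrite Ec, Rabs_mult, (Rabs_right (b - a)) by lra.
    apply Rmult_le_compat_r; [lra|]. apply H; lra.
Qed.

Lemma mean_value (h h' : R -> C) a b K : a <= b ->
  (forall t, a <= t <= b -> cderiv h t (h' t) /\ Cmod (h' t) <= K) ->
  Cmod (h b - h a) <= 2 * K * (b - a).
Proof.
  intros Hab H.
  eapply Rle_trans;
    [apply (Cmod_le_sum (Re (h b) + - Re (h a)) (Im (h b) + - Im (h a)))|].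
  assert (B1 : Rabs (Re (h b) - Re (h a)) <= K * (b - a)).
  { apply (mean_value_real (fun t => Re (h t)) (fun t => Re (h' t))); auto. intros t Ht.
    destruct (H t Ht) as [[D _] B]. split; [exact D|].
    eapply Rle_trans; [apply re_le_Cmod|exact B]. }
  assert (B2 : Rabs (Im (h b) - Im (h a)) <= K * (b - a)).
  { apply (mean_value_real (fun t => Im (h t)) (fun t => Im (h' t))); auto. intros t Ht.
    destruct (H t Ht) as [[_ D] B]. split; [exact D|].
    eapply Rle_trans; [apply im_le_Cmod|exact B]. }
  unfold Rminus in B1, B2. lra.
Qed.

Section InvertedBounds.

Context (F : C -> C)
  (F_diff : forall s, s <> RtoC 0 -> cdiff F s)
  (F_decay : rapid_decay_strips F).

Lemma inverts_le sigma h : sigma <> 0 -> inverts F sigma h ->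
  exists K, 0 <= K /\ forall x, 0 < x -> Cmod (h x) <= K * Rpower x (- sigma).
Proof.
  intros Hs Hi. destruct (line_integral_le F F_diff F_decay sigma Hs) as [K [K0 HK]].
  exists K. split; auto. intros x Hx. apply le_epsilon. intros e He.
  destruct (Hi x Hx e He) as [M0 HM0]. set (M := Rmax 0 M0).
  specialize (HM0 M (Rmax_r _ _)). specialize (HK x M (Rmax_l _ _)).
  assert (T : 2 * PI * Cmod (h x) <= e + Cmod (line_integral F sigma x M)).
  { pose proof PI_RGT_0.
    replace (2 * PI * Cmod (h x)) with (Cmod (RtoC (2 * PI) * h x))
      by (rewrite Cmod_mult, Cmod_R, Rabs_right by lra; ring).
    replace (RtoC (2 * PI) * h x)%C with
      (- (line_integral F sigma x M - RtoC (2 * PI) * h x) + line_integral F sigma x M)%C by ring.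
    eapply Rle_trans; [apply Cmod_triangle|]. rewrite Cmod_opp. lra. }
  pose proof PI2_1. pose proof (Cmod_ge_0 (h x)). nra.
Qed.

(** The mean value theorem is applied to [u^(-s)] at each point of the line, and the factor [|s|] it
    produces is absorbed by the decay of [F]. [L] is left free because [u^(-sigma - 1)] is largest
    at the left end for the right line and at the right end for the left line. *)
Lemma inverts_lipschitz sigma h : sigma <> 0 -> inverts F sigma h ->
  exists K, 0 <= K /\ forall x y L, 0 < x <= y ->
    (forall u, x <= u <= y -> Rpower u (- sigma - 1) <= L) ->
    Cmod (h y - h x) <= K * L * (y - x).
Proof.
  intros Hs Hi. destruct (F_vertical_bound F F_diff F_decay sigma Hs) as [K [K0 HK]].
  pose proof PI_RGT_0 as PP. pose proof PI2_1 as P21.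
  set (q := Rabs sigma + 1). assert (Hq : 1 <= q) by (unfold q; pose proof (Rabs_pos sigma); lra).
  exists (K * (2 * q) * PI). split; [apply Rmult_le_pos; [|lra]; nra|].
  intros x y L Hxy HL.
  assert (L0 : 0 <= L).
  { eapply Rle_trans; [|apply (HL x); lra]. left; apply exp_pos. }
  apply le_epsilon. intros e He.
  destruct (Hi x ltac:(lra) (e / 2) ltac:(lra)) as [M1 HM1].
  destruct (Hi y ltac:(lra) (e / 2) ltac:(lra)) as [M2 HM2].
  set (M := Rmax 0 (Rmax M1 M2)).
  assert (M0 : 0 <= M) by apply Rmax_l.
  assert (M12 : Rmax M1 M2 <= M) by apply Rmax_r.
  specialize (HM1 M ltac:(eapply Rle_trans; [apply Rmax_l|exact M12])).
  specialize (HM2 M ltac:(eapply Rle_trans; [apply Rmax_r|exact M12])).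
  assert (D : Cmod (line_integral F sigma y M - line_integral F sigma x M)
     <= K * (2 * q * L * (y - x)) * PI).
  { unfold line_integral. rewrite <- CI_minus; try lra;
      try (intros; now apply ccont_line_integrand).
    rewrite (CI_ext (- M) M ltac:(lra) _
      (fun t => F (sigma, t) * (Rcpow y (- (sigma, t)) - Rcpow x (- (sigma, t))))%C)
      by (intros; ring).
    apply CI_F_mult_le; auto; try lra.
    - repeat apply Rmult_le_pos; lra.
    - intros t. apply ccont_minus; apply ccont_Rcpow_exponent, ccont_opp, ccont_vertical.
    - intros t _.
      apply Rle_trans with (2 * (q * (1 + t ^ 2) ^ 2 * L) * (y - x)); [|right; ring].
      apply (mean_value (fun u => Rcpow u (- (sigma, t)))
        (fun u => - (sigma, t) * Rcpow u (- (sigma, t) - 1))%C); [lra|].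
      intros u Hu. split; [apply cderiv_Rcpow; lra|].
      rewrite Cmod_mult, Cmod_opp, Cmod_Rcpow.
      replace (Re (- (sigma, t) - 1)%C) with (- sigma - 1) by (simpl; ring).
      apply Rmult_le_compat; [apply Cmod_ge_0|left; apply exp_pos| |auto].
      eapply Rle_trans; [apply Cmod_le_sum|].
      assert (Rabs t <= (1 + t ^ 2) ^ 2) by (rewrite <- (pow2_abs t); pose proof (Rabs_pos t); nra).
      assert (1 <= (1 + t ^ 2) ^ 2) by (apply pow_R1_Rle; nra).
      unfold q. pose proof (Rabs_pos sigma). nra. }
  set (a := line_integral F sigma y M) in *. set (b := line_integral F sigma x M) in *.
  assert (T : 2 * PI * Cmod (h y - h x) <= e + K * (2 * q * L * (y - x)) * PI).
  { replace (2 * PI * Cmod (h y - h x)) with (Cmod (RtoC (2 * PI) * (h y - h x)))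
      by (rewrite Cmod_mult, Cmod_R, Rabs_right by lra; ring).
    replace (RtoC (2 * PI) * (h y - h x))%C with
      ((a - b) + ((b - RtoC (2 * PI) * h x) + - (a - RtoC (2 * PI) * h y)))%C by ring.
    eapply Rle_trans; [apply Cmod_triangle|].
    eapply Rle_trans; [apply Rplus_le_compat_l, Cmod_triangle|]. rewrite Cmod_opp. lra. }
  pose proof (Cmod_ge_0 (h y - h x)). nra.
Qed.

Lemma Rpower_le_pow x r n : 1 <= x -> INR n <= - r -> Rpower x r * x ^ n <= 1.
Proof.
  intros Hx Hr. rewrite <- Rpower_pow, <- Rpower_plus by lra.
  replace 1 with (Rpower x 0) by (apply Rpower_O; lra). apply Rle_Rpower; lra.
Qed.

Lemma Rpower_neg_mono x u r : 0 < x <= u -> r <= 0 -> Rpower u r <= Rpower x r.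
Proof.
  intros Hx Hr. unfold Rpower. apply exp_le_mono.
  assert (ln x <= ln u) by (apply ln_le; lra). nra.
Qed.

Context (h : R -> C) (c0 : C) (sigma : R) (Hsigma : 4 <= sigma)
  (inv_right : inverts F sigma h)
  (inv_left : inverts F (- (3 / 2)) (fun x => h x - c0)%C).

Lemma near_0_bound : exists A, 0 <= A /\ forall x, 0 < x ->
  Cmod (h x - c0) <= A * Rpower x (3 / 2).
Proof.
  destruct (inverts_le (- (3 / 2)) _ ltac:(lra) inv_left) as [K [K0 HK]].
  exists K; split; auto. intros x Hx. specialize (HK x Hx).
  now replace (- - (3 / 2)) with (3 / 2) in HK by lra.
Qed.

Lemma decay_bound : exists A, 0 <= A /\ forall x, 0 < x -> Cmod (h x) * (1 + x) ^ 3 <= A.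
Proof.
  destruct (inverts_le sigma _ ltac:(lra) inv_right) as [K [K0 HK]].
  destruct near_0_bound as [K' [K0' HK']].
  exists (8 * (Cmod c0 + K') + 8 * K).
  pose proof (Cmod_ge_0 c0) as Pc. split; [lra|]. intros x Hx.
  pose proof (Cmod_ge_0 (h x)) as Ph.
  destruct (Rle_dec x 1) as [H1|H1].
  - assert (B : Cmod (h x) <= Cmod c0 + K').
    { replace (h x) with (c0 + (h x - c0))%C by ring.
      eapply Rle_trans; [apply Cmod_triangle|]. apply Rplus_le_compat_l.
      eapply Rle_trans; [apply HK'; auto|].
      assert (Rpower x (3 / 2) <= 1).
      { unfold Rpower. rewrite <- exp_0. apply exp_le_mono.
        assert (ln x <= 0) by (rewrite <- ln_1; apply ln_le; auto). lra. }
      nra. }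
    assert (Q : (1 + x) ^ 3 <= 8) by (replace 8 with (2 ^ 3) by ring; apply pow_incr; lra).
    assert (0 <= (1 + x) ^ 3) by (apply pow_le; lra). nra.
  - apply Rnot_le_lt in H1. specialize (HK x Hx).
    assert (RP := Rpower_le_pow x (- sigma) 3 ltac:(lra) ltac:(simpl; lra)).
    assert (Q : (1 + x) ^ 3 <= 8 * x ^ 3)
      by (replace (8 * x ^ 3) with ((2 * x) ^ 3) by ring; apply pow_incr; lra).
    assert (0 <= (1 + x) ^ 3) by (apply pow_le; lra).
    assert (0 <= x ^ 3) by (apply pow_le; lra).
    apply Rle_trans with ((K * Rpower x (- sigma)) * (8 * x ^ 3)).
    + apply Rmult_le_compat; auto.
    + nra.
Qed.

(** For [1 <= x] the right line gives a Lipschitz constant [O(x^(-4))]. For [x < 1] and [d <= x] the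
    left line gives a bounded one, since [u <= 2]. For [x < d] boundedness of [h] is enough, because
    the weight contains the factor [x]. *)
Lemma increment_bound : exists A, 0 <= A /\ forall x d, 0 < x -> 0 <= d ->
  Cmod (h (x + d) - h x) * (x * (1 + x) ^ 3) <= A * d.
Proof.
  destruct (inverts_lipschitz sigma _ ltac:(lra) inv_right) as [K [K0 HK]].
  destruct (inverts_lipschitz (- (3 / 2)) _ ltac:(lra) inv_left) as [K' [K0' HK']].
  destruct decay_bound as [A [A0 HA]].
  exists (8 * K + 16 * K' + 16 * A). split; [lra|]. intros x d Hx Hd.
  set (D := Cmod (h (x + d)%R - h x)). assert (PD : 0 <= D) by apply Cmod_ge_0.
  destruct (Rle_dec 1 x) as [H1|H1].
  - specialize (HK x (x + d) (Rpower x (- sigma - 1)) ltac:(lra)).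
    assert (B : D <= K * Rpower x (- sigma - 1) * d).
    { unfold D. replace d with (x + d - x) at 2 by ring. apply HK.
      intros u Hu. apply Rpower_neg_mono; lra. }
    assert (RP := Rpower_le_pow x (- sigma - 1) 4 ltac:(lra) ltac:(simpl; lra)).
    assert (Q : x * (1 + x) ^ 3 <= 8 * x ^ 4).
    { replace (8 * x ^ 4) with (x * (2 * x) ^ 3) by ring. apply Rmult_le_compat_l; [lra|].
      apply pow_incr; lra. }
    assert (0 <= x * (1 + x) ^ 3) by (apply Rmult_le_pos; [lra|apply pow_le; lra]).
    assert (0 <= x ^ 4) by (apply pow_le; lra).
    apply Rle_trans with ((K * Rpower x (- sigma - 1) * d) * (8 * x ^ 4)).
    + apply Rmult_le_compat; auto.
    + apply Rle_trans with (8 * K * d * 1).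
      * replace (K * Rpower x (- sigma - 1) * d * (8 * x ^ 4)) with
          (8 * K * d * (Rpower x (- sigma - 1) * x ^ 4)) by ring.
        apply Rmult_le_compat_l; auto. repeat apply Rmult_le_pos; lra.
      * nra.
  - apply Rnot_le_lt in H1.
    assert (Q3 : (1 + x) ^ 3 <= 8) by (replace 8 with (2 ^ 3) by ring; apply pow_incr; lra).
    assert (Q3' : 0 <= (1 + x) ^ 3) by (apply pow_le; lra).
    destruct (Rle_dec d x) as [H2|H2].
    + assert (B : D <= K' * 2 * d).
      { specialize (HK' x (x + d) 2 ltac:(lra)). replace (x + d - x) with d in HK' by ring.
        unfold D. replace (h (x + d)%R - h x)%C with (h (x + d)%R - c0 - (h x - c0))%C by ring.
        apply HK'. intros u Hu. replace (- - (3 / 2) - 1) with (/ 2) by lra.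
        rewrite Rpower_sqrt by lra. apply Rle_trans with (sqrt (2 * 2)).
        - apply sqrt_le_1_alt; lra.
        - rewrite sqrt_square; lra. }
      assert (Q : x * (1 + x) ^ 3 <= 8) by nra.
      assert (0 <= x * (1 + x) ^ 3) by (apply Rmult_le_pos; lra).
      apply Rle_trans with ((K' * 2 * d) * 8); [apply Rmult_le_compat; auto|]. nra.
    + apply Rnot_le_lt in H2.
      assert (B : D <= 2 * A).
      { unfold D. eapply Rle_trans; [apply Cmod_triangle|]. rewrite Cmod_opp.
        assert (G : forall y, 0 < y -> Cmod (h y) <= A).
        { intros y Hy. specialize (HA y Hy). pose proof (Cmod_ge_0 (h y)).
          assert (1 <= (1 + y) ^ 3) by (apply pow_R1_Rle; lra). nra. }
        pose proof (G x Hx). pose proof (G (x + d) ltac:(lra)). lra. }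
      apply Rle_trans with ((2 * A) * (d * 8)); [|nra].
      apply Rmult_le_compat; auto; [apply Rmult_le_pos; lra|].
      apply Rmult_le_compat; lra.
Qed.

End InvertedBounds.

(** * A quadrature rule exact on cubics *)

Fixpoint csum (u : nat -> C) (n : nat) : C :=
  match n with O => RtoC 0 | S n => (csum u n + u n)%C end.

Lemma csum_ext u v n : (forall k, (k < n)%nat -> u k = v k) -> csum u n = csum v n.
Proof.
  induction n as [|n IH]; simpl; intros H; auto. rewrite IH by (intros; apply H; lia).
  now rewrite H by lia.
Qed.

Lemma csum_minus u v n : csum (fun k => u k - v k)%C n = (csum u n - csum v n)%C.
Proof. induction n as [|n IH]; simpl; [ring|rewrite IH; ring]. Qed.

Lemma csum_shift u n : csum u (S n) = (u O + csum (fun k => u (S k)) n)%C.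
Proof. induction n as [|n IH]; [simpl; ring|]. simpl in *. rewrite IH. ring. Qed.

(** Telescoping: the partial sums of [1 / (k + 1)^2] stay below [2 - 2 / (n + 1)]. *)
Lemma csum_inverse_squares_le u n A : 0 <= A ->
  (forall k, Cmod (u k) <= A / (INR k + 1) ^ 2) -> Cmod (csum u n) <= 2 * A.
Proof.
  intros HA H.
  assert (B : Cmod (csum u n) <= A * (2 - 2 * / (INR n + 1))).
  { induction n as [|n IH].
    - simpl. rewrite Cmod_0, Rplus_0_l, Rinv_1. lra.
    - cbn [csum]. eapply Rle_trans; [apply Cmod_triangle|].
      eapply Rle_trans; [apply Rplus_le_compat; [exact IH|apply H]|].
      rewrite S_INR. pose proof (pos_INR n) as Pn. set (x := INR n) in *.
      replace (A * (2 - 2 * / (x + 1)) + A / (x + 1) ^ 2) with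
        (A * (2 - 2 * / (x + 1) + / (x + 1) ^ 2)) by (field; lra).
      apply Rmult_le_compat_l; auto.
      assert (E : 2 - 2 * / (x + 1 + 1) - (2 - 2 * / (x + 1) + / (x + 1) ^ 2)
         = x / ((x + 1) ^ 2 * (x + 1 + 1))) by (field; lra).
      assert (0 <= x / ((x + 1) ^ 2 * (x + 1 + 1))).
      { apply Rmult_le_pos; auto. left. apply Rinv_0_lt_compat.
        apply Rmult_lt_0_compat; [apply pow_lt|]; lra. }
      lra. }
  pose proof (pos_INR n).
  assert (0 < / (INR n + 1)) by (apply Rinv_0_lt_compat; lra). nra.
Qed.

(* The weights integrate the cubic interpolating w at b, ..., b + 3 over the middle interval. *)
Definition quad (w : R -> C) (b : R) : C :=
  (RtoC (/ 24) * (- w b + RtoC 13 * w (b + 1)%R + RtoC 13 * w (b + 2)%R - w (b + 3)%R)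
   - CI w (b + 1)%R (b + 2)%R)%C.

Lemma RInt_cubic (p0 p1 p2 p3 b : R) :
  RInt (fun u => p0 + (u - b) * p1 + (u - b) ^ 2 / 2 * p2 + (u - b) ^ 3 / 6 * p3)
    (b + 1) (b + 2)
  = p0 + 3 / 2 * p1 + 7 / 6 * p2 + 5 / 8 * p3.
Proof.
  apply is_RInt_unique.
  set (P := fun u => (u - b) * p0 + (u - b) ^ 2 / 2 * p1 + (u - b) ^ 3 / 6 * p2
                     + (u - b) ^ 4 / 24 * p3).
  replace (p0 + 3 / 2 * p1 + 7 / 6 * p2 + 5 / 8 * p3)
    with (minus (P (b + 2)) (P (b + 1))) by (unfold minus, plus, opp, P; simpl; field).
  apply (is_RInt_derive (V := R_CompleteNormedModule) P).
  - intros u _. unfold P. auto_derive; auto. field.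
  - intros u _. apply continuous_of_derive.
    auto_derive; auto.
Qed.

(** The rule annihilates the cubic Taylor polynomial at [b]. The remainders at distance 1, 2, 3 are
    at most [2 K], [32 K], [162 K], and at most [32 K] under the integral; with the weights they
    total less than [60 K]. *)
Lemma quad_le (w0 w1 w2 w3 w4 : R -> C) b K : 0 <= K ->
  (forall t, b <= t <= b + 3 -> cderiv w0 t (w1 t) /\ cderiv w1 t (w2 t) /\
     cderiv w2 t (w3 t) /\ cderiv w3 t (w4 t) /\ Cmod (w4 t) <= K) ->
  Cmod (quad w0 b) <= 60 * K.
Proof.
  intros HK HD.
  set (T := fun h : R => (w0 b + RtoC h * w1 b + RtoC (h ^ 2 / 2)%R * w2 b
          + RtoC (h ^ 3 / 6)%R * w3 b)%C).
  assert (Tay : forall h, 0 <= h <= 3 -> Cmod (w0 (b + h)%R - T h) <= 2 * K * h ^ 4)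
    by exact (taylor4 w0 w1 w2 w3 w4 b 3 K HD).
  set (r := fun u => (w0 u - T (u - b)%R)%C).
  assert (C0 : forall u, b + 1 <= u <= b + 2 -> ccont w0 u).
  { intros u Hu. exact (cderiv_ccont _ _ _ (proj1 (HD u ltac:(lra)))). }
  assert (CT : forall u, ccont (fun u => T (u - b)%R) u).
  { intros u.
    assert (P : forall k (c : R) z, ccont (fun u => RtoC ((u - b) ^ k / c) * z)%C u).
    { intros k c z. apply ccont_mult; [|apply ccont_const]. apply ccont_RtoC.
      apply continuous_of_derive. auto_derive; auto. }
    assert (P1 : ccont (fun u => RtoC (u - b) * w1 b)%C u).
    { apply ccont_mult; [|apply ccont_const]. apply ccont_RtoC.
      apply continuous_of_derive. auto_derive; auto. }
    exact (ccont_plus _ _ _ (ccont_plus _ _ _ (ccont_plus _ _ _ (ccont_const _ _) P1)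
      (P 2%nat 2 (w2 b))) (P 3%nat 6 (w3 b))). }
  assert (IT : CI (fun u => T (u - b)%R) (b + 1) (b + 2)
     = (w0 b + RtoC (3 / 2) * w1 b + RtoC (7 / 6) * w2 b + RtoC (5 / 8) * w3 b)%C).
  { unfold CI. apply injective_projections; cbn [fst snd].
    - transitivity (fst (w0 b) + 3 / 2 * fst (w1 b) + 7 / 6 * fst (w2 b) + 5 / 8 * fst (w3 b)).
      + rewrite <- (RInt_cubic _ _ _ _ b). apply RInt_ext. intros u _. unfold T, Re; simpl. field.
      + simpl. field.
    - transitivity (snd (w0 b) + 3 / 2 * snd (w1 b) + 7 / 6 * snd (w2 b) + 5 / 8 * snd (w3 b)).
      + rewrite <- (RInt_cubic _ _ _ _ b). apply RInt_ext. intros u _. unfold T, Im; simpl. field.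
      + simpl. field. }
  assert (IW : CI w0 (b + 1) (b + 2) = (CI r (b + 1) (b + 2)
     + (w0 b + RtoC (3 / 2) * w1 b + RtoC (7 / 6) * w2 b + RtoC (5 / 8) * w3 b))%C).
  { rewrite <- IT, <- CI_plus; try lra.
    - apply CI_ext; [lra|]. intros u _. unfold r. ring.
    - intros u Hu. apply ccont_minus; auto.
    - auto. }
  assert (Br : Cmod (CI r (b + 1) (b + 2)) <= 32 * K * (b + 2 - (b + 1))).
  { apply CI_le_const; [lra| |].
    - intros u Hu. apply ccont_minus; auto.
    - intros u Hu. unfold r. replace u with (b + (u - b)) at 1 by ring.
      eapply Rle_trans; [apply Tay; lra|].
      assert ((u - b) ^ 4 <= 16) by (replace 16 with (2 ^ 4) by ring; apply pow_incr; lra).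
      nra. }
  assert (B1 := Tay 1 ltac:(lra)). assert (B2 := Tay 2 ltac:(lra)). assert (B3 := Tay 3 ltac:(lra)).
  set (e1 := (w0 (b + 1)%R - T 1)%C) in *. set (e2 := (w0 (b + 2)%R - T 2)%C) in *.
  set (e3 := (w0 (b + 3)%R - T 3)%C) in *. set (e4 := CI r (b + 1) (b + 2)) in *.
  assert (Q : quad w0 b = (RtoC (/ 24) * ((RtoC 13 * e1 + RtoC 13 * e2) + - e3) + - e4)%C).
  { unfold quad. rewrite IW. unfold e1, e2, e3, T.
    destruct (w0 b), (w1 b), (w2 b), (w3 b), (w0 (b + 1)), (w0 (b + 2)), (w0 (b + 3)), e4.
    apply injective_projections; simpl; field. }
  rewrite Q. eapply Rle_trans; [apply Cmod_triangle|].
  rewrite Cmod_mult, Cmod_opp, Cmod_R, (Rabs_right (/ 24)) by lra.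
  assert (T1 := Cmod_triangle (RtoC 13 * e1 + RtoC 13 * e2) (- e3)).
  assert (T2 := Cmod_triangle (RtoC 13 * e1) (RtoC 13 * e2)).
  rewrite Cmod_opp in T1. rewrite !Cmod_mult, !Cmod_R, (Rabs_right 13) in T2 by lra.
  lra.
Qed.

(* Summation by parts of the four-point stencil of [quad]: only the ends remain. *)
Lemma csum_quad (w : R -> C) n :
  (forall u, 0 < u -> ccont w u) ->
  let V := fun b => (RtoC (/ 24) * (w b + RtoC 12 * w (b + 1)%R - w (b + 2)%R))%C in
  csum (fun k => quad w (INR k + 1)) n
  = (csum (fun k => w (INR k + 2)%R) n + V (INR n + 1)%R - V 1 - CI w 2 (INR n + 2))%C.
Proof.
  intros Hw V. induction n as [|n IH].
  - cbn [csum INR]. rewrite !Rplus_0_l.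
    replace (CI w 2 2) with (RtoC 0); [ring|].
    apply injective_projections; symmetry;
      [exact (RInt_point 2 (fun t => Re (w t)))|exact (RInt_point 2 (fun t => Im (w t)))].
  - cbn [csum]. rewrite IH. pose proof (pos_INR n). rewrite S_INR.
    rewrite <- (CI_Chasles w 2 (INR n + 2) (INR n + 1 + 2)) by (try lra; intros; apply Hw; lra).
    unfold quad, V.
    replace (INR n + 1 + 1) with (INR n + 2) by ring.
    replace (INR n + 1 + 3) with (INR n + 2 + 2) by ring.
    replace (INR n + 2 + 1) with (INR n + 1 + 2) by ring.
    set (A := CI w (INR n + 2) (INR n + 1 + 2)). set (A' := CI w 2 (INR n + 2)).
    destruct A, A', (w (INR n + 1)), (w (INR n + 2)), (w (INR n + 1 + 2)),
      (w (INR n + 2 + 2)), (csum (fun k => w (INR k + 2)) n), (w 1), (w (1 + 1)), (w (1 + 2)).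
    apply injective_projections; simpl; field.
Qed.

(** The weights have absolute sum [28 / 24] and the integral contributes 1, which together is less
    than 3. *)
Lemma quad_close (w w' : R -> C) b e : 0 <= e ->
  (forall u, b <= u <= b + 3 -> ccont w u) -> (forall u, b <= u <= b + 3 -> ccont w' u) ->
  (forall u, b <= u <= b + 3 -> Cmod (w u - w' u) <= e) ->
  Cmod (quad w b - quad w' b) <= 3 * e.
Proof.
  intros He Hw Hw' H.
  assert (I : Cmod (CI w (b + 1) (b + 2) - CI w' (b + 1) (b + 2)) <= e * (b + 2 - (b + 1))).
  { rewrite <- CI_minus; try lra; try (intros; apply Hw; lra); try (intros; apply Hw'; lra).
    apply CI_le_const; [lra| |intros; apply H; lra].
    intros u Hu. apply ccont_minus; [apply Hw|apply Hw']; lra. }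
  assert (B0 := H b ltac:(lra)). assert (B1 := H (b + 1) ltac:(lra)).
  assert (B2 := H (b + 2) ltac:(lra)). assert (B3 := H (b + 3) ltac:(lra)).
  unfold quad.
  set (d0 := (w b - w' b)%C) in *. set (d1 := (w (b + 1)%R - w' (b + 1)%R)%C) in *.
  set (d2 := (w (b + 2)%R - w' (b + 2)%R)%C) in *. set (d3 := (w (b + 3)%R - w' (b + 3)%R)%C) in *.
  set (I1 := CI w (b + 1) (b + 2)) in *. set (I2 := CI w' (b + 1) (b + 2)) in *.
  match goal with |- Cmod ?z <= _ =>
    replace z with (RtoC (/ 24) * ((- d0 + RtoC 13 * d1) + (RtoC 13 * d2 + - d3)) + - (I1 - I2))%C
    by (unfold d0, d1, d2, d3; ring) end.
  eapply Rle_trans; [apply Cmod_triangle|].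
  rewrite Cmod_mult, Cmod_opp, Cmod_R, (Rabs_right (/ 24)) by lra.
  assert (T1 := Cmod_triangle (- d0 + RtoC 13 * d1) (RtoC 13 * d2 + - d3)).
  assert (T2 := Cmod_triangle (- d0) (RtoC 13 * d1)).
  assert (T3 := Cmod_triangle (RtoC 13 * d2) (- d3)).
  rewrite Cmod_opp, Cmod_mult, Cmod_R, (Rabs_right 13) in T2, T3 by lra.
  lra.
Qed.

(* The exponent in u^(-1-2s) for s = -3/2 + it. *)
Definition mono_exponent (t : R) : C := (2, - 2 * t).

(** The four factors brought down by differentiation have real parts 2, 1, 0, -1 and imaginary part
    [- 2 t]. Their product is at most [(2 + 2 |t|)^4 <= 64 (1 + t^2)^2], and the remaining power is
    [u^(-2)]. The constant is [60 * 64]. *)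
Lemma quad_Rcpow t b : 0 < b ->
  Cmod (quad (fun u => Rcpow u (mono_exponent t)) b) <= 3840 * (1 + t ^ 2) ^ 2 / b ^ 2.
Proof.
  intros Hb. set (z := mono_exponent t).
  assert (P2 : 0 < b ^ 2) by nra.
  replace (3840 * (1 + t ^ 2) ^ 2 / b ^ 2) with (60 * (64 * (1 + t ^ 2) ^ 2 / b ^ 2)) by (field; lra).
  apply (quad_le (fun u => Rcpow u z) (fun u => z * Rcpow u (z - 1))%C
    (fun u => z * ((z - 1) * Rcpow u (z - 1 - 1)))%C
    (fun u => z * ((z - 1) * ((z - 1 - 1) * Rcpow u (z - 1 - 1 - 1))))%C
    (fun u => z * ((z - 1) * ((z - 1 - 1) * ((z - 1 - 1 - 1) * Rcpow u (z - 1 - 1 - 1 - 1)))))%C).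
  { left. apply Rdiv_lt_0_compat; nra. }
  intros u Hu. assert (Hu0 : 0 < u) by lra.
  split; [now apply cderiv_Rcpow|].
  split; [now apply cderiv_scal, cderiv_Rcpow|].
  split; [now apply cderiv_scal, cderiv_scal, cderiv_Rcpow|].
  split; [now apply cderiv_scal, cderiv_scal, cderiv_scal, cderiv_Rcpow|].
  rewrite !Cmod_mult, Cmod_Rcpow.
  set (q := 2 + 2 * Rabs t). pose proof (Rabs_pos t) as Pt.
  assert (Z : forall x, Rabs x <= 2 -> Cmod (x, - 2 * t) <= q).
  { intros x Hx. eapply Rle_trans; [apply Cmod_le_sum|].
    rewrite Rabs_mult, (Rabs_left (- 2)) by lra. unfold q. lra. }
  assert (Z0 : Cmod z <= q) by (apply Z; rewrite Rabs_right; lra).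
  assert (Z1 : Cmod (z - 1) <= q).
  { replace (z - 1)%C with ((1, - 2 * t) : C);
      [apply Z; rewrite Rabs_right; lra|apply injective_projections; simpl; ring]. }
  assert (Z2 : Cmod (z - 1 - 1) <= q).
  { replace (z - 1 - 1)%C with ((0, - 2 * t) : C);
      [apply Z; rewrite Rabs_right; lra|apply injective_projections; simpl; ring]. }
  assert (Z3 : Cmod (z - 1 - 1 - 1) <= q).
  { replace (z - 1 - 1 - 1)%C with ((- (1), - 2 * t) : C);
      [apply Z; rewrite Rabs_left; lra|apply injective_projections; simpl; ring]. }
  replace (Re (z - 1 - 1 - 1 - 1)%C) with (- (2)) by (simpl; ring).
  assert (RP : Rpower u (- (2)) <= / b ^ 2).
  { rewrite Rpower_Ropp. replace 2 with (INR 2) at 1 by (simpl; ring).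
    rewrite Rpower_pow by lra. apply Rinv_le_contravar; auto. apply pow_incr; lra. }
  assert (Q4 : q * (q * (q * q)) <= 64 * (1 + t ^ 2) ^ 2).
  { assert (Q2 : q * q <= 8 * (1 + t ^ 2))
      by (unfold q; rewrite <- (pow2_abs t); pose proof (pow2_ge_0 (Rabs t - 1)); nra).
    assert (0 <= q * q) by nra.
    replace (q * (q * (q * q))) with ((q * q) * (q * q)) by ring.
    replace (64 * (1 + t ^ 2) ^ 2) with ((8 * (1 + t ^ 2)) * (8 * (1 + t ^ 2))) by ring.
    apply Rmult_le_compat; auto. }
  pose proof (Cmod_ge_0 z). pose proof (Cmod_ge_0 (z - 1)).
  pose proof (Cmod_ge_0 (z - 1 - 1)). pose proof (Cmod_ge_0 (z - 1 - 1 - 1)).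
  assert (P : 0 < Rpower u (- (2))) by apply exp_pos.
  apply Rle_trans with (q * (q * (q * (q * / b ^ 2)))).
  - repeat (apply Rmult_le_compat; auto; try (repeat apply Rmult_le_pos; auto; lra)).
  - replace (q * (q * (q * (q * / b ^ 2)))) with (q * (q * (q * q)) * / b ^ 2) by ring.
    unfold Rdiv. apply Rmult_le_compat_r; auto. left; now apply Rinv_0_lt_compat.
Qed.

Lemma ccont_mono_exponent t : ccont mono_exponent t.
Proof.
  apply ccont_pair; [apply continuous_const|].
  apply continuous_Rmult; [apply continuous_const|apply continuous_id].
Qed.

Lemma ccont2_Rcpow_mono u t : 0 < u -> ccont2 (fun u t => Rcpow u (mono_exponent t)) u t.
Proof.
  intros Hu. unfold Rcpow, mono_exponent, ccont2; simpl.
  assert (P : continuity_2d_pt (fun u _ => Rpower u 2) u t).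
  { apply continuity_2d_fst. unfold Rpower.
    apply continuous_of_derive. auto_derive; auto. }
  assert (A : continuity_2d_pt (fun u t => - 2 * t * ln u) u t).
  { apply continuity_2d_pt_mult.
    - apply continuity_2d_snd.
      apply continuous_Rmult; [apply continuous_const|apply continuous_id].
    - apply continuity_2d_fst.
      apply continuous_of_derive. auto_derive; auto. }
  split; apply continuity_2d_pt_mult; auto.
  - apply (continuity_1d_2d_pt_comp cos (fun u t => - 2 * t * ln u)); auto. apply continuity_cos.
  - apply (continuity_1d_2d_pt_comp sin (fun u t => - 2 * t * ln u)); auto. apply continuity_sin.
Qed.

Lemma ccont2_flip (g : R -> R -> C) u v : ccont2 g v u -> ccont2 (fun u v => g v u) u v.
Proof.
  intros [H1 H2]; split; intros e; [destruct (H1 e) as [d Hd]|destruct (H2 e) as [d Hd]];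
    exists d; intros; now apply Hd.
Qed.

Lemma ccont_CI_mono b t : 0 < b ->
  ccont (fun t => CI (fun u => Rcpow u (mono_exponent t)) (b + 1) (b + 2)) t.
Proof.
  intros Hb. apply (ccont_CI_param (fun t u => Rcpow u (mono_exponent t)) (t - 1)); try lra.
  intros t' u _ Hu. apply (ccont2_flip (fun u t => Rcpow u (mono_exponent t))).
  apply ccont2_Rcpow_mono; lra.
Qed.

Lemma ccont_quad_mono b t : 0 < b ->
  ccont (fun t => quad (fun u => Rcpow u (mono_exponent t)) b) t.
Proof.
  intros Hb.
  assert (H : forall u, ccont (fun t => Rcpow u (mono_exponent t)) t)
    by (intros; apply ccont_Rcpow_exponent, ccont_mono_exponent).
  unfold quad. apply ccont_minus; [|now apply ccont_CI_mono].
  apply ccont_mult; [apply ccont_const|]. apply ccont_minus; [|apply H].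
  apply ccont_plus; [apply ccont_plus; [apply (ccont_opp (fun t => Rcpow b (mono_exponent t))), H|]|];
    (apply ccont_mult; [apply ccont_const|apply H]).
Qed.

Lemma ccont_ext_pos (f g : R -> C) u : 0 < u -> (forall v, 0 < v -> g v = f v) ->
  ccont f u -> ccont g u.
Proof.
  intros Hu E [H1 H2].
  assert (L : locally u (fun v => 0 < v)) by (apply open_gt; exact Hu).
  split.
  - apply continuous_ext_loc with (fun t => Re (f t)); auto.
    eapply filter_imp; [|exact L]. intros v Hv. simpl. now rewrite E.
  - apply continuous_ext_loc with (fun t => Im (f t)); auto.
    eapply filter_imp; [|exact L]. intros v Hv. simpl. now rewrite E.
Qed.

(** * The diagonal summand on the line of abscissa -3/2 *)

Section Profile.

Context (F : C -> C)
  (F_diff : forall s, s <> RtoC 0 -> cdiff F s)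
  (F_decay : rapid_decay_strips F)
  (h : R -> C) (c0 : C)
  (h_cont : forall x, 0 < x -> ccont h x)
  (inv_left : inverts F (- (3 / 2)) (fun x => h x - c0)%C).

(** The diagonal summand at [x = a / q], extended to real [u] and freed of its harmonic part
    [c0 / u]. *)
Definition profile (x u : R) : C := ((h (x * u ^ 2)%R - c0) * RtoC (/ u))%C.

Let s1 : R := - (3 / 2).

Lemma ccont_profile x u : 0 < x -> 0 < u -> ccont (profile x) u.
Proof.
  intros Hx Hu. assert (0 < x * u ^ 2) by (apply Rmult_lt_0_compat; [|apply pow_lt]; auto).
  apply ccont_mult.
  - apply ccont_minus; [|apply ccont_const].
    apply (ccont_comp h (fun u => x * u ^ 2)); [|now apply h_cont].
    apply continuous_of_derive. auto_derive; auto.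
  - apply ccont_RtoC. apply continuous_of_derive.
    auto_derive. lra.
Qed.

Lemma line_integral_profile x u M : 0 < x -> 0 < u -> 0 <= M ->
  (line_integral F s1 (x * u ^ 2) M * RtoC (/ u))%C
  = CI (fun t => F (s1, t) * (Rcpow x (- (s1, t)) * Rcpow u (mono_exponent t)))%C (- M) M.
Proof.
  intros Hx Hu HM. unfold line_integral. rewrite Cmult_comm, <- CI_scal; try lra.
  2:{ intros; apply ccont_line_integrand; auto. unfold s1; lra. }
  apply CI_ext; [lra|]. intros t _.
  assert (E : RtoC (/ u) = Rcpow u (RtoC (- (1)))) by (rewrite Rcpow_R, Rpower_Ropp, Rpower_1; auto).
  replace (mono_exponent t) with (RtoC (- (1)) + (- (s1, t) + - (s1, t)))%C.
  - replace (x * u ^ 2) with (x * (u * u)) by ring.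
    rewrite !Rcpow_add, <- E, !Rcpow_mult by (auto; now apply Rmult_lt_0_compat). ring.
  - unfold mono_exponent, s1. apply injective_projections; simpl; field.
Qed.

Lemma ccont_line_profile x u M : 0 < x -> 0 < u -> 0 <= M ->
  ccont (fun u => line_integral F s1 (x * u ^ 2) M * RtoC (/ u))%C u.
Proof.
  intros Hx Hu HM.
  apply ccont_ext_pos with (fun u =>
    CI (fun t => F (s1, t) * Rcpow x (- (s1, t)) * Rcpow u (mono_exponent t))%C (- M) M); auto.
  - intros v Hv. rewrite line_integral_profile by auto. apply CI_ext; [lra|].
    intros t _. ring.
  - apply (ccont_CI_param
      (fun u t => F (s1, t) * Rcpow x (- (s1, t)) * Rcpow u (mono_exponent t))%C 0); try lra.
    intros v t Hv _. apply ccont2_mult; [|now apply ccont2_Rcpow_mono].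
    apply (ccont2_snd (fun t => F (s1, t) * Rcpow x (- (s1, t)))%C).
    apply ccont_line_integrand; auto. unfold s1; lra.
Qed.

(** The quadrature error is linear in the function, so it passes under the integral over [t]; its
    integral part requires an exchange of order. The error is thereby reduced to that of the pure
    powers [u^(2 - 2it)]. *)
Lemma quad_line_integral x M b : 0 < x -> 0 < b -> 0 <= M ->
  quad (fun u => line_integral F s1 (x * u ^ 2) M * RtoC (/ u))%C b
  = CI (fun t => F (s1, t) * (Rcpow x (- (s1, t))
                 * quad (fun u => Rcpow u (mono_exponent t)) b))%C (- M) M.
Proof.
  intros Hx Hb HM. assert (HMM : - M <= M) by lra.
  set (A := fun t => (F (s1, t) * Rcpow x (- (s1, t)))%C).
  assert (CA : forall t, ccont A t)
    by (intros; apply ccont_line_integrand; auto; unfold s1; lra).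
  set (G := fun t u => (A t * Rcpow u (mono_exponent t))%C).
  assert (CG : forall u t, ccont (fun t => G t u) t).
  { intros u t. apply ccont_mult; auto. apply ccont_Rcpow_exponent, ccont_mono_exponent. }
  assert (LG : forall u, 0 < u -> (line_integral F s1 (x * u ^ 2) M * RtoC (/ u))%C
     = CI (fun t => G t u) (- M) M).
  { intros u Hu. rewrite line_integral_profile by auto. apply CI_ext; auto.
    intros t _. unfold G, A. ring. }
  assert (C2 : forall u t, 0 < u -> ccont2 (fun u t => G t u) u t).
  { intros u t Hu. apply ccont2_mult; [now apply (ccont2_snd A)|now apply ccont2_Rcpow_mono]. }
  set (J := fun t => CI (fun u => Rcpow u (mono_exponent t)) (b + 1) (b + 2)).
  assert (CR : forall t u, 0 < u -> ccont (fun u => Rcpow u (mono_exponent t)) u)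
    by (intros t u Hu; eapply cderiv_ccont; now apply cderiv_Rcpow).
  assert (CJ : forall t, ccont J t) by (intros t; now apply ccont_CI_mono).
  assert (IG : CI (fun u => line_integral F s1 (x * u ^ 2) M * RtoC (/ u))%C (b + 1) (b + 2)
     = CI (fun t => A t * J t)%C (- M) M).
  { rewrite (CI_ext (b + 1) (b + 2) ltac:(lra) _ (fun u => CI (fun t => G t u) (- M) M))
      by (intros u Hu; apply LG; lra).
    rewrite <- (CI_swap (fun u t => G t u) 0 (b + 1) (b + 2) (- M) M); try lra.
    - apply CI_ext; auto. intros t _. unfold J, G. rewrite CI_scal; try lra; auto.
      intros u Hu. apply CR; lra.
    - intros; now apply C2. }
  unfold quad at 1. rewrite IG, !LG by lra. symmetry.
  rewrite (CI_ext (- M) M HMM _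
    (fun t => RtoC (/ 24) * ((RtoC 13 * G t (b + 1)%R - G t b) + (RtoC 13 * G t (b + 2)%R - G t (b + 3)%R))
              - A t * J t)%C).
  2:{ intros t _. unfold quad, G, A, J. ring. }
  assert (C13 : forall u t, ccont (fun t => RtoC 13 * G t u)%C t)
    by (intros u t; apply ccont_mult; [apply ccont_const|apply CG]).
  assert (CD : forall u v t, ccont (fun t => RtoC 13 * G t u - G t v)%C t)
    by (intros u v t; apply ccont_minus; [apply C13|apply CG]).
  rewrite CI_minus, CI_scal, CI_plus, !CI_minus, !CI_scal; auto.
  - ring.
  - intros t _. apply ccont_plus; apply CD.
  - intros t _. apply ccont_mult; [apply ccont_const|]. apply ccont_plus; apply CD.
  - intros t _. now apply ccont_mult.
Qed.

Lemma Rpower_profile x u : 0 < x -> 0 < u ->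
  Rpower (x * u ^ 2) (3 / 2) * / u = Rpower x (3 / 2) * u ^ 2.
Proof.
  intros Hx Hu. rewrite <- Rpower_mult_distr by (auto; now apply pow_lt).
  replace (Rpower (u ^ 2) (3 / 2)) with (u ^ 3).
  - field. lra.
  - rewrite <- (Rpower_pow 2), Rpower_mult by auto. simpl.
    replace ((1 + 1) * (3 / 2)) with (INR 3) by (simpl; field).
    now rewrite Rpower_pow.
Qed.

(** The bound holds for the line integral truncated at [M], uniformly in [M]. Replacing the
    truncation by the profile costs [O((b + 3)^2 / M)] for fixed [x], which vanishes in the
    limit. *)
Lemma quad_profile : exists A, 0 <= A /\ forall x b, 0 < x -> 0 < b ->
  Cmod (quad (profile x) b) <= A * Rpower x (3 / 2) / b ^ 2.
Proof.
  assert (Hs : s1 <> 0) by (unfold s1; lra).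
  destruct (F_vertical_bound F F_diff F_decay s1 Hs) as [K [K0 HK]].
  destruct (inverts_uniform F F_diff F_decay s1 _ Hs inv_left) as [K' [K0' HK']].
  replace (- s1) with (3 / 2) in HK' by (unfold s1; lra).
  pose proof PI_RGT_0 as PP. pose proof PI2_1 as P21.
  exists (K * 3840 * PI). split; [apply Rmult_le_pos; lra|]. intros x b Hx Hb.
  set (X := Rpower x (3 / 2)). assert (PX : 0 < X) by apply exp_pos.
  assert (Pb : 0 < b ^ 2) by nra.
  apply le_epsilon. intros e He.
  set (Q := 3 * (K' * X * (b + 3) ^ 2)).
  assert (PQ : 0 <= K' * X * (b + 3) ^ 2)
    by (pose proof (pow2_ge_0 (b + 3)); apply Rmult_le_pos; [apply Rmult_le_pos|]; lra).
  assert (HQ : 0 <= Q) by (unfold Q; lra).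
  destruct (limit_of_K_over_M Q e HQ He) as [M [M1 HM]]. specialize (HM M (Rle_refl M)).
  set (WM := fun u => (line_integral F s1 (x * u ^ 2) M * RtoC (/ u))%C).
  set (W2 := fun u => (RtoC (2 * PI) * profile x u)%C).
  assert (B1 : Cmod (quad WM b) <= K * (3840 * X / b ^ 2) * PI).
  { unfold WM. rewrite quad_line_integral by lra.
    apply CI_F_mult_le; auto; try lra.
    - left. apply Rdiv_lt_0_compat; lra.
    - intros t. apply ccont_mult; [|now apply ccont_quad_mono].
      apply ccont_Rcpow_exponent, ccont_opp, ccont_vertical.
    - intros t _. rewrite Cmod_mult, Cmod_Rcpow, Re_vertical_opp.
      replace (- s1) with (3 / 2) by (unfold s1; lra). fold X.
      replace (3840 * X / b ^ 2 * (1 + t ^ 2) ^ 2)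
        with (X * (3840 * (1 + t ^ 2) ^ 2 / b ^ 2)) by (field; lra).
      apply Rmult_le_compat_l; [lra|]. now apply quad_Rcpow. }
  assert (CW : forall u, b <= u <= b + 3 -> ccont (profile x) u)
    by (intros; apply ccont_profile; lra).
  assert (B2 : Cmod (quad WM b - quad W2 b) <= 3 * (K' * X * (b + 3) ^ 2 / (1 + M ^ 2))).
  { apply quad_close.
    - apply Rmult_le_pos; [exact PQ|].
      left; apply Rinv_0_lt_compat; nra.
    - intros u Hu. exact (ccont_line_profile x u M Hx ltac:(lra) ltac:(lra)).
    - intros u Hu. exact (ccont_mult _ _ _ (ccont_const _ _) (CW u Hu)).
    - intros u Hu. assert (Pu : 0 < u) by lra. unfold WM, W2, profile.
      replace (line_integral F s1 (x * u ^ 2) M * RtoC (/ u)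
         - RtoC (2 * PI) * ((h (x * u ^ 2)%R - c0) * RtoC (/ u)))%C with
        ((line_integral F s1 (x * u ^ 2) M - RtoC (2 * PI) * (h (x * u ^ 2)%R - c0)) * RtoC (/ u))%C
        by ring.
      assert (Pi : 0 < / u) by now apply Rinv_0_lt_compat.
      rewrite Cmod_mult, Cmod_R, (Rabs_right (/ u)) by lra.
      eapply Rle_trans; [apply Rmult_le_compat_r; [lra|apply HK'; [|lra]]|].
      { apply Rmult_lt_0_compat; [|apply pow_lt]; auto. }
      replace (K' * Rpower (x * u ^ 2) (3 / 2) / (1 + M ^ 2) * / u) with
        (K' * (Rpower (x * u ^ 2) (3 / 2) * / u) / (1 + M ^ 2)) by (field; split; nra).
      rewrite Rpower_profile by auto. fold X. unfold Rdiv.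
      apply Rmult_le_compat_r; [left; apply Rinv_0_lt_compat; nra|].
      rewrite Rmult_assoc. apply Rmult_le_compat_l; auto.
      apply Rmult_le_compat_l; [lra|]. apply pow_incr; lra. }
  assert (E2 : quad W2 b = (RtoC (2 * PI) * quad (profile x) b)%C).
  { unfold quad, W2. rewrite CI_scal; [ring|lra|]. intros; apply CW; lra. }
  assert (B3 : 3 * (K' * X * (b + 3) ^ 2 / (1 + M ^ 2)) <= e).
  { eapply Rle_trans; [|exact HM]. unfold Q, Rdiv. rewrite <- Rmult_assoc.
    apply Rmult_le_compat_l; [lra|].
    apply Rinv_le_contravar; nra. }
  assert (T : 2 * PI * Cmod (quad (profile x) b) <= K * (3840 * X / b ^ 2) * PI + e).
  { replace (2 * PI * Cmod (quad (profile x) b)) with (Cmod (quad W2 b))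
      by (rewrite E2, Cmod_mult, Cmod_R, Rabs_right by lra; ring).
    replace (quad W2 b) with (quad WM b + - (quad WM b - quad W2 b))%C by ring.
    eapply Rle_trans; [apply Cmod_triangle|]. rewrite Cmod_opp. lra. }
  pose proof (Cmod_ge_0 (quad (profile x) b)).
  replace (K * 3840 * PI * X / b ^ 2) with (K * (3840 * X / b ^ 2) * PI) by (field; lra).
  assert (0 <= K * (3840 * X / b ^ 2) * PI).
  { apply Rmult_le_pos; [|lra]. apply Rmult_le_pos; auto. left. apply Rdiv_lt_0_compat; lra. }
  nra.
Qed.

End Profile.

(** * The diagonal sum *)

Section DiagonalSum.

Context (h : R -> C) (c0 : C) (A0 B Aq : R)
  (h_cont : forall x, 0 < x -> ccont h x)
  (A0_pos : 0 <= A0) (B_pos : 0 <= B) (Aq_pos : 0 <= Aq)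
  (near_0 : forall x, 0 < x -> Cmod (h x - c0) <= A0 * Rpower x (3 / 2))
  (decay : forall x, 0 < x -> Cmod (h x) * (1 + x) ^ 3 <= B)
  (quad_small : forall x b, 0 < x -> 0 < b ->
     Cmod (quad (profile h c0 x) b) <= Aq * Rpower x (3 / 2) / b ^ 2).

Let W := profile h c0.

Lemma h_le x : 0 < x -> Cmod (h x) <= B / x.
Proof.
  intros Hx. apply Rmult_le_reg_r with x; auto.
  replace (B / x * x) with B by (field; lra). eapply Rle_trans; [|apply (decay x Hx)].
  apply Rmult_le_compat_l; [apply Cmod_ge_0|].
  assert (0 <= x ^ 2) by nra. assert (0 <= x ^ 3) by (apply pow_le; lra). nra.
Qed.

Lemma h_bounded x : 0 < x -> Cmod (h x) <= B.
Proof.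
  intros Hx. eapply Rle_trans; [|apply (decay x Hx)].
  assert (1 <= (1 + x) ^ 3) by (apply pow_R1_Rle; lra).
  pose proof (Cmod_ge_0 (h x)). nra.
Qed.

Lemma profile_small x u : 0 < x -> 0 < u -> Cmod (W x u) <= A0 * Rpower x (3 / 2) * u ^ 2.
Proof.
  intros Hx Hu. unfold W, profile.
  assert (Pi : 0 < / u) by now apply Rinv_0_lt_compat.
  rewrite Cmod_mult, Cmod_R, Rabs_right by lra.
  rewrite Rmult_assoc, <- Rpower_profile, <- Rmult_assoc by auto.
  apply Rmult_le_compat_r; [lra|]. apply near_0.
  apply Rmult_lt_0_compat; [|apply pow_lt]; auto.
Qed.

Lemma profile_far x u : 0 < x -> 0 < u -> Cmod (W x u) <= (B + Cmod c0) / u.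
Proof.
  intros Hx Hu. unfold W, profile.
  assert (Pi : 0 < / u) by now apply Rinv_0_lt_compat.
  rewrite Cmod_mult, Cmod_R, Rabs_right by lra.
  apply Rmult_le_compat_r; [lra|]. eapply Rle_trans; [apply Cmod_triangle|].
  rewrite Cmod_opp. apply Rplus_le_compat_r. apply h_bounded.
  apply Rmult_lt_0_compat; [|apply pow_lt]; auto.
Qed.

Lemma ccont_W x u : 0 < x -> 0 < u -> ccont (W x) u.
Proof. apply ccont_profile; auto. Qed.

(** By [csum_quad] the difference consists of quadrature errors and end terms. The stencil starting
    at 1 integrates over [[2, 3]], so the integral begins at 2. The constant [4 * A0] is [3 * A0]
    for the stencil terms at the left end and [A0] for the summand at 1. *)
Lemma csum_profile_close x N : 0 < x ->
  Cmod (csum (fun k => W x (INR k + 1)) (S N) - CI (W x) 2 (INR N + 2))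
  <= (4 * A0 + 2 * Aq) * Rpower x (3 / 2) + (B + Cmod c0) / (INR N + 1).
Proof.
  intros Hx. pose proof (pos_INR N) as PN. set (X := Rpower x (3 / 2)).
  assert (PX : 0 < X) by apply exp_pos.
  assert (E := csum_quad (W x) N (fun u Hu => ccont_W x u Hx Hu)). cbv zeta in E.
  set (V := fun b => (RtoC (/ 24) * (W x b + RtoC 12 * W x (b + 1)%R - W x (b + 2)%R))%C) in *.
  assert (BV : forall b, Cmod (V b)
     <= / 24 * (Cmod (W x b) + 12 * Cmod (W x (b + 1)) + Cmod (W x (b + 2)))).
  { intros b. unfold V. rewrite Cmod_mult, Cmod_R, Rabs_right by lra.
    apply Rmult_le_compat_l; [lra|].
    eapply Rle_trans; [apply Cmod_triangle|]. rewrite Cmod_opp.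
    apply Rplus_le_compat_r. eapply Rle_trans; [apply Cmod_triangle|].
    rewrite Cmod_mult, Cmod_R, Rabs_right by lra. lra. }
  assert (V1 : Cmod (V 1) <= 3 * A0 * X).
  { eapply Rle_trans; [apply BV|].
    pose proof (profile_small x 1 Hx ltac:(lra)) as Q1.
    pose proof (profile_small x (1 + 1) Hx ltac:(lra)) as Q2.
    pose proof (profile_small x (1 + 2) Hx ltac:(lra)) as Q3. fold X in Q1, Q2, Q3. nra. }
  assert (VN : Cmod (V (INR N + 1)) <= (B + Cmod c0) / (INR N + 1)).
  { eapply Rle_trans; [apply BV|].
    assert (G : forall u, INR N + 1 <= u -> Cmod (W x u) <= (B + Cmod c0) / (INR N + 1)).
    { intros u Hu. eapply Rle_trans; [apply profile_far; lra|].
      apply Rmult_le_compat_l; [pose proof (Cmod_ge_0 c0); lra|].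
      apply Rinv_le_contravar; lra. }
    pose proof (G (INR N + 1) ltac:(lra)). pose proof (G (INR N + 1 + 1) ltac:(lra)).
    pose proof (G (INR N + 1 + 2) ltac:(lra)).
    pose proof (Cmod_ge_0 (W x (INR N + 1))). lra. }
  assert (Qs : Cmod (csum (fun k => quad (W x) (INR k + 1)) N) <= 2 * (Aq * X)).
  { apply csum_inverse_squares_le; [nra|]. intros k. pose proof (pos_INR k).
    apply quad_small; lra. }
  assert (W1 := profile_small x 1 Hx ltac:(lra)). fold X in W1.
  rewrite csum_shift.
  rewrite (csum_ext (fun k => W x (INR (S k) + 1)) (fun k => W x (INR k + 2)) N)
    by (intros k _; f_equal; rewrite S_INR; ring).
  replace (INR 0 + 1) with 1 by (simpl; ring).
  set (S2 := csum (fun k => W x (INR k + 2)) N) in *.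
  set (SQ := csum (fun k => quad (W x) (INR k + 1)) N) in *.
  set (J := CI (W x) 2 (INR N + 2)) in *.
  replace (W x 1 + S2 - J)%C with (W x 1 + (SQ + (- V (INR N + 1)%R + V 1)))%C
    by (rewrite E; ring).
  eapply Rle_trans; [apply Cmod_triangle|].
  eapply Rle_trans; [apply Rplus_le_compat_l, Cmod_triangle|].
  eapply Rle_trans; [apply Rplus_le_compat_l, Rplus_le_compat_l, Cmod_triangle|].
  rewrite Cmod_opp. nra.
Qed.

Let g := fun v => ((h v - c0) * RtoC (/ v))%C.

Lemma ccont_g v : 0 < v -> ccont g v.
Proof.
  intros Hv. apply ccont_mult.
  - apply ccont_minus; [now apply h_cont|apply ccont_const].
  - apply ccont_RtoC. apply continuous_of_derive.
    auto_derive. lra.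
Qed.

(** Substitution [v = x u^2], under which [du / u = dv / (2 v)]. Afterwards [x] enters only through
    the limits of integration. *)
Lemma CI_profile x Y : 0 < x -> 2 <= Y ->
  CI (W x) 2 Y = (RtoC (/ 2) * CI g (4 * x) (x * Y ^ 2))%C.
Proof.
  intros Hx HY.
  assert (S : forall f : R -> R, (forall v, 0 < v -> continuous f v) ->
    RInt (fun u => 2 * x * u * f (x * u ^ 2)) 2 Y = RInt f (4 * x) (x * Y ^ 2)).
  { intros f Hf.
    assert (E := RInt_comp (V := R_CompleteNormedModule) f (fun u => x * u ^ 2) (fun u => 2 * x * u) 2 Y).
    rewrite Rmin_left, Rmax_right in E by lra. cbv beta in E.
    replace (x * 2 ^ 2) with (4 * x) in E by ring.
    apply E.
    - intros u Hu. apply Hf. apply Rmult_lt_0_compat; [|apply pow_lt]; lra.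
    - intros u Hu. split; [auto_derive; auto; ring|].
      apply continuous_of_derive. auto_derive; auto. }
  assert (H42 : 4 * x <= x * Y ^ 2) by (assert (4 <= Y ^ 2) by nra; nra).
  rewrite <- CI_scal; auto.
  2:{ intros v Hv. apply ccont_g; lra. }
  unfold CI. f_equal.
  - rewrite <- (S (fun v => Re (RtoC (/ 2) * g v)%C)).
    + apply RInt_ext. intros u Hu. rewrite Rmin_left, Rmax_right in Hu by lra.
      unfold W, profile, g, Re. simpl. field. lra.
    + intros v Hv. exact (proj1 (ccont_mult _ _ _ (ccont_const _ v) (ccont_g v Hv))).
  - rewrite <- (S (fun v => Im (RtoC (/ 2) * g v)%C)).
    + apply RInt_ext. intros u Hu. rewrite Rmin_left, Rmax_right in Hu by lra.
      unfold W, profile, g, Im. simpl. field. lra.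
    + intros v Hv. exact (proj2 (ccont_mult _ _ _ (ccont_const _ v) (ccont_g v Hv))).
Qed.

Lemma CI_g_near p q : 0 < p <= q -> Cmod (CI g p q) <= A0 * Rpower q (3 / 2).
Proof.
  intros Hpq.
  apply Rle_trans with (A0 * Rpower q (1 / 2) * (q - p)).
  - apply CI_le_const; [lra|intros; apply ccont_g; lra|].
    intros v Hv. unfold g. assert (Pi : 0 < / v) by (apply Rinv_0_lt_compat; lra).
    rewrite Cmod_mult, Cmod_R, Rabs_right by lra.
    apply Rle_trans with (A0 * Rpower v (3 / 2) * / v).
    + apply Rmult_le_compat_r; [lra|]. apply near_0; lra.
    + rewrite Rmult_assoc. apply Rmult_le_compat_l; auto.
      replace (3 / 2) with (1 / 2 + 1) by field. rewrite Rpower_plus, Rpower_1 by lra.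
      rewrite Rmult_assoc, Rinv_r, Rmult_1_r by lra.
      apply Rle_Rpower_l; lra.
  - replace (3 / 2) with (1 / 2 + 1) by field. rewrite Rpower_plus, Rpower_1 by lra.
    rewrite <- Rmult_assoc. apply Rmult_le_compat_l; [|lra].
    apply Rmult_le_pos; auto. left; apply exp_pos.
Qed.

(** The part [c0 / v] of [g] integrates to the logarithm, and [h v / v] is at most [B / v^2]. *)
Lemma CI_g_far p q : 0 < p <= q ->
  Cmod (CI g p q + c0 * RtoC (ln q - ln p)) <= B / p ^ 2 * (q - p).
Proof.
  intros Hpq.
  assert (Ci : forall v, 0 < v -> continuous (fun v => / v) v).
  { intros v Hv. apply continuous_of_derive.
    auto_derive. lra. }
  assert (Ch : forall v, p <= v <= q -> ccont (fun v => h v * RtoC (/ v))%C v).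
  { intros v Hv. apply ccont_mult; [apply h_cont; lra|]. apply ccont_RtoC, Ci; lra. }
  assert (L : (c0 * RtoC (ln q - ln p))%C = CI (fun v => c0 * RtoC (/ v))%C p q).
  { rewrite CI_scal; [|lra|intros; apply ccont_RtoC, Ci; lra].
    f_equal. unfold CI, RtoC. apply injective_projections; cbn [fst snd]; symmetry.
    - apply is_RInt_unique. change (ln q - ln p) with (minus (ln q) (ln p)).
      apply (is_RInt_derive (V := R_CompleteNormedModule) ln); rewrite Rmin_left, Rmax_right by lra.
      + intros v Hv. auto_derive; [lra|]. simpl. field. lra.
      + intros v Hv. apply Ci; lra.
    - unfold Im; simpl. rewrite RInt_const. apply Rmult_0_r. }
  rewrite L, <- CI_plus; try lra.
  2:{ intros; apply ccont_g; lra. }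
  2:{ intros v Hv. apply ccont_mult; [apply ccont_const|apply ccont_RtoC, Ci; lra]. }
  rewrite (CI_ext p q ltac:(lra) _ (fun v => h v * RtoC (/ v))%C)
    by (intros; unfold g; ring).
  apply CI_le_const; [lra|auto|].
  intros v Hv. assert (Pi : 0 < / v) by (apply Rinv_0_lt_compat; lra).
  assert (Pi2 : / v <= / p) by (apply Rinv_le_contravar; lra).
  rewrite Cmod_mult, Cmod_R, Rabs_right by lra.
  pose proof (h_le v ltac:(lra)) as Hv'. unfold Rdiv in *.
  pose proof (Cmod_ge_0 (h v)).
  replace (B * / p ^ 2) with ((B * / p) * / p) by (field; lra).
  apply Rmult_le_compat; try lra.
  eapply Rle_trans; [exact Hv'|]. apply Rmult_le_compat_l; auto.
Qed.

Context (P : R -> C)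
  (P_lim : forall x e, 0 < x -> 0 < e -> exists N0, forall N, (N0 <= N)%nat ->
     Cmod (csum (fun k => h (x * (INR k + 1) ^ 2)%R * RtoC (/ (INR k + 1)))%C N - P x) <= e).

(** With the same [N] for [x] and [y] the harmonic sums multiplied by [c0] cancel. The two integrals
    of [g] overlap; what remains is [[4y, 4x]], which is small, and [[y T^2, x T^2]], which gives
    the logarithm. Half of [A0 (4x)^(3/2)] adds [4 * A0] to the constant of [csum_profile_close]. *)
Lemma diagonal_sum_osc x y : 0 < y <= x ->
  Cmod ((P x + c0 * RtoC (/ 2 * ln x)) - (P y + c0 * RtoC (/ 2 * ln y)))
  <= (8 * A0 + 2 * Aq) * (Rpower x (3 / 2) + Rpower y (3 / 2)).
Proof.
  intros Hxy. set (X := Rpower x (3 / 2)). set (Y := Rpower y (3 / 2)).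
  assert (PX : 0 < X) by apply exp_pos. assert (PY : 0 < Y) by apply exp_pos.
  apply le_epsilon. intros e He.
  set (D := B + Cmod c0). assert (HD : 0 <= D) by (unfold D; pose proof (Cmod_ge_0 c0); lra).
  set (Z := B / y ^ 2 * x).
  assert (Py2 : 0 < y ^ 2) by (apply pow_lt; lra).
  assert (HZ : 0 <= Z).
  { unfold Z. apply Rmult_le_pos; [|lra]. apply Rmult_le_pos; auto.
    left; now apply Rinv_0_lt_compat. }
  destruct (P_lim x (e / 8) ltac:(lra) ltac:(lra)) as [N1 H1].
  destruct (P_lim y (e / 8) ltac:(lra) ltac:(lra)) as [N2 H2].
  destruct (limit_of_K_over_M D (e / 8) HD ltac:(lra)) as [M3 [_ H3]].
  destruct (limit_of_K_over_M Z (e / 8) HZ ltac:(lra)) as [M4 [_ H4]].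
  (* The third bound forces [4 x <= y T^2], so that the ranges of integration overlap as
     required. *)
  assert (Hr : exists n, Rmax (Rmax M3 M4) (4 * x / y) <= INR n).
  { destruct (INR_unbounded (Rmax (Rmax M3 M4) (4 * x / y))) as [n Hn]. exists n. lra. }
  destruct Hr as [n5 H5].
  set (N := (N1 + N2 + n5)%nat).
  assert (HN5 : Rmax (Rmax M3 M4) (4 * x / y) <= INR N)
    by (eapply Rle_trans; [exact H5|]; apply le_INR; unfold N; lia).
  assert (HM34 : Rmax M3 M4 <= INR N) by (eapply Rle_trans; [apply Rmax_l|exact HN5]).
  assert (Hxy4 : 4 * x / y <= INR N) by (eapply Rle_trans; [apply Rmax_r|exact HN5]).
  assert (HM3 : M3 <= INR N) by (eapply Rle_trans; [apply Rmax_l|exact HM34]).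
  assert (HM4 : M4 <= INR N) by (eapply Rle_trans; [apply Rmax_r|exact HM34]).
  pose proof (pos_INR N) as PN.
  specialize (H1 (S N) ltac:(unfold N; lia)). specialize (H2 (S N) ltac:(unfold N; lia)).
  specialize (H3 (INR N + 1) ltac:(lra)). specialize (H4 (INR N + 2) ltac:(lra)).
  assert (C1 := csum_profile_close x N ltac:(lra)).
  assert (C2 := csum_profile_close y N ltac:(lra)).
  fold X in C1. fold Y in C2. fold D in C1, C2.
  set (T := INR N + 2) in *.
  assert (HT : 2 <= T) by (unfold T; lra).
  rewrite (CI_profile x T ltac:(lra) HT) in C1.
  rewrite (CI_profile y T ltac:(lra) HT) in C2.
  assert (HT2 : 1 <= T) by lra.
  assert (TT : T <= T ^ 2) by nra.
  assert (O1 : 4 * x <= y * T ^ 2).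
  { assert (4 * x <= y * INR N).
    { apply Rmult_le_reg_r with (/ y); [apply Rinv_0_lt_compat; lra|].
      replace (y * INR N * / y) with (INR N) by (field; lra). exact Hxy4. }
    apply Rle_trans with (y * T); [unfold T; nra|]. apply Rmult_le_compat_l; lra. }
  assert (O2 : y * T ^ 2 <= x * T ^ 2) by (apply Rmult_le_compat_r; nra).
  assert (G1 : (CI g (4 * x) (x * T ^ 2) - CI g (4 * y) (y * T ^ 2))%C
     = (CI g (y * T ^ 2) (x * T ^ 2) - CI g (4 * y) (4 * x))%C).
  { rewrite <- (CI_Chasles g (4 * x) (y * T ^ 2) (x * T ^ 2)) by (try lra; intros; apply ccont_g; lra).
    rewrite <- (CI_Chasles g (4 * y) (4 * x) (y * T ^ 2)) by (try lra; intros; apply ccont_g; lra).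
    ring. }
  assert (F1 := CI_g_near (4 * y) (4 * x) ltac:(lra)).
  assert (F2 := CI_g_far (y * T ^ 2) (x * T ^ 2) ltac:(split; [apply Rmult_lt_0_compat; nra|lra])).
  assert (P4 : Rpower (4 * x) (3 / 2) = 8 * X).
  { rewrite <- Rpower_mult_distr by lra. f_equal.
    replace 4 with (Rpower 2 2) at 1.
    - rewrite Rpower_mult. replace (2 * (3 / 2)) with (INR 3) by (simpl; field).
      rewrite Rpower_pow by lra. ring.
    - replace 2 with (INR 2) at 2 by (simpl; ring). rewrite Rpower_pow by lra. ring. }
  rewrite P4 in F1.
  assert (PT2 : 0 < T ^ 2) by nra.
  rewrite !ln_mult in F2 by lra.
  replace (ln x + ln (T ^ 2) - (ln y + ln (T ^ 2))) with (ln x - ln y) in F2 by ring.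
  assert (F2' : B / (y * T ^ 2) ^ 2 * (x * T ^ 2 - y * T ^ 2) <= e / 8).
  { eapply Rle_trans; [|exact H4].
    replace (B / (y * T ^ 2) ^ 2 * (x * T ^ 2 - y * T ^ 2)) with (B / y ^ 2 * (x - y) / T ^ 2)
      by (field; split; lra).
    unfold Z, Rdiv. apply Rmult_le_compat.
    - apply Rmult_le_pos; [apply Rmult_le_pos; auto; left; now apply Rinv_0_lt_compat|lra].
    - left; apply Rinv_0_lt_compat; lra.
    - apply Rmult_le_compat_l; [|lra]. apply Rmult_le_pos; auto. left; now apply Rinv_0_lt_compat.
    - apply Rinv_le_contravar; lra. }
  assert (SS : (csum (fun k => h (x * (INR k + 1) ^ 2)%R * RtoC (/ (INR k + 1))) (S N)
     - csum (fun k => h (y * (INR k + 1) ^ 2)%R * RtoC (/ (INR k + 1))) (S N))%C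
     = (csum (fun k => W x (INR k + 1)) (S N) - csum (fun k => W y (INR k + 1)) (S N))%C).
  { rewrite <- !csum_minus. apply csum_ext. intros k _. unfold W, profile. ring. }
  set (Sx := csum (fun k => h (x * (INR k + 1) ^ 2)%R * RtoC (/ (INR k + 1)))%C (S N)) in *.
  set (Sy := csum (fun k => h (y * (INR k + 1) ^ 2)%R * RtoC (/ (INR k + 1)))%C (S N)) in *.
  set (Wx := csum (fun k => W x (INR k + 1)) (S N)) in *.
  set (Wy := csum (fun k => W y (INR k + 1)) (S N)) in *.
  set (Gx := CI g (4 * x) (x * T ^ 2)) in *. set (Gy := CI g (4 * y) (y * T ^ 2)) in *.
  set (Gf := CI g (y * T ^ 2) (x * T ^ 2)) in *. set (Gn := CI g (4 * y) (4 * x)) in *.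
  replace (P x + c0 * RtoC (/ 2 * ln x) - (P y + c0 * RtoC (/ 2 * ln y)))%C with
    ((- (Sx - P x) + (Sy - P y)) + (((Wx - RtoC (/ 2) * Gx) + - (Wy - RtoC (/ 2) * Gy))
      + (RtoC (/ 2) * (Gf + c0 * RtoC (ln x - ln y)) + - (RtoC (/ 2) * Gn))))%C.
  2:{ rewrite !RtoC_mult, RtoC_minus.
      transitivity ((P x - P y) - (Sx - Sy) + (Wx - Wy) - RtoC (/ 2) * (Gx - Gy)
        + RtoC (/ 2) * (Gf - Gn) + c0 * RtoC (/ 2) * (RtoC (ln x) - RtoC (ln y)))%C; [ring|].
      rewrite SS, G1. ring. }
  eapply Rle_trans; [apply Cmod_triangle|].
  eapply Rle_trans; [apply Rplus_le_compat; [apply Cmod_triangle|apply Cmod_triangle]|].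
  eapply Rle_trans; [apply Rplus_le_compat_l, Rplus_le_compat; apply Cmod_triangle|].
  rewrite !Cmod_opp, !Cmod_mult, !Cmod_R, !(Rabs_right (/ 2)) by lra.
  nra.
Qed.

Theorem diagonal_sum_asymptotic : exists c2, forall x, 0 < x ->
  Cmod (P x - (c2 - c0 * RtoC (/ 2 * ln x))) <= (8 * A0 + 2 * Aq) * Rpower x (3 / 2).
Proof.
  destruct (limit_at_0 (fun x => P x + c0 * RtoC (/ 2 * ln x))%C (8 * A0 + 2 * Aq)) as [c2 H2].
  - intros x y Hx Hy. destruct (Rle_dec y x) as [H|H].
    + apply diagonal_sum_osc; lra.
    + rewrite (Rplus_comm (Rpower x (3 / 2))).
      match goal with |- Cmod (?a - ?b) <= _ => replace (a - b)%C with (- (b - a))%C by ring end.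
      rewrite Cmod_opp. apply diagonal_sum_osc; lra.
  - exists c2. intros x Hx. specialize (H2 x Hx).
    now replace (P x - (c2 - c0 * RtoC (/ 2 * ln x)))%C
      with (P x + c0 * RtoC (/ 2 * ln x) - c2)%C by ring.
Qed.

End DiagonalSum.

(** * Unordered sums *)

Definition lsum {I} (u : I -> C) (l : list I) : C :=
  fold_right (fun i s => (u i + s)%C) (RtoC 0) l.

Definition rlsum {I} (u : I -> R) (l : list I) : R :=
  fold_right (fun i s => u i + s) 0 l.

(** Convergence along finite subsets, represented by lists without duplicates. It is invariant under
    bijections of the index set, which is how pairs [(m, n)] are exchanged for [(m, l)] or
    [(l, n)]. *)
Definition usum {I} (u : I -> C) (S : C) : Prop :=
  forall e, 0 < e -> exists A, forall B, NoDup B -> incl A B -> Cmod (lsum u B - S) <= e.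

Definition abs_bounded {I} (u : I -> C) (K : R) : Prop :=
  forall B, NoDup B -> rlsum (fun i => Cmod (u i)) B <= K.

Lemma lsum_app {I} (u : I -> C) l l' : lsum u (l ++ l') = (lsum u l + lsum u l')%C.
Proof. induction l as [|i l IH]; simpl; [ring|rewrite IH; ring]. Qed.

Lemma rlsum_app {I} (u : I -> R) l l' : rlsum u (l ++ l') = rlsum u l + rlsum u l'.
Proof. induction l as [|i l IH]; simpl; [ring|rewrite IH; ring]. Qed.

Lemma lsum_zero {I} (u : I -> C) l : (forall i, In i l -> u i = RtoC 0) -> lsum u l = RtoC 0.
Proof.
  induction l as [|i l IH]; simpl; intros H; auto. rewrite H, IH by auto. ring.
Qed.

Lemma Cmod_lsum_le {I} (u : I -> C) l : Cmod (lsum u l) <= rlsum (fun i => Cmod (u i)) l.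
Proof.
  induction l as [|i l IH]; simpl; [rewrite Cmod_0; lra|].
  eapply Rle_trans; [apply Cmod_triangle|]. lra.
Qed.

Lemma rlsum_le {I} (u v : I -> R) l : (forall i, In i l -> u i <= v i) ->
  rlsum u l <= rlsum v l.
Proof.
  induction l as [|i l IH]; simpl; intros H; [lra|]. apply Rplus_le_compat; auto.
Qed.

Lemma rlsum_nonneg {I} (u : I -> R) l : (forall i, 0 <= u i) -> 0 <= rlsum u l.
Proof. intros H; induction l as [|i l IH]; simpl; [lra|]. specialize (H i); lra. Qed.

Lemma rlsum_incl {I} (u : I -> R) B : (forall i, 0 <= u i) -> NoDup B ->
  forall L, incl B L -> rlsum u B <= rlsum u L.
Proof.
  intros Hu. induction 1 as [|b B Hb HB IH]; intros L HL.
  - now apply rlsum_nonneg.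
  - destruct (in_split b L (HL b (or_introl eq_refl))) as [L1 [L2 ->]].
    assert (Hi : incl B (L1 ++ L2)).
    { intros x Hx. specialize (HL x (or_intror Hx)). rewrite in_app_iff in *. simpl in HL.
      destruct HL as [H|[H|H]]; auto. subst x; contradiction. }
    specialize (IH _ Hi). rewrite rlsum_app in *. simpl. lra.
Qed.

Lemma rlsum_scal {I} c (u : I -> R) l : rlsum (fun i => c * u i) l = c * rlsum u l.
Proof. induction l as [|i l IH]; simpl; [ring|]. rewrite IH. ring. Qed.

Lemma nodup_cover {I} (A : list I) : exists B, NoDup B /\ incl A B /\ incl B A.
Proof.
  exists (nodup (fun x y => excluded_middle_informative (x = y)) A).
  split; [apply NoDup_nodup|]. split; intros x Hx; now apply (nodup_In _ A x) in Hx || apply nodup_In.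
Qed.

Lemma usum_unique {I} (u : I -> C) S T : usum u S -> usum u T -> S = T.
Proof.
  intros HS HT. enough (Cmod (S - T) <= 0).
  { assert (E : (S - T)%C = RtoC 0) by (apply Cmod_eq_0; pose proof (Cmod_ge_0 (S - T)); lra).
    replace S with ((S - T) + T)%C by ring. rewrite E. ring. }
  apply le_epsilon. intros e He.
  destruct (HS (e / 2) ltac:(lra)) as [A HA]. destruct (HT (e / 2) ltac:(lra)) as [A' HA'].
  destruct (nodup_cover (A ++ A')) as [B [HB [HAB _]]].
  specialize (HA B HB (fun x Hx => HAB x (in_or_app _ _ _ (or_introl Hx)))).
  specialize (HA' B HB (fun x Hx => HAB x (in_or_app _ _ _ (or_intror Hx)))).
  replace (S - T)%C with (- (lsum u B - S) + (lsum u B - T))%C by ring.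
  eapply Rle_trans; [apply Cmod_triangle|]. rewrite Cmod_opp. lra.
Qed.

Lemma usum_ext {I} (u v : I -> C) S : (forall i, u i = v i) -> usum u S -> usum v S.
Proof.
  intros E H e He. destruct (H e He) as [A HA]. exists A. intros B HB HAB.
  replace (lsum v B) with (lsum u B); auto.
  clear -E. induction B as [|b B IH]; simpl; auto. now rewrite IH, E.
Qed.

Lemma usum_plus {I} (u v : I -> C) S T : usum u S -> usum v T ->
  usum (fun i => u i + v i)%C (S + T)%C.
Proof.
  intros HS HT e He.
  destruct (HS (e / 2) ltac:(lra)) as [A HA]. destruct (HT (e / 2) ltac:(lra)) as [A' HA'].
  exists (A ++ A'). intros B HB HAB.
  specialize (HA B HB (fun x Hx => HAB x (in_or_app _ _ _ (or_introl Hx)))).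
  specialize (HA' B HB (fun x Hx => HAB x (in_or_app _ _ _ (or_intror Hx)))).
  replace (lsum (fun i => u i + v i)%C B) with (lsum u B + lsum v B)%C.
  - replace (lsum u B + lsum v B - (S + T))%C with ((lsum u B - S) + (lsum v B - T))%C by ring.
    eapply Rle_trans; [apply Cmod_triangle|]. lra.
  - clear. induction B as [|b B IH]; simpl; [ring|]. rewrite <- IH. ring.
Qed.

Lemma usum_scal {I} (c : C) (u : I -> C) S : usum u S -> usum (fun i => c * u i)%C (c * S)%C.
Proof.
  intros HS e He. pose proof (Cmod_ge_0 c) as Pc.
  destruct (HS (e / (Cmod c + 1)) ltac:(apply Rdiv_lt_0_compat; lra)) as [A HA].
  exists A. intros B HB HAB. specialize (HA B HB HAB).
  replace (lsum (fun i => c * u i)%C B) with (c * lsum u B)%C.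
  - replace (c * lsum u B - c * S)%C with (c * (lsum u B - S))%C by ring. rewrite Cmod_mult.
    apply Rle_trans with ((Cmod c + 1) * (e / (Cmod c + 1))).
    + apply Rmult_le_compat; try lra. apply Cmod_ge_0.
    + right. field. lra.
  - clear. induction B as [|b B IH]; simpl; [ring|]. rewrite <- IH. ring.
Qed.

Lemma usum_minus {I} (u v : I -> C) S T : usum u S -> usum v T ->
  usum (fun i => u i - v i)%C (S - T)%C.
Proof.
  intros HS HT. apply usum_ext with (fun i => u i + RtoC (- (1)) * v i)%C.
  - intros i. rewrite RtoC_opp. ring.
  - replace (S - T)%C with (S + RtoC (- (1)) * T)%C by (rewrite RtoC_opp; ring).
    apply usum_plus; auto. now apply usum_scal.
Qed.

Lemma usum_le {I} (u : I -> C) S K : usum u S -> abs_bounded u K -> Cmod S <= K.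
Proof.
  intros HS HK. apply le_epsilon. intros e He. destruct (HS e He) as [A HA].
  destruct (nodup_cover A) as [B [HB [HAB _]]]. specialize (HA B HB HAB). specialize (HK B HB).
  replace S with (- (lsum u B - S) + lsum u B)%C by ring.
  eapply Rle_trans; [apply Cmod_triangle|]. rewrite Cmod_opp.
  pose proof (Cmod_lsum_le u B). lra.
Qed.

Lemma usum_nonneg_ex {I} (v : I -> R) K : (forall i, 0 <= v i) ->
  (forall B, NoDup B -> rlsum v B <= K) -> exists s : R, usum (fun i => RtoC (v i)) (RtoC s).
Proof.
  intros Hv HK.
  destruct (completeness (fun y => exists B, NoDup B /\ y = rlsum v B)) as [s [Hs1 Hs2]].
  - exists K. intros y [B [HB ->]]. auto.
  - exists 0, nil. split; [constructor|reflexivity].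
  - exists s. intros e He.
    assert (HA : exists A, NoDup A /\ s - e < rlsum v A).
    { apply NNPP. intros N. assert (s <= s - e); [|lra]. apply Hs2. intros y [B [HB ->]].
      apply Rnot_lt_le. intros Hlt. apply N. exists B; auto. }
    destruct HA as [A [HA1 HA2]]. exists A. intros B HB HAB.
    replace (lsum (fun i => RtoC (v i)) B) with (RtoC (rlsum v B)).
    + rewrite <- RtoC_minus, Cmod_R.
      assert (rlsum v B <= s) by (apply Hs1; eauto).
      assert (rlsum v A <= rlsum v B) by now apply rlsum_incl.
      rewrite Rabs_left1; lra.
    + clear. induction B as [|b B IH]; simpl; auto. now rewrite RtoC_plus, IH.
Qed.

(** Each component [g] is written as [(|u| + g u) - |u|], a difference of nonnegative families,
    whose sums are suprema. *)
Lemma usum_ex {I} (u : I -> C) K : abs_bounded u K -> exists S, usum u S.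
Proof.
  intros HK.
  assert (G : forall g : C -> R, (forall z, Rabs (g z) <= Cmod z) ->
    exists s : R, usum (fun i => RtoC (g (u i))) (RtoC s)).
  { intros g Hg.
    assert (Hb : forall z, - Cmod z <= g z <= Cmod z) by (intros z; apply Rabs_le_between, Hg).
    destruct (usum_nonneg_ex (fun i => Cmod (u i)) K) as [s1 H1]; auto.
    { intros; apply Cmod_ge_0. }
    destruct (usum_nonneg_ex (fun i => Cmod (u i) + g (u i)) (2 * K)) as [s2 H2].
    { intros i. specialize (Hb (u i)). lra. }
    { intros B HB. specialize (HK B HB).
      apply Rle_trans with (2 * rlsum (fun i => Cmod (u i)) B); [|lra].
      clear -Hb. induction B as [|b B IH]; simpl; [lra|]. specialize (Hb (u b)). lra. }
    exists (s2 - s1). rewrite RtoC_minus.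
    apply usum_ext with (fun i => RtoC (Cmod (u i) + g (u i)) - RtoC (Cmod (u i)))%C.
    - intros i. rewrite RtoC_plus. ring.
    - now apply usum_minus. }
  destruct (G Re re_le_Cmod) as [s1 H1]. destruct (G Im im_le_Cmod) as [s2 H2].
  exists (RtoC s1 + Ci * RtoC s2)%C.
  apply usum_ext with (fun i => RtoC (Re (u i)) + Ci * RtoC (Im (u i)))%C.
  - intros i. destruct (u i). apply injective_projections; simpl; ring.
  - apply usum_plus; auto. now apply usum_scal.
Qed.

Lemma lsum_filter {I} (u : I -> C) (U : I -> Prop) l : (forall i, ~ U i -> u i = RtoC 0) ->
  lsum u (filter (fun i => if excluded_middle_informative (U i) then true else false) l) = lsum u l.
Proof.
  intros H. induction l as [|i l IH]; simpl; auto.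
  destruct (excluded_middle_informative (U i)) as [Hi|Hi]; simpl; rewrite IH; auto.
  rewrite H by auto. ring.
Qed.

Lemma NoDup_map_on {I J} (phi : I -> J) (l : list I) :
  (forall i i', In i l -> In i' l -> phi i = phi i' -> i = i') -> NoDup l -> NoDup (map phi l).
Proof.
  intros Hinj H. induction H as [|i l Hi Hl IH]; simpl; constructor.
  - rewrite in_map_iff. intros [i' [E Hi']]. apply Hi.
    rewrite (Hinj i i'); simpl; auto.
  - apply IH. intros; apply Hinj; simpl; auto.
Qed.

(** [phi] is a bijection between [U] and [V], outside of which the families vanish. A finite set of
    [J] is pulled back to [U] and compared with the sum over [I]. *)
Lemma usum_reindex {I J} (U : I -> Prop) (V : J -> Prop) (phi : I -> J)
  (u : I -> C) (v : J -> C) S :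
  (forall i, ~ U i -> u i = RtoC 0) -> (forall j, ~ V j -> v j = RtoC 0) ->
  (forall i, U i -> V (phi i) /\ v (phi i) = u i) ->
  (forall i i', U i -> U i' -> phi i = phi i' -> i = i') ->
  (forall j, V j -> exists i, U i /\ phi i = j) ->
  usum u S -> usum v S.
Proof.
  intros Hu Hv HUV Hinj Hsurj HS e He. destruct (HS e He) as [A HA].
  set (fU := filter (fun i => if excluded_middle_informative (U i) then true else false)).
  set (fV := filter (fun j => if excluded_middle_informative (V j) then true else false)).
  assert (InU : forall l i, In i (fU l) <-> In i l /\ U i).
  { intros l i. unfold fU. rewrite filter_In.
    destruct (excluded_middle_informative (U i)); intuition discriminate. }
  assert (InV : forall l j, In j (fV l) <-> In j l /\ V j).
  { intros l i. unfold fV. rewrite filter_In.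
    destruct (excluded_middle_informative (V i)); intuition discriminate. }
  exists (map phi (fU A)). intros B HB HAB.
  assert (Pre : forall l, NoDup l -> (forall j, In j l -> V j) ->
    exists k, NoDup k /\ (forall i, In i k <-> U i /\ In (phi i) l) /\ lsum u k = lsum v l).
  { induction l as [|j l IH]; intros Hl HV.
    - exists nil. split; [constructor|]. split; [|reflexivity]. simpl; tauto.
    - inversion Hl as [|? ? Nj Nl]; subst.
      destruct (IH Nl (fun j' H => HV j' (or_intror H))) as [k [Hk1 [Hk2 Hk3]]].
      destruct (Hsurj j (HV j (or_introl eq_refl))) as [i [Ui Ei]].
      exists (i :: k). split; [|split].
      + constructor; auto. rewrite Hk2, Ei. tauto.
      + intros i'. simpl. rewrite Hk2. split.
        * intros [<-|[H1 H2]]; auto.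
        * intros [H1 [H2|H2]]; [|auto]. left. apply Hinj; auto. congruence.
      + simpl. rewrite Hk3. f_equal. rewrite <- Ei. symmetry. now apply HUV. }
  assert (NfV : NoDup (fV B)) by now apply NoDup_filter.
  destruct (Pre (fV B) NfV (fun j Hj => proj2 (proj1 (InV B j) Hj))) as [k [Hk1 [Hk2 Hk3]]].
  (* The pulled-back list lies in [U] and may miss part of [A]. The points of [A] outside [U] are
     appended; their terms are 0. *)
  destruct (nodup_cover (filter (fun i => if excluded_middle_informative (U i) then false else true) A))
    as [A2 [NA2 [HA21 HA22]]].
  assert (NU2 : forall i, In i A2 -> ~ U i).
  { intros i Hi. apply HA22 in Hi. rewrite filter_In in Hi.
    destruct (excluded_middle_informative (U i)); intuition discriminate. }
  assert (NK : NoDup (k ++ A2)).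
  { apply NoDup_app; auto. intros i Hi Hi2. apply (NU2 i Hi2). now apply Hk2 in Hi. }
  assert (IK : incl A (k ++ A2)).
  { intros i Hi. apply in_or_app. destruct (excluded_middle_informative (U i)) as [Ui|Ui].
    - left. apply Hk2. split; auto. apply InV. split; [|now apply HUV].
      apply HAB, in_map, InU. auto.
    - right. apply HA21. rewrite filter_In. split; auto.
      destruct (excluded_middle_informative (U i)); auto; contradiction. }
  specialize (HA _ NK IK). rewrite lsum_app, (lsum_zero u A2) in HA by auto.
  rewrite Hk3 in HA. unfold fV in HA. rewrite lsum_filter in HA by auto.
  now replace (lsum v B + 0 - S)%C with (lsum v B - S)%C in HA by ring.
Qed.

(** * Domination by a summable family of pairs *)

Definition dominant (p : nat * nat) : R :=
  / ((INR (fst p) + 1) ^ 2 * (INR (snd p) + 1) ^ 2).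

Lemma dominant_pos p : 0 < dominant p.
Proof.
  unfold dominant. apply Rinv_0_lt_compat. pose proof (pos_INR (fst p)).
  pose proof (pos_INR (snd p)). apply Rmult_lt_0_compat; apply pow_lt; lra.
Qed.

Lemma sum_inverse_squares n : rlsum (fun k => / (INR k + 1) ^ 2) (seq 0 n) <= 2.
Proof.
  assert (B : rlsum (fun k => / (INR k + 1) ^ 2) (seq 0 n) <= 2 - 2 * / (INR n + 1)).
  { induction n as [|n IH].
    - simpl. rewrite Rplus_0_l, Rinv_1. lra.
    - rewrite seq_S, rlsum_app, Nat.add_0_l. cbn [rlsum fold_right].
      rewrite S_INR. pose proof (pos_INR n) as Pn. set (x := INR n) in *.
      assert (E : 2 - 2 * / (x + 1 + 1) - (2 - 2 * / (x + 1) + / (x + 1) ^ 2)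
         = x / ((x + 1) ^ 2 * (x + 1 + 1))) by (field; lra).
      assert (0 <= x / ((x + 1) ^ 2 * (x + 1 + 1))).
      { apply Rmult_le_pos; auto. left. apply Rinv_0_lt_compat.
        apply Rmult_lt_0_compat; [apply pow_lt|]; lra. }
      lra. }
  pose proof (pos_INR n). assert (0 < / (INR n + 1)) by (apply Rinv_0_lt_compat; lra). lra.
Qed.

Lemma nat_list_bound (B : list nat) : exists N, forall x, In x B -> (x < N)%nat.
Proof.
  induction B as [|b B [N HN]]; [exists O; simpl; tauto|].
  exists (S (b + N)). intros x [->|H]; [lia|]. specialize (HN x H). lia.
Qed.

Lemma pair_list_bound (B : list (nat * nat)) :
  exists N, incl B (list_prod (seq 0 N) (seq 0 N)).
Proof.
  destruct (nat_list_bound (map fst B ++ map snd B)) as [N HN]. exists N.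
  intros [i j] Hp. apply in_prod; apply in_seq; split; try lia; apply HN; apply in_or_app.
  - left. now apply (in_map fst) in Hp.
  - right. now apply (in_map snd) in Hp.
Qed.

(** A finite set of pairs lies in a square, where the sum factors into two sums of inverse squares,
    each at most 2. *)
Lemma rlsum_dominant B : NoDup B -> rlsum dominant B <= 4.
Proof.
  intros HB. destruct (pair_list_bound B) as [N HN].
  eapply Rle_trans; [apply rlsum_incl; [intros; left; apply dominant_pos|exact HB|exact HN]|].
  pose proof (sum_inverse_squares N) as H2. set (L := seq 0 N) in *.
  assert (E : forall l, rlsum dominant (list_prod l L)
     = rlsum (fun k => / (INR k + 1) ^ 2) l * rlsum (fun k => / (INR k + 1) ^ 2) L).
  { induction l as [|x l IH]; [cbn; ring|].
    change (list_prod (x :: l) L) with (map (fun y => (x, y)) L ++ list_prod l L).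
    rewrite rlsum_app, IH.
    change (rlsum (fun k => / (INR k + 1) ^ 2) (x :: l))
      with (/ (INR x + 1) ^ 2 + rlsum (fun k => / (INR k + 1) ^ 2) l). clear.
    assert (H : rlsum dominant (map (fun y => (x, y)) L)
       = / (INR x + 1) ^ 2 * rlsum (fun k => / (INR k + 1) ^ 2) L).
    { induction L as [|y L IH]; [cbn; ring|].
      change (dominant (x, y) + rlsum dominant (map (fun y => (x, y)) L)
        = / (INR x + 1) ^ 2 * (/ (INR y + 1) ^ 2 + rlsum (fun k => / (INR k + 1) ^ 2) L)).
      rewrite IH. unfold dominant at 1; cbn [fst snd].
      pose proof (pos_INR x). pose proof (pos_INR y). field. lra. }
    rewrite H. ring. }
  rewrite E.
  assert (0 <= rlsum (fun k => / (INR k + 1) ^ 2) L).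
  { apply rlsum_nonneg. intros i. left. apply Rinv_0_lt_compat, pow_lt.
    pose proof (pos_INR i). lra. }
  nra.
Qed.

(** Only injectivity of [phi] on the support matters. This lets the points of a residue class be
    counted by the block of length [a] that contains them. *)
Lemma abs_bounded_dominant {I} (U : I -> Prop) (phi : I -> nat * nat) (u : I -> C) K :
  0 <= K -> (forall i, ~ U i -> u i = RtoC 0) ->
  (forall i i', U i -> U i' -> phi i = phi i' -> i = i') ->
  (forall i, U i -> Cmod (u i) <= K * dominant (phi i)) -> abs_bounded u (4 * K).
Proof.
  intros HK H0 Hinj Hd B HB.
  set (BU := filter (fun i => if excluded_middle_informative (U i) then true else false) B).
  assert (InU : forall i, In i BU -> U i).
  { intros i. unfold BU. rewrite filter_In.
    destruct (excluded_middle_informative (U i)); intuition discriminate. }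
  assert (E : rlsum (fun i => Cmod (u i)) B = rlsum (fun i => Cmod (u i)) BU).
  { unfold BU. clear -H0. induction B as [|i B IH]; simpl; auto.
    destruct (excluded_middle_informative (U i)) as [Hi|Hi]; simpl; rewrite IH; auto.
    rewrite H0, Cmod_0 by auto. ring. }
  rewrite E. eapply Rle_trans; [apply rlsum_le; intros i Hi; apply Hd, InU, Hi|].
  assert (M : rlsum (fun i => K * dominant (phi i)) BU = K * rlsum dominant (map phi BU)).
  { clear. induction BU as [|i l IH]; simpl; [ring|]. rewrite IH. ring. }
  rewrite M.
  assert (rlsum dominant (map phi BU) <= 4).
  { apply rlsum_dominant. apply NoDup_map_on; [|now apply NoDup_filter].
    intros i i' Hi Hi'. apply Hinj; auto. }
  nra.
Qed.

Lemma abs_bounded_dominant_id (u : nat * nat -> C) K : 0 <= K ->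
  (forall p, Cmod (u p) <= K * dominant p) -> abs_bounded u (4 * K).
Proof.
  intros HK H. apply abs_bounded_dominant with (U := fun _ => True) (phi := fun p => p); auto.
  intros i N. now elim N.
Qed.

Lemma usum_compare {I} (u v : I -> C) S T K : usum u S -> usum v T ->
  abs_bounded (fun i => u i - v i)%C K -> Cmod (S - T) <= K.
Proof. intros HS HT HK. eapply usum_le; [|exact HK]. now apply usum_minus. Qed.

(** * Iterated series *)

Definition climit (s : nat -> C) (S : C) : Prop :=
  forall e, 0 < e -> exists N0, forall N, (N0 <= N)%nat -> Cmod (s N - S) <= e.

Lemma climit_unique s S T : climit s S -> climit s T -> S = T.
Proof.
  intros HS HT. enough (Cmod (S - T) <= 0).
  { assert (E : (S - T)%C = RtoC 0) by (apply Cmod_eq_0; pose proof (Cmod_ge_0 (S - T)); lra).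
    replace S with ((S - T) + T)%C by ring. rewrite E. ring. }
  apply le_epsilon. intros e He.
  destruct (HS (e / 2) ltac:(lra)) as [N1 H1]. destruct (HT (e / 2) ltac:(lra)) as [N2 H2].
  specialize (H1 (N1 + N2)%nat ltac:(lia)). specialize (H2 (N1 + N2)%nat ltac:(lia)).
  replace (S - T)%C with (- (s (N1 + N2)%nat - S) + (s (N1 + N2)%nat - T))%C by ring.
  eapply Rle_trans; [apply Cmod_triangle|]. rewrite Cmod_opp. lra.
Qed.

(** [csum] takes the number of terms, [sum_n] the last index; hence the shift. *)
Lemma csum_components u n : csum u (S n) = (sum_n (fun k => Re (u k)) n, sum_n (fun k => Im (u k)) n).
Proof.
  induction n as [|n IH].
  - rewrite !sum_O. simpl. destruct (u O). apply injective_projections; simpl; ring.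
  - rewrite !sum_Sn. cbn [csum] in *. rewrite IH. unfold plus; simpl.
    destruct (u (S n)). apply injective_projections; simpl; ring.
Qed.

Lemma climit_CSeries u S : climit (csum u) S -> CSeries u = S.
Proof.
  intros H.
  assert (G : forall (p : C -> R), (forall z w, Rabs (p z - p w) <= Cmod (z - w)) ->
     forall v, (forall n, p (csum u (Datatypes.S n)) = sum_n v n) -> Series v = p S).
  { intros p Hp v Hv. apply is_series_unique.
    apply (filterlim_locally (F := eventually) (sum_n v) (p S)). intros e.
    destruct (H (e / 2)) as [N0 HN].
    { pose proof (cond_pos e); lra. }
    exists N0. intros n Hn. rewrite <- Hv.
    change (Rabs (p (csum u (Datatypes.S n)) - p S) < e). eapply Rle_lt_trans; [apply Hp|].
    eapply Rle_lt_trans; [apply HN; lia|]. pose proof (cond_pos e); lra. }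
  unfold CSeries. rewrite (surjective_pairing S). f_equal.
  - apply (G Re); [exact (fun z w => re_le_Cmod (z - w))|].
    intros n. now rewrite csum_components.
  - apply (G Im); [exact (fun z w => im_le_Cmod (z - w))|].
    intros n. now rewrite csum_components.
Qed.

Lemma csum_lsum u n : csum u n = lsum u (seq 0 n).
Proof.
  induction n as [|n IH]; [reflexivity|]. rewrite seq_S, lsum_app, <- IH, Nat.add_0_l. simpl. ring.
Qed.

Lemma usum_climit (u : nat -> C) S : usum u S -> climit (csum u) S.
Proof.
  intros H e He. destruct (H e He) as [A HA]. destruct (nat_list_bound A) as [N0 HN0].
  exists N0. intros N HN. rewrite csum_lsum. apply HA; [apply seq_NoDup|].
  intros x Hx. apply in_seq. specialize (HN0 x Hx). lia.
Qed.

Lemma usum_CSeries (u : nat -> C) S : usum u S -> CSeries u = S.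
Proof. intros H. now apply climit_CSeries, usum_climit. Qed.

Lemma lsum_prod (u : nat * nat -> C) l M :
  lsum u (list_prod l (seq 0 M)) = lsum (fun i => csum (fun j => u (i, j)) M) l.
Proof.
  induction l as [|i l IH]; simpl; auto. rewrite lsum_app, IH. f_equal.
  rewrite csum_lsum. generalize (seq 0 M) as k. induction k as [|j k IHk]; simpl; auto.
  now rewrite IHk.
Qed.

Lemma NoDup_list_prod_seq N M : NoDup (list_prod (seq 0 N) (seq 0 M)).
Proof.
  assert (H := seq_NoDup N 0). induction H as [|i l Hi Hl IH]; [constructor|].
  change (list_prod (i :: l) (seq 0 M)) with (map (fun y => (i, y)) (seq 0 M) ++ list_prod l (seq 0 M)).
  apply NoDup_app; auto.
  - apply NoDup_map_on; [congruence|apply seq_NoDup].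
  - intros p Hp Hp'. apply in_map_iff in Hp. destruct Hp as [j [<- _]].
    apply in_prod_iff in Hp'. tauto.
Qed.

Section Iterated.

Context (u : nat -> nat -> C) (K : R) (HK : 0 <= K)
  (Hdom : forall i j, Cmod (u i j) <= K * dominant (i, j)).

Lemma row_dominant i j : Cmod (u i j) <= K / (INR i + 1) ^ 2 * / (INR j + 1) ^ 2.
Proof.
  eapply Rle_trans; [apply Hdom|]. right. unfold dominant; cbn [fst snd].
  pose proof (pos_INR i). pose proof (pos_INR j). field. lra.
Qed.

Lemma ex_series_inverse_squares : ex_series (fun j => / (INR j + 1) ^ 2).
Proof.
  assert (P : forall j, 0 < / (INR j + 1) ^ 2).
  { intros j. pose proof (pos_INR j). apply Rinv_0_lt_compat, pow_lt. lra. }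
  destruct (ex_finite_lim_seq_incr (sum_n (fun j => / (INR j + 1) ^ 2)) 2) as [l Hl].
  - intros n. rewrite sum_Sn. unfold plus; simpl. specialize (P (S n)). simpl in P. lra.
  - intros n. eapply Rle_trans; [|apply (sum_inverse_squares (S n))]. right.
    induction n as [|n IH].
    + rewrite sum_O. cbn. ring.
    + rewrite sum_Sn, IH. rewrite (seq_S (S n)), rlsum_app. unfold plus; simpl. ring.
  - exists l. exact Hl.
Qed.

Lemma row_abs_bounded i : abs_bounded (u i) (2 * (K / (INR i + 1) ^ 2)).
Proof.
  intros B HB. destruct (nat_list_bound B) as [N HN].
  assert (P : 0 <= K / (INR i + 1) ^ 2).
  { pose proof (pos_INR i). apply Rmult_le_pos; auto. left. apply Rinv_0_lt_compat, pow_lt. lra. }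
  apply Rle_trans with (rlsum (fun j => K / (INR i + 1) ^ 2 * / (INR j + 1) ^ 2) (seq 0 N)).
  - eapply Rle_trans; [apply rlsum_le; intros j _; apply row_dominant|].
    apply rlsum_incl; auto.
    + intros j. apply Rmult_le_pos; auto. left. apply Rinv_0_lt_compat, pow_lt.
      pose proof (pos_INR j). lra.
    + intros j Hj. apply in_seq. specialize (HN j Hj). lia.
  - replace (rlsum (fun j => K / (INR i + 1) ^ 2 * / (INR j + 1) ^ 2) (seq 0 N))
      with (K / (INR i + 1) ^ 2 * rlsum (fun j => / (INR j + 1) ^ 2) (seq 0 N)).
    + pose proof (sum_inverse_squares N). nra.
    + symmetry. apply (rlsum_scal (K / (INR i + 1) ^ 2) (fun j => / (INR j + 1) ^ 2)).
Qed.

Lemma row_climit i : climit (csum (u i)) (CSeries (u i)).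
Proof.
  destruct (usum_ex _ _ (row_abs_bounded i)) as [S HS].
  rewrite (usum_CSeries _ _ HS). now apply usum_climit.
Qed.

Lemma ex_series_row i : ex_series (fun j => Cmod (u i j)).
Proof.
  apply (ex_series_le (K := R_AbsRing) (V := R_CompleteNormedModule) _
    (fun j => K / (INR i + 1) ^ 2 * / (INR j + 1) ^ 2)).
  - intros j. unfold norm; simpl; unfold abs; simpl. rewrite Rabs_right by (apply Rle_ge, Cmod_ge_0).
    apply row_dominant.
  - exact (ex_series_scal (V := R_NormedModule) (K / (INR i + 1) ^ 2) _ ex_series_inverse_squares).
Qed.

Lemma dominated_double_abs_summable : double_abs_summable u.
Proof.
  split; [exact ex_series_row|].
  set (L := Series (fun j => / (INR j + 1) ^ 2)).
  apply (ex_series_le (K := R_AbsRing) (V := R_CompleteNormedModule) _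
    (fun i => K * L * / (INR i + 1) ^ 2)).
  - intros i. unfold norm; simpl; unfold abs; simpl.
    assert (Hs : Series (fun j => Cmod (u i j))
       <= Series (fun j => K / (INR i + 1) ^ 2 * / (INR j + 1) ^ 2)).
    { apply Series_le.
      - intros j. split; [apply Cmod_ge_0|apply row_dominant].
      - exact (ex_series_scal (V := R_NormedModule) (K / (INR i + 1) ^ 2) _ ex_series_inverse_squares). }
    rewrite Series_scal_l in Hs. fold L in Hs.
    assert (Hp : 0 <= Series (fun j => Cmod (u i j))).
    { rewrite <- (Rmult_0_l (Series (fun _ => 0))), <- Series_scal_l.
      apply Series_le; [intros j; pose proof (Cmod_ge_0 (u i j)); lra|apply ex_series_row]. }
    rewrite Rabs_right by lra. eapply Rle_trans; [exact Hs|].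
    right. pose proof (pos_INR i). field. lra.
  - exact (ex_series_scal (V := R_NormedModule) (K * L) _ ex_series_inverse_squares).
Qed.

(** Links unordered sums with the iterated series that defines [S_sum]: a large rectangle contains
    any prescribed finite set, and its row sums approximate the inner series. *)
Theorem usum_iterated :
  usum (fun p => u (fst p) (snd p)) (CSeries (fun i => CSeries (fun j => u i j))).
Proof.
  set (v := fun p : nat * nat => u (fst p) (snd p)).
  assert (HB : abs_bounded v (4 * K)).
  { apply abs_bounded_dominant_id; auto. intros [i j]. apply Hdom. }
  destruct (usum_ex v _ HB) as [S HS].
  replace (CSeries (fun i => CSeries (fun j => u i j))) with S; auto. symmetry.
  apply climit_CSeries. intros e He. destruct (HS (e / 2) ltac:(lra)) as [A HA].
  destruct (pair_list_bound A) as [N0 HN0]. exists N0. intros N HN.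
  (* For finitely many rows the inner limits can be taken together, so a single width [M] serves all
     of them. *)
  assert (L : forall l, climit (fun M => lsum (fun i => csum (u i) M) l)
     (lsum (fun i => CSeries (u i)) l)).
  { induction l as [|i l IH].
    - intros d Hd. exists O. intros M _. simpl.
      replace (0 - 0)%C with (RtoC 0) by ring. rewrite Cmod_0. lra.
    - intros d Hd. destruct (IH (d / 2) ltac:(lra)) as [M1 H1].
      destruct (row_climit i (d / 2) ltac:(lra)) as [M2 H2].
      exists (M1 + M2)%nat. intros M HM. specialize (H1 M ltac:(lia)). specialize (H2 M ltac:(lia)).
      simpl. match goal with |- Cmod (?a + ?b - (?c + ?d)) <= _ =>
        replace (a + b - (c + d))%C with ((a - c) + (b - d))%C by ring end.
      eapply Rle_trans; [apply Cmod_triangle|]. lra. }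
  destruct (L (seq 0 N) (e / 2) ltac:(lra)) as [M0 HM0].
  set (M := (M0 + N0)%nat). specialize (HM0 M ltac:(unfold M; lia)).
  rewrite csum_lsum.
  assert (R1 : Cmod (lsum v (list_prod (seq 0 N) (seq 0 M)) - S) <= e / 2).
  { apply HA; [apply NoDup_list_prod_seq|]. intros [i j] Hp. apply HN0 in Hp.
    apply in_prod_iff in Hp. destruct Hp as [Hi Hj]. apply in_seq in Hi, Hj.
    apply in_prod; apply in_seq; unfold M; lia. }
  rewrite lsum_prod in R1. unfold v in R1; cbn [fst snd] in R1.
  match goal with |- Cmod (?a - _) <= _ => set (X := a) end.
  match type of R1 with Cmod (?b - _) <= _ => set (Y := b) in * end.
  change (Cmod (Y - X) <= e / 2) in HM0.
  replace (X - S)%C with (- (Y - X) + (Y - S))%C by ring.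
  eapply Rle_trans; [apply Cmod_triangle|]. rewrite Cmod_opp. lra.
Qed.

End Iterated.

(** * The weight f(x) / sqrt x *)

Definition weight (f : R -> C) (x : R) : C := (f x * RtoC (/ sqrt x))%C.

(** The size of the derivative of [f x / sqrt x]: increments of the weight are measured by
    [d * omega x], and the weight itself by [x * omega x]. *)
Definition omega (x : R) : R := / (x * sqrt x * (1 + x) ^ 3).

Lemma omega_pos x : 0 < x -> 0 < omega x.
Proof.
  intros Hx. apply Rinv_0_lt_compat. pose proof (sqrt_lt_R0 x Hx).
  apply Rmult_lt_0_compat; [apply Rmult_lt_0_compat; auto|apply pow_lt; lra].
Qed.

Section Weight.

Context (f : R -> C) (A B : R) (A_pos : 0 <= A) (B_pos : 0 <= B)
  (decay : forall x, 0 < x -> Cmod (f x) * (1 + x) ^ 3 <= B)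
  (increment : forall x d, 0 < x -> 0 <= d ->
     Cmod (f (x + d) - f x) * (x * (1 + x) ^ 3) <= A * d).

Lemma weight_le x : 0 < x -> Cmod (weight f x) <= B * (x * omega x).
Proof.
  intros Hx. pose proof (sqrt_lt_R0 x Hx) as Hs.
  assert (P3 : 0 < (1 + x) ^ 3) by (apply pow_lt; lra).
  unfold weight, omega. rewrite Cmod_mult, Cmod_R, Rabs_right
    by (apply Rle_ge; left; now apply Rinv_0_lt_compat).
  replace (B * (x * / (x * sqrt x * (1 + x) ^ 3))) with (B * / (1 + x) ^ 3 * / sqrt x)
    by (field; repeat split; lra).
  apply Rmult_le_compat_r; [left; now apply Rinv_0_lt_compat|].
  apply Rmult_le_reg_r with ((1 + x) ^ 3); auto.
  rewrite (Rmult_assoc B), Rinv_l, Rmult_1_r by lra. now apply decay.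
Qed.

Lemma inv_sqrt_increment x d : 0 < x -> 0 <= d ->
  0 <= / sqrt x - / sqrt (x + d) <= d / (x * sqrt x).
Proof.
  intros Hx Hd. pose proof (sqrt_lt_R0 x Hx) as Hs.
  pose proof (sqrt_lt_R0 (x + d) ltac:(lra)) as Hs'.
  pose proof (sqrt_sqrt x ltac:(lra)) as E1. pose proof (sqrt_sqrt (x + d) ltac:(lra)) as E2.
  assert (Hle : sqrt x <= sqrt (x + d)) by (apply sqrt_le_1_alt; lra).
  set (s := sqrt x) in *. set (s' := sqrt (x + d)) in *.
  assert (E : / s - / s' = (s' - s) / (s * s')) by (field; lra).
  rewrite E. split.
  - apply Rmult_le_pos; [lra|]. left. apply Rinv_0_lt_compat, Rmult_lt_0_compat; auto.
  - replace (d / (x * s)) with ((s' * s' - s * s) / (s * s * s))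
      by (rewrite E1, E2; field; split; nra).
    apply Rmult_le_reg_r with (s * s * s * s'); [repeat apply Rmult_lt_0_compat; auto|].
    replace ((s' - s) / (s * s') * (s * s * s * s')) with ((s' - s) * (s * s)) by (field; lra).
    replace ((s' * s' - s * s) / (s * s * s) * (s * s * s * s'))
      with ((s' - s) * ((s' + s) * s')) by (field; lra).
    apply Rmult_le_compat_l; nra.
Qed.

(** Product rule in difference form: the increment of [f] against [1 / sqrt (x + d)], and the value
    [f x] against the increment of [1 / sqrt]. *)
Lemma weight_increment x d : 0 < x -> 0 <= d ->
  Cmod (weight f (x + d) - weight f x) <= (A + B) * (d * omega x).
Proof.
  intros Hx Hd. pose proof (sqrt_lt_R0 x Hx) as Hs.
  destruct (inv_sqrt_increment x d Hx Hd) as [I1 I2].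
  assert (P3 : 0 < (1 + x) ^ 3) by (apply pow_lt; lra).
  unfold weight.
  replace (f (x + d)%R * RtoC (/ sqrt (x + d)) - f x * RtoC (/ sqrt x))%C with
    ((f (x + d)%R - f x) * RtoC (/ sqrt (x + d)) + - (f x * RtoC (/ sqrt x - / sqrt (x + d))))%C
    by (rewrite RtoC_minus; ring).
  eapply Rle_trans; [apply Cmod_triangle|].
  rewrite Cmod_opp, !Cmod_mult, !Cmod_R, (Rabs_right (_ - _)) by lra.
  assert (Hi : 0 < / sqrt (x + d)) by (apply Rinv_0_lt_compat, sqrt_lt_R0; lra).
  rewrite Rabs_right by lra.
  assert (T1 : Cmod (f (x + d)%R - f x) * / sqrt (x + d) <= A * (d * omega x)).
  { apply Rle_trans with (A * d * / (x * (1 + x) ^ 3) * / sqrt x).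
    - apply Rmult_le_compat; [apply Cmod_ge_0|lra| |lra].
      assert (P : 0 < x * (1 + x) ^ 3) by (apply Rmult_lt_0_compat; auto).
      apply Rmult_le_reg_r with (x * (1 + x) ^ 3); auto.
      rewrite (Rmult_assoc (A * d)), Rinv_l, Rmult_1_r by lra. now apply increment.
    - right. unfold omega. field. repeat split; lra. }
  assert (T2 : Cmod (f x) * (/ sqrt x - / sqrt (x + d)) <= B * (d * omega x)).
  { apply Rle_trans with (B * / (1 + x) ^ 3 * (d / (x * sqrt x))).
    - apply Rmult_le_compat; [apply Cmod_ge_0|lra| |lra].
      apply Rmult_le_reg_r with ((1 + x) ^ 3); auto.
      rewrite (Rmult_assoc B), Rinv_l, Rmult_1_r by lra. now apply decay.
    - right. unfold omega. field. repeat split; lra. }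
  lra.
Qed.

(** The three factors of the denominator shrink by at most 2, 2 and 8. *)
Lemma omega_half x y : 0 < x -> x / 2 <= y -> omega y <= 32 * omega x.
Proof.
  intros Hx Hy. pose proof (sqrt_lt_R0 x Hx) as Hs.
  assert (Hs2 : sqrt x <= 2 * sqrt y).
  { replace (2 * sqrt y) with (sqrt (4 * y)).
    - apply sqrt_le_1_alt; lra.
    - rewrite sqrt_mult by lra. f_equal. replace 4 with (2 * 2) by ring. apply sqrt_square; lra. }
  assert (P3 : 0 < (1 + x) ^ 3) by (apply pow_lt; lra).
  assert (C3 : (1 + x) ^ 3 <= 8 * (1 + y) ^ 3).
  { replace (8 * (1 + y) ^ 3) with ((2 * (1 + y)) ^ 3) by ring. apply pow_incr; lra. }
  unfold omega.
  replace (32 * / (x * sqrt x * (1 + x) ^ 3)) with (/ (x * sqrt x * (1 + x) ^ 3 / 32))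
    by (field; repeat split; lra).
  apply Rinv_le_contravar.
  - apply Rmult_lt_0_compat; [|lra]. apply Rmult_lt_0_compat; auto.
    apply Rmult_lt_0_compat; auto.
  - apply Rmult_le_reg_r with 32; [lra|].
    replace (x * sqrt x * (1 + x) ^ 3 / 32 * 32) with (x * sqrt x * (1 + x) ^ 3) by field.
    replace (y * sqrt y * (1 + y) ^ 3 * 32) with ((2 * y) * (2 * sqrt y) * (8 * (1 + y) ^ 3)) by ring.
    apply Rmult_le_compat; try lra; [nra|]. apply Rmult_le_compat; lra.
Qed.

Lemma weight_decrement x d : 0 < x -> 0 <= d -> 2 * d <= x ->
  Cmod (weight f (x - d) - weight f x) <= 32 * (A + B) * (d * omega x).
Proof.
  intros Hx Hd Hdx.
  assert (H := weight_increment (x - d) d ltac:(lra) Hd).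
  replace (x - d + d) with x in H by ring.
  replace (weight f (x - d)%R - weight f x)%C with (- (weight f x - weight f (x - d)%R))%C by ring.
  rewrite Cmod_opp. eapply Rle_trans; [exact H|].
  replace (32 * (A + B) * (d * omega x)) with ((A + B) * (d * (32 * omega x))) by ring.
  apply Rmult_le_compat_l; [lra|]. apply Rmult_le_compat_l; auto. apply omega_half; lra.
Qed.

(** For points of the model sum without a counterpart in the original sum. When the displacement [d]
    is at least [x / 2], the weight is already of the order of the admissible error. *)
Lemma weight_discarded x d : 0 < x -> x <= 2 * d ->
  Cmod (0 - weight f x) <= 32 * (A + B) * (d * omega x).
Proof.
  intros Hx Hd. replace (0 - weight f x)%C with (- weight f x)%C by ring. rewrite Cmod_opp.
  eapply Rle_trans; [now apply weight_le|]. pose proof (omega_pos x Hx).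
  assert (x * omega x <= 2 * (d * omega x)) by nra.
  assert (0 <= x * omega x) by nra. nra.
Qed.

End Weight.

(** * Lattice points *)

Definition idx (i : nat) : Z := (Z.of_nat i + 1)%Z.

Definition pos_index (z : Z) : nat := Z.to_nat (z - 1).

Lemma idx_pos i : (0 < idx i)%Z.
Proof. unfold idx; lia. Qed.

Lemma idx_pos_index z : (0 < z)%Z -> idx (pos_index z) = z.
Proof. unfold idx, pos_index. lia. Qed.

Lemma pos_index_inj z z' : (0 < z)%Z -> (0 < z')%Z -> pos_index z = pos_index z' -> z = z'.
Proof. unfold pos_index. lia. Qed.

Lemma idx_inj i j : idx i = idx j -> i = j.
Proof. unfold idx. lia. Qed.

Lemma IZR_idx i : IZR (idx i) = INR i + 1.
Proof. unfold idx. rewrite plus_IZR, <- INR_IZR_INZ. reflexivity. Qed.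

Lemma IZR_idx_ge i : 1 <= IZR (idx i).
Proof. rewrite IZR_idx. pose proof (pos_INR i). lra. Qed.

Lemma S_term_out r b f i j : ~ (r | idx j - b * idx i)%Z -> S_term r b f i j = RtoC 0.
Proof.
  intros H. unfold S_term. rewrite !Nat2Z.inj_add. change (Z.of_nat 1) with 1%Z.
  fold (idx i) (idx j). destruct (Zdivide_dec r (idx j - b * idx i)); [contradiction|reflexivity].
Qed.

(** Writing [1 / sqrt (m n)] as [r^(-1/2) (m n / r)^(-1/2)] turns each term into [r^(-1/2)] times
    the weight at [m n / r]. *)
Lemma S_term_in r b f i j : (0 < r)%Z -> (r | idx j - b * idx i)%Z ->
  S_term r b f i j
  = (RtoC (/ sqrt (IZR r)) * weight f (IZR (idx i) * IZR (idx j) / IZR r))%C.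
Proof.
  intros Hr H. unfold S_term. rewrite !Nat2Z.inj_add. change (Z.of_nat 1) with 1%Z.
  fold (idx i) (idx j). destruct (Zdivide_dec r (idx j - b * idx i)); [|contradiction].
  rewrite mult_IZR. assert (Pr : 0 < IZR r) by now apply IZR_lt.
  pose proof (IZR_idx_ge i) as Pi. pose proof (IZR_idx_ge j) as Pj.
  set (m := IZR (idx i)) in *. set (n := IZR (idx j)) in *.
  assert (Pmn : 0 < m * n) by nra.
  assert (E : sqrt (m * n) = sqrt (IZR r) * sqrt (m * n / IZR r)).
  { rewrite <- sqrt_mult.
    - f_equal. field. lra.
    - lra.
    - left. now apply Rdiv_lt_0_compat. }
  pose proof (sqrt_lt_R0 _ Pr). pose proof (sqrt_lt_R0 (m * n / IZR r) ltac:(now apply Rdiv_lt_0_compat)).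
  unfold weight, Cdiv. rewrite RtoC_inv_total, E, Rinv_mult, RtoC_mult. ring.
Qed.

(** Extension by zero keeps all pieces of a sum on one index type, so that their unordered sums can
    be added. *)
Definition on {I} (U : I -> Prop) (u : I -> C) (i : I) : C :=
  if excluded_middle_informative (U i) then u i else RtoC 0.

Lemma on_in {I} (U : I -> Prop) u i : U i -> on U u i = u i.
Proof. intros H. unfold on. destruct excluded_middle_informative; [reflexivity|contradiction]. Qed.

Lemma on_out {I} (U : I -> Prop) u i : ~ U i -> on U u i = RtoC 0.
Proof. intros H. unfold on. destruct excluded_middle_informative; [contradiction|reflexivity]. Qed.

Lemma abs_bounded_on {I} (U : I -> Prop) (u : I -> C) K :
  abs_bounded u K -> abs_bounded (on U u) K.
Proof.
  intros H B HB. eapply Rle_trans; [|apply (H B HB)]. apply rlsum_le. intros i _.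
  unfold on. destruct excluded_middle_informative; [lra|]. rewrite Cmod_0. apply Cmod_ge_0.
Qed.

Lemma dominant_idx i j : dominant (i, j) = / (IZR (idx i) ^ 2 * IZR (idx j) ^ 2).
Proof. unfold dominant; cbn [fst snd]. now rewrite !IZR_idx. Qed.

(** With [x = m l >= 1] one has [m^2 <= x^2] and [omega x <= x^(-4)]. *)
Lemma omega_dominant_product a q m l : 0 < a -> 0 < q -> 1 <= m -> 1 <= l ->
  a * m ^ 2 / q * omega (m * l) <= a / q * / (m ^ 2 * l ^ 2).
Proof.
  intros Ha Hq Hm Hl. assert (Hx : 1 <= m * l) by nra. set (x := m * l) in *.
  assert (Hs : 1 <= sqrt x) by (rewrite <- sqrt_1; apply sqrt_le_1_alt; lra).
  assert (Paq : 0 < a / q) by (apply Rdiv_lt_0_compat; lra).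
  replace (a * m ^ 2 / q * omega x) with (a / q * (m ^ 2 * omega x)) by (unfold Rdiv; ring).
  apply Rmult_le_compat_l; [lra|].
  replace (m ^ 2 * l ^ 2) with (x ^ 2) by (unfold x; ring).
  apply Rle_trans with (x ^ 2 * omega x).
  { apply Rmult_le_compat_r; [left; apply omega_pos; lra|]. apply pow_incr. unfold x. nra. }
  unfold omega.
  apply Rle_trans with (x ^ 2 * / (x * 1 * x ^ 3)).
  - apply Rmult_le_compat_l; [nra|]. apply Rinv_le_contravar.
    + apply Rmult_lt_0_compat; [lra|apply pow_lt; lra].
    + apply Rmult_le_compat; [lra|apply pow_le; lra|nra|apply pow_incr; lra].
  - right. field. lra.
Qed.

(** With [x = n l / a] the displacement is [(a / q) x^2 / l^2]. Its factor [x^2] tames the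
    singularity of [omega] at 0: [x^2 omega x = sqrt x / (1 + x)^3 <= 1 / (1 + x)^2], and
    [k <= x]. *)
Lemma omega_dominant_class a q n l k : 0 < a -> 0 < q -> 1 <= n -> 1 <= l -> 0 <= k ->
  k * a <= n -> n ^ 2 / (a * q) * omega (n * l / a) <= a / q * / (l ^ 2 * (k + 1) ^ 2).
Proof.
  intros Ha Hq Hn Hl Hk Hkn. set (x := n * l / a).
  assert (Hx : 0 < x) by (apply Rdiv_lt_0_compat; nra).
  assert (Hkx : k <= x).
  { apply Rmult_le_reg_r with a; auto. unfold x. replace (n * l / a * a) with (n * l) by (field; lra).
    nra. }
  pose proof (sqrt_lt_R0 x Hx) as Hs. pose proof (sqrt_sqrt x ltac:(lra)) as Hss.
  assert (P3 : 0 < (1 + x) ^ 3) by (apply pow_lt; lra).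
  assert (Hs1 : sqrt x <= 1 + x) by nra.
  replace (n ^ 2 / (a * q)) with (a / q * (x ^ 2 / l ^ 2)) by (unfold x; field; lra).
  rewrite Rmult_assoc. apply Rmult_le_compat_l; [left; now apply Rdiv_lt_0_compat|].
  assert (E : x ^ 2 / l ^ 2 * omega x = / l ^ 2 * (sqrt x * / (1 + x) ^ 3)).
  { unfold omega. rewrite <- Hss at 1.
    replace (x * sqrt x) with (sqrt x * sqrt x * sqrt x) by (rewrite Hss; ring).
    field. repeat split; lra. }
  rewrite E, Rinv_mult. apply Rmult_le_compat_l; [left; apply Rinv_0_lt_compat, pow_lt; lra|].
  apply Rle_trans with ((1 + x) * / (1 + x) ^ 3).
  - apply Rmult_le_compat_r; [left; now apply Rinv_0_lt_compat|lra].
  - replace ((1 + x) * / (1 + x) ^ 3) with (/ (1 + x) ^ 2) by (field; lra).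
    apply Rinv_le_contravar; [apply pow_lt; lra|]. apply pow_incr; lra.
Qed.

(* Within a row l, the points n of one class mod a lie in different blocks of length a. *)
Definition class_index (a : Z) (p : nat * nat) : nat * nat :=
  (fst p, (snd p / Z.to_nat a)%nat).

(** Two points of one class in the same row differ by a multiple of [a]; in the same block they
    differ by less than [a]. *)
Lemma class_index_inj a b p p' : (0 < a)%Z ->
  (a | idx (snd p) - b * idx (fst p))%Z -> (a | idx (snd p') - b * idx (fst p'))%Z ->
  class_index a p = class_index a p' -> p = p'.
Proof.
  intros Ha H H' E. destruct p as [i j], p' as [i' j']. unfold class_index in E. cbn [fst snd] in *.
  injection E as -> E. f_equal.
  assert (D : (a | idx j - idx j')%Z).
  { replace (idx j - idx j')%Z with ((idx j - b * idx i') - (idx j' - b * idx i'))%Z by ring.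
    now apply Z.divide_sub_r. }
  destruct D as [t Ht]. unfold idx in Ht.
  set (a' := Z.to_nat a) in *. assert (Ea : a = Z.of_nat a') by (unfold a'; lia).
  assert (Na : (a' <> 0)%nat) by lia.
  pose proof (Nat.div_mod_eq j a') as D1. pose proof (Nat.div_mod_eq j' a') as D2.
  pose proof (Nat.mod_upper_bound j a' Na). pose proof (Nat.mod_upper_bound j' a' Na).
  rewrite E in D1. assert (t = 0)%Z by nia. lia.
Qed.

Lemma class_index_le a j : (0 < a)%Z ->
  INR (j / Z.to_nat a) * IZR a <= IZR (idx j).
Proof.
  intros Ha. rewrite IZR_idx. set (a' := Z.to_nat a).
  replace (IZR a) with (INR a') by (unfold a'; rewrite INR_IZR_INZ, Z2Nat.id by lia; reflexivity).
  rewrite <- mult_INR. pose proof (Nat.Div0.mul_div_le j a') as H. rewrite Nat.mul_comm in H.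
  apply le_INR in H. lra.
Qed.

Lemma sqrt_ratio a q : 0 < a -> 0 < q -> sqrt (a / q) * / sqrt a = / sqrt q.
Proof.
  intros Ha Hq. rewrite sqrt_div_alt by auto.
  pose proof (sqrt_lt_R0 _ Ha). pose proof (sqrt_lt_R0 _ Hq). field. split; lra.
Qed.

(** * Comparison of the pieces of the double sums *)

Section Reciprocity.

Context (f : R -> C) (A B : R) (A_pos : 0 <= A) (B_pos : 0 <= B)
  (decay : forall x, 0 < x -> Cmod (f x) * (1 + x) ^ 3 <= B)
  (increment : forall x d, 0 < x -> 0 <= d ->
     Cmod (f (x + d) - f x) * (x * (1 + x) ^ 3) <= A * d).

Let W := weight f.

(** The crude factor [r^2] is harmless: the bound only serves to justify convergence and the
    existence of [c3]. *)
Lemma weight_product_le m n r : 0 < r -> 1 <= m -> 1 <= n ->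
  / sqrt r * Cmod (W (m * n / r)) <= B * r ^ 2 * / (m ^ 2 * n ^ 2).
Proof.
  intros Hr Hm Hn. assert (Hmn : 1 <= m * n) by nra. set (x := m * n / r).
  assert (Hx : 0 < x) by (apply Rdiv_lt_0_compat; lra).
  pose proof (sqrt_lt_R0 r Hr) as Sr. pose proof (sqrt_lt_R0 x Hx) as Sx.
  assert (P3 : 0 < (1 + x) ^ 3) by (apply pow_lt; lra).
  apply Rle_trans with (/ sqrt r * (B * (x * omega x))).
  { apply Rmult_le_compat_l; [left; now apply Rinv_0_lt_compat|].
    now apply (weight_le f B decay). }
  assert (E : / sqrt r * (B * (x * omega x)) = B * / (sqrt (m * n) * (1 + x) ^ 3)).
  { replace (sqrt (m * n)) with (sqrt r * sqrt x).
    - unfold omega. field. repeat split; lra.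
    - rewrite <- sqrt_mult by lra. f_equal. unfold x. field. lra. }
  rewrite E, Rmult_assoc. apply Rmult_le_compat_l; auto.
  replace (r ^ 2 * / (m ^ 2 * n ^ 2)) with (/ (1 * x ^ 2)) by (unfold x; field; repeat split; lra).
  assert (Px2 : 0 < x ^ 2) by (apply pow_lt; lra).
  apply Rinv_le_contravar; [lra|].
  apply Rmult_le_compat; try lra.
  - rewrite <- sqrt_1. apply sqrt_le_1_alt; lra.
  - assert (0 < x ^ 3) by (apply pow_lt; lra). nra.
Qed.

Lemma S_term_dominated r b i j : (0 < r)%Z ->
  Cmod (S_term r b f i j) <= B * IZR r ^ 2 * dominant (i, j).
Proof.
  intros Hr. assert (Pr : 0 < IZR r) by now apply IZR_lt.
  assert (PB : 0 <= B * IZR r ^ 2) by (apply Rmult_le_pos; auto; apply pow_le; lra).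
  destruct (Zdivide_dec r (idx j - b * idx i)) as [H|H].
  - rewrite S_term_in by auto. rewrite Cmod_mult, Cmod_R, Rabs_right
      by (apply Rle_ge; left; now apply Rinv_0_lt_compat, sqrt_lt_R0).
    rewrite dominant_idx. apply weight_product_le; auto; apply IZR_idx_ge.
  - rewrite S_term_out by auto. rewrite Cmod_0. apply Rmult_le_pos; auto.
    left; apply dominant_pos.
Qed.

Lemma S_term_double_abs_summable r b : (0 < r)%Z -> double_abs_summable (S_term r b f).
Proof.
  intros Hr. apply dominated_double_abs_summable with (K := B * IZR r ^ 2).
  intros; now apply S_term_dominated.
Qed.

Definition S_family (r b : Z) (p : nat * nat) : C := S_term r b f (fst p) (snd p).

Lemma usum_S_sum r b : (0 < r)%Z -> usum (S_family r b) (S_sum r b f).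
Proof.
  intros Hr. apply usum_iterated with (K := B * IZR r ^ 2).
  - apply Rmult_le_pos; auto. apply pow_le. left; now apply IZR_lt.
  - intros; now apply S_term_dominated.
Qed.

Lemma abs_bounded_S_family r b : (0 < r)%Z -> exists K, abs_bounded (S_family r b) K.
Proof.
  intros Hr. eexists. apply (abs_bounded_dominant_id _ (B * IZR r ^ 2)).
  - apply Rmult_le_pos; auto. apply pow_le. left; now apply IZR_lt.
  - intros [i j]. now apply S_term_dominated.
Qed.

Lemma usum_on_S_family r b U : (0 < r)%Z -> exists S, usum (on U (S_family r b)) S.
Proof.
  intros Hr. destruct (abs_bounded_S_family r b Hr) as [K HK].
  apply usum_ex with K. now apply abs_bounded_on.
Qed.

Definition product_family (p : nat * nat) : C := W (IZR (idx (fst p)) * IZR (idx (snd p))).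

Lemma usum_product_family_ex : exists c3, usum product_family c3.
Proof.
  apply usum_ex with (4 * B). apply abs_bounded_dominant_id; auto. intros [i j].
  unfold product_family; cbn [fst snd]. rewrite dominant_idx.
  assert (H := weight_product_le _ _ 1 Rlt_0_1 (IZR_idx_ge i) (IZR_idx_ge j)).
  rewrite sqrt_1, Rinv_1, Rmult_1_l, Rdiv_1_r in H.
  eapply Rle_trans; [exact H|]. right. ring.
Qed.

Context (a q : Z) (Ha : (0 < a)%Z) (Hq : (0 < q)%Z).

(* The points with l > 0 and with l < 0 in n = a m + q l. *)
Definition above (p : nat * nat) : Prop :=
  (q | idx (snd p) - a * idx (fst p))%Z /\ (a * idx (fst p) < idx (snd p))%Z.

Definition below (p : nat * nat) : Prop :=
  (q | idx (snd p) - a * idx (fst p))%Z /\ (idx (snd p) < a * idx (fst p))%Z.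

Definition diagonal (p : nat * nat) : Prop := (idx (snd p) = a * idx (fst p))%Z.

(* Here n + a m = q l with l > 0 throughout. *)
Definition near_side (p : nat * nat) : Prop :=
  (q | idx (snd p) - - a * idx (fst p))%Z /\ (a * idx (fst p) <= idx (snd p))%Z.

Definition far_side (p : nat * nat) : Prop :=
  (q | idx (snd p) - - a * idx (fst p))%Z /\ (idx (snd p) < a * idx (fst p))%Z.

Lemma split_positive S0 Sa Sb :
  usum (on diagonal (S_family q a)) S0 -> usum (on above (S_family q a)) Sa ->
  usum (on below (S_family q a)) Sb -> S_sum q a f = (S0 + Sa + Sb)%C.
Proof.
  clear A A_pos increment.
  intros H0 H1 H2. apply (usum_unique (S_family q a)); [now apply usum_S_sum|].
  eapply usum_ext; [|exact (usum_plus _ _ _ _ (usum_plus _ _ _ _ H0 H1) H2)].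
  intros [i j]. cbn beta.
  destruct (Zdivide_dec q (idx j - a * idx i)) as [Hd|Hd].
  - destruct (Z.lt_trichotomy (idx j) (a * idx i)) as [H|[H|H]].
    + rewrite (on_out diagonal), (on_out above), (on_in below)
        by (unfold diagonal, above, below; cbn [fst snd]; auto; lia). ring.
    + rewrite (on_in diagonal), (on_out above), (on_out below)
        by (unfold diagonal, above, below; cbn [fst snd]; auto; lia). ring.
    + rewrite (on_out diagonal), (on_in above), (on_out below)
        by (unfold diagonal, above, below; cbn [fst snd]; auto; lia). ring.
  - assert (Hn : ~ diagonal (i, j)).
    { unfold diagonal; cbn [fst snd]. intros E. apply Hd. rewrite E. exists 0%Z. ring. }
    rewrite (on_out diagonal), (on_out above), (on_out below)
      by (auto; unfold above, below; cbn [fst snd]; tauto).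
    unfold S_family; cbn [fst snd]. rewrite S_term_out by auto. ring.
Qed.

Lemma split_negative Sn Sf :
  usum (on near_side (S_family q (- a))) Sn -> usum (on far_side (S_family q (- a))) Sf ->
  S_sum q (- a) f = (Sn + Sf)%C.
Proof.
  clear A A_pos increment.
  intros H1 H2. apply (usum_unique (S_family q (- a))); [now apply usum_S_sum|].
  eapply usum_ext; [|exact (usum_plus _ _ _ _ H1 H2)].
  intros [i j]. cbn beta.
  destruct (Zdivide_dec q (idx j - - a * idx i)) as [Hd|Hd].
  - destruct (Z.lt_ge_cases (idx j) (a * idx i)) as [H|H].
    + rewrite (on_out near_side), (on_in far_side)
        by (unfold near_side, far_side; cbn [fst snd]; auto; lia). ring.
    + rewrite (on_in near_side), (on_out far_side)
        by (unfold near_side, far_side; cbn [fst snd]; auto; lia). ring.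
  - rewrite (on_out near_side), (on_out far_side)
      by (unfold near_side, far_side; cbn [fst snd]; tauto).
    unfold S_family; cbn [fst snd]. rewrite S_term_out by auto. ring.
Qed.

Let ra := IZR a.
Let rq := IZR q.
(** The constant of a backward step of the weight; it also covers the [A + B] of a forward step, so
    all four comparisons share it. *)
Let C1 := 32 * (A + B).

Lemma ra_pos : 0 < ra.
Proof. now apply IZR_lt. Qed.

Lemma rq_pos : 0 < rq.
Proof. now apply IZR_lt. Qed.

Lemma inv_sqrt_rq_pos : 0 < / sqrt rq.
Proof. apply Rinv_0_lt_compat, sqrt_lt_R0, rq_pos. Qed.

(** Common to the two pieces whose model is [q^(-1/2)] times the full sum over [(m, l)]. The value
    [w] is either a displaced weight or 0, the latter when the pair has no counterpart. *)
Lemma product_comparison (v : nat * nat -> C) S c3 :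
  usum v S -> usum product_family c3 ->
  (forall i k, let m := IZR (idx i) in let l := IZR (idx k) in
     exists w, v (i, k) = (RtoC (/ sqrt rq) * w)%C /\
       Cmod (w - W (m * l)) <= C1 * (ra * m ^ 2 / rq * omega (m * l))) ->
  Cmod (S - c3 * RtoC (/ sqrt rq)) <= 4 * C1 * (/ sqrt rq * (ra / rq)).
Proof.
  intros HS Hc Hv. pose proof ra_pos. pose proof rq_pos. pose proof inv_sqrt_rq_pos.
  assert (C10 : 0 <= C1) by (unfold C1; lra).
  rewrite Cmult_comm.
  apply (usum_compare v (fun p => RtoC (/ sqrt rq) * product_family p)%C); auto.
  { now apply usum_scal. }
  replace (4 * C1 * (/ sqrt rq * (ra / rq))) with (4 * (C1 * (/ sqrt rq * (ra / rq)))) by ring.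
  assert (Paq : 0 < ra / rq) by now apply Rdiv_lt_0_compat.
  apply abs_bounded_dominant_id.
  { apply Rmult_le_pos; auto. apply Rmult_le_pos; lra. }
  intros [i k]. destruct (Hv i k) as [w [-> Hw]].
  unfold product_family; cbn [fst snd].
  pose proof (IZR_idx_ge i). pose proof (IZR_idx_ge k). rewrite dominant_idx.
  set (m := IZR (idx i)) in *. set (l := IZR (idx k)) in *.
  replace (RtoC (/ sqrt rq) * w - RtoC (/ sqrt rq) * W (m * l))%C
    with (RtoC (/ sqrt rq) * (w - W (m * l)))%C by ring.
  rewrite Cmod_mult, Cmod_R, Rabs_right by lra.
  replace (C1 * (/ sqrt rq * (ra / rq)) * / (m ^ 2 * l ^ 2)) with
    (/ sqrt rq * (C1 * (ra / rq * / (m ^ 2 * l ^ 2)))) by ring.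
  apply Rmult_le_compat_l; [lra|]. eapply Rle_trans; [exact Hw|].
  apply Rmult_le_compat_l; auto. now apply omega_dominant_product.
Qed.

(* The points of [v] are the pairs (l, n) with n = b l (mod a). *)
Lemma class_comparison b (v : nat * nat -> C) S :
  usum v S ->
  (forall p, ~ (a | idx (snd p) - b * idx (fst p))%Z -> v p = RtoC 0) ->
  (forall k j, (a | idx j - b * idx k)%Z ->
     let l := IZR (idx k) in let n := IZR (idx j) in
     exists w, v (k, j) = (RtoC (/ sqrt rq) * w)%C /\
       Cmod (w - W (n * l / ra)) <= C1 * (n ^ 2 / (ra * rq) * omega (n * l / ra))) ->
  Cmod (S - RtoC (sqrt (ra / rq)) * S_sum a b f) <= 4 * C1 * (/ sqrt rq * (ra / rq)).
Proof.
  intros HS Hout Hv. pose proof ra_pos as Pa. pose proof rq_pos as Pq.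
  pose proof inv_sqrt_rq_pos as Pi.
  assert (C10 : 0 <= C1) by (unfold C1; lra).
  apply (usum_compare v (fun p => RtoC (sqrt (ra / rq)) * S_family a b p)%C); auto.
  { now apply usum_scal, usum_S_sum. }
  replace (4 * C1 * (/ sqrt rq * (ra / rq))) with (4 * (C1 * (/ sqrt rq * (ra / rq)))) by ring.
  assert (Paq : 0 < ra / rq) by now apply Rdiv_lt_0_compat.
  apply (abs_bounded_dominant (fun p => (a | idx (snd p) - b * idx (fst p))%Z) (class_index a)).
  - apply Rmult_le_pos; auto. apply Rmult_le_pos; lra.
  - intros p Hp. unfold S_family. rewrite Hout, S_term_out by auto. ring.
  - intros p p' Hp Hp'. now apply class_index_inj with b.
  - intros [k j] Hp; cbn [fst snd] in Hp. destruct (Hv k j Hp) as [w [-> Hw]].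
    unfold S_family; cbn [fst snd]. rewrite S_term_in by auto.
    pose proof (IZR_idx_ge k) as Pk. pose proof (IZR_idx_ge j) as Pj.
    unfold class_index, dominant; cbn [fst snd]. rewrite <- (IZR_idx k).
    pose proof (class_index_le a j Ha) as Hkj.
    set (l := IZR (idx k)) in *. set (n := IZR (idx j)) in *.
    set (c := INR (j / Z.to_nat a)) in *.
    assert (Pc : 0 <= c) by apply pos_INR.
    fold ra in Hkj |- *.
    (* [sqrt (a / q) a^(-1/2) = q^(-1/2)]: both sums now carry the same factor. *)
    replace (RtoC (sqrt (ra / rq)) * (RtoC (/ sqrt ra) * weight f (l * n / ra)))%C with
      (RtoC (/ sqrt rq) * W (n * l / ra))%C.
    2:{ rewrite <- (sqrt_ratio ra rq) by auto. rewrite RtoC_mult. unfold W.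
        replace (n * l / ra) with (l * n / ra) by (unfold Rdiv; ring). ring. }
    replace (RtoC (/ sqrt rq) * w - RtoC (/ sqrt rq) * W (n * l / ra))%C
      with (RtoC (/ sqrt rq) * (w - W (n * l / ra)))%C by ring.
    rewrite Cmod_mult, Cmod_R, Rabs_right by lra.
    replace (C1 * (/ sqrt rq * (ra / rq)) * / (l ^ 2 * (c + 1) ^ 2)) with
      (/ sqrt rq * (C1 * (ra / rq * / (l ^ 2 * (c + 1) ^ 2)))) by ring.
    apply Rmult_le_compat_l; [lra|]. eapply Rle_trans; [exact Hw|].
    apply Rmult_le_compat_l; auto. now apply omega_dominant_class.
Qed.

Lemma quotient_spec z : (q | z)%Z -> z = (q * (z / q))%Z.
Proof. intros [t ->]. rewrite Z.div_mul by lia. ring. Qed.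

(** The map [(m, n) -> (m, l)] with [l = (n - a m) / q] is a bijection onto all pairs, and
    [m n / q = m l + a m^2 / q] is a forward displacement of [m l]. *)
Lemma above_estimate S c3 : usum (on above (S_family q a)) S -> usum product_family c3 ->
  Cmod (S - c3 * RtoC (/ sqrt rq)) <= 4 * C1 * (/ sqrt rq * (ra / rq)).
Proof.
  intros HS Hc. pose proof ra_pos as Pa. pose proof rq_pos as Pq.
  set (v := fun p : nat * nat => let m := IZR (idx (fst p)) in let l := IZR (idx (snd p)) in
     (RtoC (/ sqrt rq) * W (m * l + ra * m ^ 2 / rq))%C).
  apply (product_comparison v); auto.
  - apply (usum_reindex above (fun _ => True)
      (fun p => (fst p, pos_index ((idx (snd p) - a * idx (fst p)) / q)))
      (on above (S_family q a))); auto.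
    + intros p Hp. now apply on_out.
    + intros p Hp. now elim Hp.
    + intros [i j] Hp. split; auto. rewrite on_in by auto. destruct Hp as [Hd Hlt].
      unfold v, S_family; cbn [fst snd] in *. rewrite S_term_in by auto.
      pose proof (quotient_spec _ Hd) as E. set (l := ((idx j - a * idx i) / q)%Z) in *.
      assert (Pl : (0 < l)%Z) by nia. rewrite idx_pos_index by auto.
      assert (En : idx j = (a * idx i + q * l)%Z) by lia. rewrite En at 1.
      rewrite plus_IZR, !mult_IZR. fold ra rq. unfold W. f_equal. f_equal. field. lra.
    + intros [i j] [i' j'] [Hd Hlt] [Hd' Hlt'] E. cbn [fst snd] in *.
      injection E as -> E. pose proof (quotient_spec _ Hd) as E1.
      pose proof (quotient_spec _ Hd') as E2.
      apply pos_index_inj in E; [|nia|nia]. f_equal. apply idx_inj. nia.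
    + intros [i k] _. pose proof (idx_pos i). pose proof (idx_pos k).
      exists (i, pos_index (a * idx i + q * idx k)). unfold above; cbn [fst snd].
      rewrite idx_pos_index by nia.
      replace (a * idx i + q * idx k - a * idx i)%Z with (idx k * q)%Z by ring.
      split; [split; [now exists (idx k)|nia]|].
      rewrite Z.div_mul by lia. f_equal. apply idx_inj. now rewrite idx_pos_index by auto.
  - intros i k m l. exists (W (m * l + ra * m ^ 2 / rq)). split; [reflexivity|].
    assert (Pm : 1 <= m) by apply IZR_idx_ge. assert (Pl : 1 <= l) by apply IZR_idx_ge.
    assert (Pd : 0 <= ra * m ^ 2 / rq).
    { apply Rmult_le_pos; [nra|]. left; now apply Rinv_0_lt_compat. }
    eapply Rle_trans; [apply (weight_increment f A B); auto; nra|].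
    assert (0 < omega (m * l)) by (apply omega_pos; nra).
    unfold C1. assert (0 <= ra * m ^ 2 / rq * omega (m * l)) by (apply Rmult_le_pos; lra).
    nra.
Qed.

(** Here [m] is eliminated: [(m, n) -> (l, n)] with [l = (a m - n) / q]. Integrality of
    [m = (n + q l) / a] is the congruence of [S(a, -q)], and [m n / q = n l / a + n^2 / (a q)]. *)
Lemma below_estimate S : usum (on below (S_family q a)) S ->
  Cmod (S - RtoC (sqrt (ra / rq)) * S_sum a (- q) f) <= 4 * C1 * (/ sqrt rq * (ra / rq)).
Proof.
  intros HS. pose proof ra_pos as Pa. pose proof rq_pos as Pq.
  set (V := fun p : nat * nat => (a | idx (snd p) - - q * idx (fst p))%Z).
  set (v := on V (fun p : nat * nat => let l := IZR (idx (fst p)) in let n := IZR (idx (snd p)) in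
     (RtoC (/ sqrt rq) * W (n * l / ra + n ^ 2 / (ra * rq)))%C)).
  apply (class_comparison (- q) v); auto.
  - apply (usum_reindex below V
      (fun p => (pos_index ((a * idx (fst p) - idx (snd p)) / q), snd p))
      (on below (S_family q a))); auto.
    + intros p Hp. now apply on_out.
    + intros p Hp. now apply on_out.
    + intros [i j] Hp. rewrite (on_in below) by auto. destruct Hp as [Hd Hlt]. cbn [fst snd] in *.
      assert (Hd' : (q | a * idx i - idx j)%Z).
      { replace (a * idx i - idx j)%Z with (- (idx j - a * idx i))%Z by ring.
        now apply Z.divide_opp_r. }
      pose proof (quotient_spec _ Hd') as E. set (l := ((a * idx i - idx j) / q)%Z) in *.
      assert (Pl : (0 < l)%Z) by nia.
      assert (En : (a * idx i = idx j + q * l)%Z) by lia.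
      assert (HV : V (pos_index l, j)).
      { unfold V; cbn [fst snd]. rewrite idx_pos_index by auto. exists (idx i). lia. }
      split; auto. unfold v. rewrite on_in by auto. cbn [fst snd]. rewrite idx_pos_index by auto.
      unfold S_family; cbn [fst snd]. rewrite S_term_in by auto.
      assert (EnR : ra * IZR (idx i) = IZR (idx j) + rq * IZR l).
      { unfold ra, rq. rewrite <- !mult_IZR, <- plus_IZR. now f_equal. }
      assert (Em : IZR (idx i) = (IZR (idx j) + rq * IZR l) / ra) by (rewrite <- EnR; field; lra).
      rewrite Em. fold rq. unfold W. f_equal. f_equal. field. lra.
    + intros [i j] [i' j'] [Hd Hlt] [Hd' Hlt'] E. cbn [fst snd] in *.
      injection E as E ->.
      assert (D1 : (q | a * idx i - idx j')%Z).
      { replace (a * idx i - idx j')%Z with (- (idx j' - a * idx i))%Z by ring.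
        now apply Z.divide_opp_r. }
      assert (D2 : (q | a * idx i' - idx j')%Z).
      { replace (a * idx i' - idx j')%Z with (- (idx j' - a * idx i'))%Z by ring.
        now apply Z.divide_opp_r. }
      pose proof (quotient_spec _ D1) as E1. pose proof (quotient_spec _ D2) as E2.
      apply pos_index_inj in E; [|nia|nia]. f_equal. apply idx_inj. nia.
    + intros [k j] [t Ht]. cbn [fst snd] in *. pose proof (idx_pos k). pose proof (idx_pos j).
      assert (Pt : (0 < t)%Z) by nia.
      assert (Et : (a * t - idx j = idx k * q)%Z) by lia.
      exists (pos_index t, j). unfold below; cbn [fst snd]. rewrite !idx_pos_index by auto.
      split; [split; [|nia]|].
      * exists (- idx k)%Z. lia.
      * rewrite Et, Z.div_mul by lia. f_equal. apply idx_inj. now rewrite idx_pos_index by auto.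
  - intros p Hp. now apply on_out.
  - intros k j Hp l n. exists (W (n * l / ra + n ^ 2 / (ra * rq))).
    split; [unfold v; now rewrite on_in|].
    assert (Pn : 1 <= n) by apply IZR_idx_ge. assert (Pl : 1 <= l) by apply IZR_idx_ge.
    assert (Px : 0 < n * l / ra) by (apply Rdiv_lt_0_compat; nra).
    assert (Pd : 0 <= n ^ 2 / (ra * rq)).
    { apply Rmult_le_pos; [nra|]. left; apply Rinv_0_lt_compat; nra. }
    eapply Rle_trans; [apply (weight_increment f A B); auto|].
    assert (0 < omega (n * l / ra)) by now apply omega_pos.
    unfold C1. assert (0 <= n ^ 2 / (ra * rq) * omega (n * l / ra)) by (apply Rmult_le_pos; lra).
    nra.
Qed.

(** For [n = a m] the argument is [(a / q) m^2] and [1 / sqrt (m n) = a^(-1/2) / m]. *)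
Lemma diagonal_value S P : usum (on diagonal (S_family q a)) S ->
  climit (csum (fun k => f (ra / rq * (INR k + 1) ^ 2)%R * RtoC (/ (INR k + 1)))%C) P ->
  S = (RtoC (/ sqrt ra) * P)%C.
Proof.
  intros HS HP. pose proof ra_pos as Pa. pose proof rq_pos as Pq.
  set (v := fun k => (RtoC (/ sqrt ra) * (f (ra / rq * (INR k + 1) ^ 2)%R * RtoC (/ (INR k + 1))))%C).
  assert (Hv : usum v S).
  { apply (usum_reindex diagonal (fun _ => True) fst (on diagonal (S_family q a))); auto.
    - intros p Hp. now apply on_out.
    - intros p Hp. now elim Hp.
    - intros [i j] Hp. split; auto. rewrite on_in by auto. unfold diagonal in Hp. cbn [fst snd] in *.
      unfold v, S_family; cbn [fst snd]. rewrite S_term_in by (auto; rewrite Hp; exists 0%Z; ring).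
      rewrite Hp, mult_IZR, <- IZR_idx. fold ra rq.
      pose proof (IZR_idx_ge i) as Pm. set (m := IZR (idx i)) in *. unfold weight.
      replace (m * (ra * m) / rq) with (ra / rq * m ^ 2) by (field; lra).
      set (z := f (ra / rq * m ^ 2)).
      replace (/ sqrt (ra / rq * m ^ 2)) with (sqrt rq * (/ sqrt ra * / m)).
      + rewrite !RtoC_mult. pose proof (sqrt_lt_R0 rq Pq).
        transitivity (RtoC (/ sqrt rq * sqrt rq) * (z * (RtoC (/ sqrt ra) * RtoC (/ m))))%C.
        * rewrite Rinv_l by lra. ring.
        * rewrite RtoC_mult. ring.
      + rewrite sqrt_mult, sqrt_pow2, sqrt_div_alt by (try lra; try nra; left; now apply Rdiv_lt_0_compat).
        pose proof (sqrt_lt_R0 rq Pq). pose proof (sqrt_lt_R0 ra Pa). field. repeat split; lra.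
    - intros [i j] [i' j'] Hp Hp' E. unfold diagonal in *. cbn [fst snd] in *. subst i'.
      f_equal. apply idx_inj. lia.
    - intros k _. pose proof (idx_pos k). exists (k, pos_index (a * idx k)).
      unfold diagonal; cbn [fst snd]. rewrite idx_pos_index by nia. auto. }
  apply usum_climit in Hv. apply (climit_unique _ _ _ Hv).
  pose proof (sqrt_lt_R0 ra Pa). intros e He.
  destruct (HP (e * sqrt ra) ltac:(nra)) as [N0 HN0]. exists N0. intros N HN. specialize (HN0 N HN).
  replace (csum v N) with (RtoC (/ sqrt ra)
    * csum (fun k => f (ra / rq * (INR k + 1) ^ 2)%R * RtoC (/ (INR k + 1))) N)%C.
  - match goal with |- Cmod (?c * ?x - ?c * ?y) <= _ =>
      replace (c * x - c * y)%C with (c * (x - y))%C by ring end.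
    assert (0 < / sqrt ra) by now apply Rinv_0_lt_compat.
    rewrite Cmod_mult, Cmod_R, Rabs_right by lra.
    replace e with (/ sqrt ra * (e * sqrt ra)) by (field; lra). apply Rmult_le_compat_l; lra.
  - clear. induction N as [|N IH]; simpl; [ring|]. rewrite <- IH. unfold v. simpl. ring.
Qed.

(** With [n = q l - a m] the condition [a m <= n] reads [2 a m <= q l], that is, the backward
    displacement [a m^2 / q] is at most half of [m l]. The other pairs [(m, l)] are covered by
    [weight_discarded]. *)
Lemma near_side_estimate S c3 : usum (on near_side (S_family q (- a))) S ->
  usum product_family c3 ->
  Cmod (S - c3 * RtoC (/ sqrt rq)) <= 4 * C1 * (/ sqrt rq * (ra / rq)).
Proof.
  intros HS Hc. pose proof ra_pos as Pa. pose proof rq_pos as Pq.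
  set (V := fun p : nat * nat => (2 * (a * idx (fst p)) <= q * idx (snd p))%Z).
  set (v := on V (fun p : nat * nat => let m := IZR (idx (fst p)) in let l := IZR (idx (snd p)) in
     (RtoC (/ sqrt rq) * W (m * l - ra * m ^ 2 / rq))%C)).
  apply (product_comparison v); auto.
  - apply (usum_reindex near_side V
      (fun p => (fst p, pos_index ((idx (snd p) - - a * idx (fst p)) / q)))
      (on near_side (S_family q (- a)))); auto.
    + intros p Hp. now apply on_out.
    + intros p Hp. now apply on_out.
    + intros [i j] Hp. rewrite (on_in near_side) by auto. destruct Hp as [Hd Hle].
      cbn [fst snd] in *. pose proof (idx_pos i). pose proof (idx_pos j).
      pose proof (quotient_spec _ Hd) as E. set (l := ((idx j - - a * idx i) / q)%Z) in *.
      assert (Pl : (0 < l)%Z) by nia.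
      assert (En : idx j = (q * l - a * idx i)%Z) by lia.
      assert (HV : V (i, pos_index l)).
      { unfold V; cbn [fst snd]. rewrite idx_pos_index by auto. lia. }
      split; auto. unfold v. rewrite on_in by auto. cbn [fst snd]. rewrite idx_pos_index by auto.
      unfold S_family; cbn [fst snd]. rewrite S_term_in by auto.
      rewrite En at 1. rewrite minus_IZR, !mult_IZR. fold ra rq.
      unfold W. f_equal. f_equal. field. lra.
    + intros [i j] [i' j'] [Hd Hlt] [Hd' Hlt'] E. cbn [fst snd] in *.
      pose proof (idx_pos i). pose proof (idx_pos j). pose proof (idx_pos i'). pose proof (idx_pos j').
      injection E as -> E. pose proof (quotient_spec _ Hd) as E1.
      pose proof (quotient_spec _ Hd') as E2.
      apply pos_index_inj in E; [|nia|nia]. f_equal. apply idx_inj. nia.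
    + intros [i k] Hp. unfold V in Hp; cbn [fst snd] in Hp.
      pose proof (idx_pos i). pose proof (idx_pos k).
      exists (i, pos_index (q * idx k - a * idx i)). unfold near_side; cbn [fst snd].
      rewrite idx_pos_index by nia.
      replace (q * idx k - a * idx i - - a * idx i)%Z with (idx k * q)%Z by ring.
      split; [split; [now exists (idx k)|lia]|].
      rewrite Z.div_mul by lia. f_equal. apply idx_inj. now rewrite idx_pos_index by auto.
  - intros i k m l.
    assert (Pm : 1 <= m) by apply IZR_idx_ge. assert (Pl : 1 <= l) by apply IZR_idx_ge.
    assert (Pd : 0 <= ra * m ^ 2 / rq).
    { apply Rmult_le_pos; [nra|]. left; now apply Rinv_0_lt_compat. }
    assert (Ed : (2 * (a * idx i) <= q * idx k)%Z -> 2 * (ra * m ^ 2 / rq) <= m * l).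
    { intros Hle. apply IZR_le in Hle. rewrite !mult_IZR in Hle. fold ra rq m l in Hle.
      apply Rmult_le_reg_r with rq; auto.
      replace (2 * (ra * m ^ 2 / rq) * rq) with (2 * (ra * m) * m) by (field; lra). nra. }
    assert (Ed' : ~ (2 * (a * idx i) <= q * idx k)%Z -> m * l <= 2 * (ra * m ^ 2 / rq)).
    { intros Hle. apply Z.nle_gt in Hle. apply IZR_lt in Hle. rewrite !mult_IZR in Hle.
      fold ra rq m l in Hle. apply Rmult_le_reg_r with rq; auto.
      replace (2 * (ra * m ^ 2 / rq) * rq) with (2 * (ra * m) * m) by (field; lra). nra. }
    unfold v, on. destruct excluded_middle_informative as [HV|HV]; unfold V in HV; cbn [fst snd] in HV.
    + exists (W (m * l - ra * m ^ 2 / rq)). split; [reflexivity|].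
      apply (weight_decrement f A B); auto. nra.
    + exists (RtoC 0). split; [ring|]. apply (weight_discarded f A B); auto. nra.
Qed.

(** With [a m = q l - n] the condition [n < a m] reads [2 n < q l], so the displacement
    [n^2 / (a q)] is less than half of [n l / a]. The other points of the class [n = q l] mod [a]
    are covered by [weight_discarded]. *)
Lemma far_side_estimate S : usum (on far_side (S_family q (- a))) S ->
  Cmod (S - RtoC (sqrt (ra / rq)) * S_sum a q f) <= 4 * C1 * (/ sqrt rq * (ra / rq)).
Proof.
  intros HS. pose proof ra_pos as Pa. pose proof rq_pos as Pq.
  set (V := fun p : nat * nat => (a | idx (snd p) - q * idx (fst p))%Z /\
     (2 * idx (snd p) < q * idx (fst p))%Z).
  set (v := on V (fun p : nat * nat => let l := IZR (idx (fst p)) in let n := IZR (idx (snd p)) in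
     (RtoC (/ sqrt rq) * W (n * l / ra - n ^ 2 / (ra * rq)))%C)).
  apply (class_comparison q v); auto.
  - apply (usum_reindex far_side V
      (fun p => (pos_index ((idx (snd p) - - a * idx (fst p)) / q), snd p))
      (on far_side (S_family q (- a)))); auto.
    + intros p Hp. now apply on_out.
    + intros p Hp. now apply on_out.
    + intros [i j] Hp. rewrite (on_in far_side) by auto. destruct Hp as [Hd Hlt]. cbn [fst snd] in *.
      pose proof (idx_pos i). pose proof (idx_pos j).
      pose proof (quotient_spec _ Hd) as E. set (l := ((idx j - - a * idx i) / q)%Z) in *.
      assert (Pl : (0 < l)%Z) by nia.
      assert (En : (a * idx i = q * l - idx j)%Z) by lia.
      assert (HV : V (pos_index l, j)).
      { unfold V; cbn [fst snd]. rewrite idx_pos_index by auto. split; [|lia].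
        exists (- idx i)%Z. lia. }
      split; auto. unfold v. rewrite on_in by auto. cbn [fst snd]. rewrite idx_pos_index by auto.
      unfold S_family; cbn [fst snd]. rewrite S_term_in by auto.
      assert (EnR : ra * IZR (idx i) = rq * IZR l - IZR (idx j)).
      { unfold ra, rq. rewrite <- !mult_IZR, <- minus_IZR. now f_equal. }
      assert (Em : IZR (idx i) = (rq * IZR l - IZR (idx j)) / ra) by (rewrite <- EnR; field; lra).
      rewrite Em. fold rq. unfold W. f_equal. f_equal. field. lra.
    + intros [i j] [i' j'] [Hd Hlt] [Hd' Hlt'] E. cbn [fst snd] in *.
      pose proof (idx_pos i). pose proof (idx_pos i'). pose proof (idx_pos j').
      injection E as E ->.
      pose proof (quotient_spec _ Hd) as E1. pose proof (quotient_spec _ Hd') as E2.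
      apply pos_index_inj in E; [|nia|nia]. f_equal. apply idx_inj. nia.
    + intros [k j] [[t Ht] Hlt]. cbn [fst snd] in *. pose proof (idx_pos k). pose proof (idx_pos j).
      (* The divisor relation is [n - q l = t a], so the preimage has [m = - t]. *)
      assert (Pt : (0 < - t)%Z) by nia.
      assert (Et : (idx j - - a * - t = idx k * q)%Z) by lia.
      exists (pos_index (- t), j). unfold far_side; cbn [fst snd]. rewrite !idx_pos_index by auto.
      split; [split; [|nia]|].
      * exists (idx k). lia.
      * rewrite Et, Z.div_mul by lia. f_equal. apply idx_inj. now rewrite idx_pos_index by auto.
  - intros p Hp. apply on_out. unfold V. tauto.
  - intros k j Hp l n.
    assert (Pn : 1 <= n) by apply IZR_idx_ge. assert (Pl : 1 <= l) by apply IZR_idx_ge.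
    assert (Px : 0 < n * l / ra) by (apply Rdiv_lt_0_compat; nra).
    assert (Paq : 0 < ra * rq) by nra.
    assert (Pd : 0 <= n ^ 2 / (ra * rq)).
    { apply Rmult_le_pos; [nra|]. left; now apply Rinv_0_lt_compat. }
    assert (X1 : 2 * (n ^ 2 / (ra * rq)) = 2 * n * (n / (ra * rq))) by (field; lra).
    assert (X2 : n * l / ra = rq * l * (n / (ra * rq))) by (field; lra).
    assert (Pz : 0 < n / (ra * rq)) by (apply Rdiv_lt_0_compat; lra).
    unfold v, on. destruct excluded_middle_informative as [HV|HV]; unfold V in HV; cbn [fst snd] in HV.
    + exists (W (n * l / ra - n ^ 2 / (ra * rq))). split; [reflexivity|].
      apply (weight_decrement f A B); auto. rewrite X1, X2.
      destruct HV as [_ HV]. apply IZR_lt in HV. rewrite !mult_IZR in HV. fold rq n l in HV.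
      apply Rmult_le_compat_r; lra.
    + exists (RtoC 0). split; [ring|]. apply (weight_discarded f A B); auto. rewrite X1, X2.
      assert (HV' : (q * idx k <= 2 * idx j)%Z) by (apply Z.nlt_ge; tauto).
      apply IZR_le in HV'. rewrite !mult_IZR in HV'. fold rq n l in HV'.
      apply Rmult_le_compat_r; lra.
Qed.

End Reciprocity.

(** * The reciprocity formula *)

Lemma smooth_pos_ccont f x : smooth_pos f -> 0 < x -> ccont f x.
Proof.
  intros H Hx. destruct (H 1%nat x Hx) as [H1 H2]. split.
  - exact (continuous_of_derive _ _ H1).
  - exact (continuous_of_derive _ _ H2).
Qed.

Lemma diagonal_sum_converges f B x : 0 <= B ->
  (forall x, 0 < x -> Cmod (f x) * (1 + x) ^ 3 <= B) -> 0 < x ->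
  exists P, climit (csum (fun k => f (x * (INR k + 1) ^ 2)%R * RtoC (/ (INR k + 1)))%C) P.
Proof.
  intros HB Hd Hx.
  set (u := fun k => (f (x * (INR k + 1) ^ 2)%R * RtoC (/ (INR k + 1)))%C).
  assert (Hu : abs_bounded u (4 * (B / x))).
  { apply abs_bounded_dominant with (U := fun _ => True) (phi := fun k => (k, O)).
    - apply Rmult_le_pos; auto. left; now apply Rinv_0_lt_compat.
    - intros i N. now elim N.
    - intros i i' _ _ E. now injection E.
    - intros k _. unfold u, dominant; cbn [fst snd]. pose proof (pos_INR k) as Pk.
      set (m := INR k + 1). assert (Pm : 1 <= m) by (unfold m; lra).
      assert (Pi : 0 < / m <= 1).
      { split; [apply Rinv_0_lt_compat; lra|]. rewrite <- Rinv_1. apply Rinv_le_contravar; lra. }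
      assert (Pm2 : 0 < m ^ 2) by (apply pow_lt; lra).
      rewrite Cmod_mult, Cmod_R, Rabs_right by lra.
      assert (Hxm : 0 < x * m ^ 2) by now apply Rmult_lt_0_compat.
      pose proof (h_le f B Hd _ Hxm) as Hh. pose proof (Cmod_ge_0 (f (x * m ^ 2))).
      apply Rle_trans with (Cmod (f (x * m ^ 2))); [nra|].
      eapply Rle_trans; [exact Hh|]. right. simpl (INR 0). field. lra. }
  destruct (usum_ex u _ Hu) as [P HP]. exists P. now apply usum_climit.
Qed.

Lemma Rpower_minus_half x : 0 < x -> Rpower x (- (1 / 2)) = / sqrt x.
Proof.
  intros Hx. rewrite Rpower_Ropp. replace (1 / 2) with (/ 2) by field. now rewrite Rpower_sqrt.
Qed.

(** Converts the diagonal error, obtained on the line of abscissa -3/2, into the error of the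
    off-diagonal parts. *)
Lemma Rpower_three_halves_ratio a q : 0 < a -> 0 < q ->
  / sqrt a * Rpower (a / q) (3 / 2) = / sqrt q * (a / q).
Proof.
  intros Ha Hq. assert (Paq : 0 < a / q) by now apply Rdiv_lt_0_compat.
  replace (3 / 2) with (/ 2 + 1) by field. rewrite Rpower_plus, Rpower_1, Rpower_sqrt by auto.
  rewrite <- (sqrt_ratio a q) by auto. ring.
Qed.

Theorem theorem1p1 (f : R -> C) (F : C -> C) (alpha beta : R)
  (f_smooth : smooth_pos f)
  (strip : 0 <= alpha < beta)
  (F_mellin : forall s : C, alpha < Re s < beta -> is_mellin f s (F s))
  (F_holo : forall s : C, s <> RtoC 0 -> holomorphic_at F s)
  (F_pole : pole_order_le 1 F (RtoC 0))
  (F_decay : rapid_decay_strips F) :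
  (forall r b : Z, (0 < r)%Z -> Z.gcd b r = 1%Z ->
     double_abs_summable (S_term r b f)) /\
  exists c1 c2 c3 : C, forall eps : R, 0 < eps -> exists K : R,
    forall a q : Z, (0 < a)%Z -> (0 < q)%Z -> Z.gcd a q = 1%Z ->
      Cmod (S_sum q a f
            - (RtoC (Rpower (IZR a) (- (1 / 2)))
                 * (c1 * RtoC (ln (IZR q / IZR a)) + c2)
               + c3 * RtoC (Rpower (IZR q) (- (1 / 2)))
               + RtoC (sqrt (IZR a / IZR q)) * S_sum a (- q) f))%C
        <= K * (Rpower (IZR q) (- (1 / 2) + eps) * (IZR a / IZR q)) /\
      Cmod (S_sum q (- a) f
            - (RtoC (sqrt (IZR a / IZR q)) * S_sum a q f
               + c3 * RtoC (Rpower (IZR q) (- (1 / 2)))))%C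
        <= K * (Rpower (IZR q) (- (1 / 2) + eps) * (IZR a / IZR q)).
Proof.
  assert (F_diff : forall s, s <> RtoC 0 -> cdiff F s)
    by (intros s Hs; now apply holomorphic_cdiff, F_holo).
  assert (f_cont : forall x, 0 < x -> ccont f x)
    by (intros x Hx; now apply smooth_pos_ccont).
  (* Any abscissa inside the strip of absolute convergence would do; it is positive because
     [0 <= alpha]. *)
  set (s0 := (alpha + beta) / 2). assert (Hs0 : 0 < s0) by (unfold s0; lra).
  assert (I0 : inverts F s0 f).
  { destruct (F_vertical_bound F F_diff F_decay s0 ltac:(lra)) as [K [_ HK]].
    intros x Hx e He. apply (mellin_inversion f s0 f_cont F) with (K := K); auto.
    - intros t. apply F_mellin. unfold s0; simpl. lra.
    - intros t. apply F_vertical_cont; auto. lra.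
    - intros t. eapply Rle_trans; [|apply (HK t)]. apply Rmult_le_compat_l; [apply Cmod_ge_0|].
      apply Rle_pow; [nra|lia]. }
  (* The shift by 4 reaches an abscissa at least 4 wherever the strip lies. *)
  assert (I4 : inverts F (s0 + 4) f)
    by (apply (shift_to_the_right F F_diff F_decay s0); auto; lra).
  destruct (inverts_left F F_diff F_decay F_pole s0 f Hs0 I0) as [c0 Il].
  destruct (near_0_bound F F_diff F_decay f c0 Il) as [A0 [A0_pos near_0]].
  destruct (decay_bound F F_diff F_decay f c0 (s0 + 4) ltac:(lra) I4 Il) as [B [B_pos decay]].
  destruct (increment_bound F F_diff F_decay f c0 (s0 + 4) ltac:(lra) I4 Il)
    as [A [A_pos increment]].
  destruct (quad_profile F F_diff F_decay f c0 f_cont Il) as [Aq [Aq_pos Hq]].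
  split.
  { intros r b Hr _. now apply (S_term_double_abs_summable f B). }
  set (P := fun x => CSeries (fun k => f (x * (INR k + 1) ^ 2)%R * RtoC (/ (INR k + 1)))%C).
  assert (HP : forall x, 0 < x ->
    climit (csum (fun k => f (x * (INR k + 1) ^ 2)%R * RtoC (/ (INR k + 1)))%C) (P x)).
  { intros x Hx. destruct (diagonal_sum_converges f B x B_pos decay Hx) as [p Hp].
    unfold P. now rewrite (climit_CSeries _ _ Hp). }
  destruct (diagonal_sum_asymptotic f c0 A0 B Aq f_cont A0_pos B_pos Aq_pos near_0 decay Hq P
    (fun x e Hx He => HP x Hx e He)) as [c2 Hc2].
  destruct (usum_product_family_ex f B B_pos decay) as [c3 Hc3].
  (* The diagonal sum at [x = a / q] is [c2 - (c0 / 2) ln x] up to its error, and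
     [- ln (a / q) = ln (q / a)]. *)
  exists (c0 * RtoC (/ 2))%C, c2, c3. intros eps Heps.
  (* Two off-diagonal comparisons at [4 * C1] each, plus the constant of the diagonal
     asymptotics. *)
  set (K := 8 * (32 * (A + B)) + (8 * A0 + 2 * Aq)).
  assert (K_pos : 0 <= K) by (unfold K; lra).
  exists K. intros a q Ha Hq0 _.
  assert (Pa : 0 < IZR a) by now apply IZR_lt. assert (Pq : 0 < IZR q) by now apply IZR_lt.
  assert (Paq : 0 < IZR a / IZR q) by now apply Rdiv_lt_0_compat.
  pose proof (sqrt_lt_R0 _ Pa) as Sa. pose proof (sqrt_lt_R0 _ Pq) as Sq.
  set (E := / sqrt (IZR q) * (IZR a / IZR q)).
  assert (HE : 0 < E) by (apply Rmult_lt_0_compat; auto; now apply Rinv_0_lt_compat).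
  (* [1 <= q] because [q] is a positive integer, so raising the exponent by [eps] can only enlarge
     the power. *)
  assert (Hfin : K * E <= K * (Rpower (IZR q) (- (1 / 2) + eps) * (IZR a / IZR q))).
  { apply Rmult_le_compat_l; auto. apply Rmult_le_compat_r; [lra|].
    rewrite <- Rpower_minus_half by auto. apply Rle_Rpower; [|lra].
    apply IZR_le. lia. }
  rewrite !Rpower_minus_half by auto.
  split; (eapply Rle_trans; [|exact Hfin]).
  - destruct (usum_on_S_family f B B_pos decay q a (diagonal a) Hq0) as [S0 H0].
    destruct (usum_on_S_family f B B_pos decay q a (above a q) Hq0) as [S1 H1].
    destruct (usum_on_S_family f B B_pos decay q a (below a q) Hq0) as [S2 H2].
    rewrite (split_positive f B B_pos decay a q Hq0 S0 S1 S2 H0 H1 H2).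
    rewrite (diagonal_value f a q Ha Hq0 S0 _ H0 (HP _ Paq)).
    assert (B1 := above_estimate f A B A_pos B_pos decay increment a q Ha Hq0 S1 c3 H1 Hc3).
    assert (B2 := below_estimate f A B A_pos B_pos decay increment a q Ha Hq0 S2 H2).
    assert (B0 := Hc2 _ Paq). fold E in B1, B2.
    set (x := IZR a / IZR q) in *.
    replace (ln (IZR q / IZR a)) with (- ln x).
    2:{ unfold x. replace (IZR q / IZR a) with (/ (IZR a / IZR q)) by (field; lra).
        now rewrite ln_Rinv. }
    set (T := (RtoC (sqrt x) * S_sum a (- q) f)%C) in *.
    replace (RtoC (/ sqrt (IZR a)) * P x + S1 + S2 -
       (RtoC (/ sqrt (IZR a)) * (c0 * RtoC (/ 2) * RtoC (- ln x) + c2)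
        + c3 * RtoC (/ sqrt (IZR q)) + T))%C with
      (RtoC (/ sqrt (IZR a)) * (P x - (c2 - c0 * RtoC (/ 2 * ln x)))
       + ((S1 - c3 * RtoC (/ sqrt (IZR q))) + (S2 - T)))%C
      by (rewrite RtoC_mult, RtoC_opp; ring).
    eapply Rle_trans; [apply Cmod_triangle|].
    eapply Rle_trans; [apply Rplus_le_compat_l, Cmod_triangle|].
    assert (Pi : 0 < / sqrt (IZR a)) by now apply Rinv_0_lt_compat.
    rewrite Cmod_mult, Cmod_R, Rabs_right by lra.
    assert (B0' : / sqrt (IZR a) * Cmod (P x - (c2 - c0 * RtoC (/ 2 * ln x)))
       <= (8 * A0 + 2 * Aq) * E).
    { apply Rle_trans with (/ sqrt (IZR a) * ((8 * A0 + 2 * Aq) * Rpower x (3 / 2))).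
      - apply Rmult_le_compat_l; lra.
      - right. unfold E, x. rewrite <- Rpower_three_halves_ratio by auto. ring. }
    unfold K. lra.
  - destruct (usum_on_S_family f B B_pos decay q (- a) (near_side a q) Hq0) as [S1 H1].
    destruct (usum_on_S_family f B B_pos decay q (- a) (far_side a q) Hq0) as [S2 H2].
    rewrite (split_negative f B B_pos decay a q Hq0 S1 S2 H1 H2).
    assert (B1 := near_side_estimate f A B A_pos B_pos decay increment a q Ha Hq0 S1 c3 H1 Hc3).
    assert (B2 := far_side_estimate f A B A_pos B_pos decay increment a q Ha Hq0 S2 H2).
    fold E in B1, B2.
    set (T := (RtoC (sqrt (IZR a / IZR q)) * S_sum a q f)%C) in *.
    replace (S1 + S2 - (T + c3 * RtoC (/ sqrt (IZR q))))%C with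
      ((S1 - c3 * RtoC (/ sqrt (IZR q))) + (S2 - T))%C by ring.
    eapply Rle_trans; [apply Cmod_triangle|]. unfold K.
    assert (0 <= (8 * A0 + 2 * Aq) * E) by (apply Rmult_le_pos; lra). lra.
Qed.
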